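(* For every integer $N\geq 1$, the probability measure $\mu_N$ on $E_N$ is invariant under the flow $\Phi$ of the equation (CR) restricted to $E_N$. Consequently $\mu_N$-almost every $u_0\in E_N$ is recurrent in the following sense: for $\mu_N$-almost all $u_0\in E_N$ there exists a sequence of times $t_n\to+\infty$ such that $$\lim_{n\to+\infty}\big\|\Phi(t_n)u_0-u_0\big\|_{L^2(\mathbb{R}^2)}=0 .$$
   Context: Let $H=-\Delta+|x|^2$ be the harmonic oscillator on $\mathbb{R}^2$. It is self-adjoint on $L^2(\mathbb{R}^2)$ with spectrum $\{2N+2: N\in\mathbb{N}\}$ ($\mathbb{N}$ includes $0$); $E_N$ denotes the eigenspace for the eigenvalue $2N+2$, which has complex dimension $N+1$. The continuous resonant equation (CR) is $i\partial_t u=\mathcal{T}(u,u,u)$, $u(0)=f$, for $(t,x)\in\mathbb{R}\times\mathbb{R}^2$, where $$\mathcal{T}(f_1,f_2,f_3)=2\pi\int_{-\pi/4}^{\pi/4} e^{i\tau H}\Big[(e^{-i\tau H}f_1)(e^{-i\tau H}f_2)\overline{(e^{-i\tau H}f_3)}\Big]\,d\tau .$$ It is known that (CR) is globally well-posed in $L^2(\mathbb{R}^2)$ and that its flow $\Phi(t)$ leaves each $E_N$ stable. Let $(\varphi_{N,k})_{0\le k\le N}$ be an orthonormal basis of $E_N$, let $g_{N,k}$, $0\le k\le N$, be independent standard complex Gaussians on a probability space $(\Omega,\mathcal{F},\mathbf{p})$ (density $\frac1\pi e^{-|z|^2}$ on $\mathbb{C}$), and set $$\gamma_N(\omega,x)=\frac{1}{\sqrt{N+1}}\sum_{k=0}^N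 g_{N,k}(\omega)\varphi_{N,k}(x).$$ Then $\mu_N:=\mathbf{p}\circ\gamma_N^{-1}$ is the law of $\gamma_N$ on $E_N$ (it does not depend on the choice of basis). *)

(* Defs.v *)
From HB Require Import structures.
From mathcomp Require Import all_boot all_order all_algebra.
From mathcomp Require Import all_classical all_reals all_analysis.
From mathcomp Require Import measurable_realfun complex.
From mathcomp Require Import ring lra.

Set Implicit Arguments.
Unset Strict Implicit.
Unset Printing Implicit Defensive.
Import Order.TTheory GRing.Theory Num.Theory.
Import numFieldNormedType.Exports.

Local Open Scope classical_set_scope.
Local Open Scope ring_scope.
Local Open Scope complex_scope.

(* [measurableTypeR R] is [R] with the Borel sigma-algebra on which
   [lebesgue_measure] is defined. *)
Notation plane R := (measurableTypeR R * measurableTypeR R)%type.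

Definition leb2 (R : realType) : {measure set (plane R) -> \bar R} :=
  (@lebesgue_measure R \x @lebesgue_measure R)%E.

Section L2.
Context {R : realType}.
Implicit Types u v : plane R -> R[i].

(* Elements of L^2(R^2) are represented by square integrable functions; they
   are only ever compared through almost everywhere equality, the inner product
   and the L^2 norm. *)
Definition L2norm u : \bar R :=
  Lnorm (leb2 R) 2%:E (fun x => (Normc.normc (u x))%:E).

Definition L2 u : Prop :=
  [/\ measurable_fun setT (fun x => complex.Re (u x)),
      measurable_fun setT (fun x => complex.Im (u x)) & (L2norm u < +oo)%E].

Definition cintegral d (T : measurableType d) (mu : {measure set T -> \bar R})
    (D : set T) (f : T -> R[i]) : R[i] :=
  (\int[mu]_(x in D) complex.Re (f x)) +i*
  (\int[mu]_(x in D) complex.Im (f x)).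

Definition inner u v : R[i] :=
  cintegral (leb2 R) setT (fun x => u x * (v x)^*).

End L2.

Section harmonic_oscillator.
Context {R : realType}.
Implicit Types (f : plane R -> R) (u v : plane R -> R[i]).

Definition e1 : plane R := (1, 0).
Definition e2 : plane R := (0, 1).

(* f is of class C^n: all iterated partial derivatives of order at most n exist
   and those of order n are continuous. *)
Fixpoint classC (n : nat) f : Prop :=
  if n is m.+1 then
    [/\ forall x, derivable f x e1, forall x, derivable f x e2,
        classC m ('D_e1 f) & classC m ('D_e2 f)]
  else continuous f.

Definition smooth f : Prop := forall n, classC n f.

Definition test_function u : Prop :=
  [/\ smooth (fun x => complex.Re (u x)), smooth (fun x => complex.Im (u x)) &
      exists r : R, forall x, r < `|x| -> u x = 0].

Definition laplacian f : plane R -> R :=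
  fun x => 'D_e1 ('D_e1 f) x + 'D_e2 ('D_e2 f) x.

Definition Hop_real f : plane R -> R :=
  fun x => - laplacian f x + (x.1 ^+ 2 + x.2 ^+ 2) * f x.

Definition Hop u : plane R -> R[i] := fun x =>
  Hop_real (fun y => complex.Re (u y)) x +i*
  Hop_real (fun y => complex.Im (u y)) x.

(* [Hgraph u v] : u is in the domain of the self-adjoint operator H and
   H u = v. The self-adjoint realization is the L^2 closure of
   -Laplacian + |x|^2 acting on compactly supported smooth functions, on which
   it is essentially self-adjoint. *)
Definition Hgraph u v : Prop :=
  [/\ L2 u, L2 v & exists w : nat -> plane R -> R[i],
    [/\ forall n, test_function (w n),
        (fun n => L2norm (fun x => w n x - u x)) @ \oo --> 0%E &
        (fun n => L2norm (fun x => Hop (w n) x - v x)) @ \oo --> 0%E]].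

Definition eigenvalue_H (N : nat) : R := (2 * N + 2)%N%:R.

Definition eigenfunction (N : nat) u : Prop :=
  Hgraph u (fun x => (eigenvalue_H N)%:C * u x).

End harmonic_oscillator.

Section proofs.
Context {R : realType}.
Implicit Types (f g : plane R -> R) (u v : plane R -> R[i]).

Lemma countable_cover_measurable d (T : measurableType d) (I : countType)
    (B : I -> set T) (A : set T) :
  (forall i, measurable (B i)) ->
  (forall x, A x -> exists2 i, B i x & B i `<=` A) -> measurable A.
Proof.
move=> mB cA.
pose F i := [set x | B i x /\ B i `<=` A].
have -> : A = \bigcup_i F i.
  by apply/seteqP; split => [x /cA[i Bx BA]|x [i _ [Bx]]]; [exists i|apply].
apply: countable_bigcupT_measurable => // i; rewrite /F.
have [BA|BA] := pselect (B i `<=` A).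
  by rewrite (_ : [set x | _] = B i)//; apply/seteqP; split => // x [].
by rewrite (_ : [set x | _] = set0)//; apply/seteqP; split => // x [].
Qed.

Definition qbox (q : rat * rat * nat) : set (plane R) :=
  [set` `]ratr q.1.1 - q.2.+1%:R^-1, ratr q.1.1 + q.2.+1%:R^-1[%R] `*`
  [set` `]ratr q.1.2 - q.2.+1%:R^-1, ratr q.1.2 + q.2.+1%:R^-1[%R].

Lemma rat_approx (x e : R) : 0 < e -> exists q : rat, `|ratr q - x| < e.
Proof.
move=> e0.
have /rat_in_itvoo[q] : x - e < x + e by lra.
rewrite inE/= => /itvP qxe; exists q.
by rewrite ltr_distl !qxe.
Qed.

Lemma itv_approx (q x d : R) : `|q - x| < d -> q - d < x < q + d.
Proof. by rewrite ltr_distl => /andP[? ?]; apply/andP; split; lra. Qed.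

Lemma itv_dist (q x y d e : R) :
  `|q - x| < d -> q - d < y < q + d -> d < e / 2 -> `|x - y| < e.
Proof.
by rewrite !ltr_distl => /andP[? ?] /andP[? ?] ?; apply/andP; split; lra.
Qed.

Lemma open2_measurable (A : set (plane R)) : open A -> measurable A.
Proof.
move=> oA; apply: (@countable_cover_measurable _ _ _ qbox) => [q|x Ax].
  by apply: measurableX; exact: measurable_itv.
have /nbhs_ballP[e /= e0 eA] := open_nbhs_nbhs (conj oA Ax).
have [n n0] : exists n : nat, n.+1%:R^-1 < e / 2.
  have e20 : 0 < e / 2 by rewrite divr_gt0.
  near \oo => n; exists n; near: n.
  exact: (near_infty_natSinv_lt (PosNum e20)).
have npos : 0 < n.+1%:R^-1 :> R by rewrite invr_gt0.
have [p1 h1] := rat_approx x.1 npos.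
have [p2 h2] := rat_approx x.2 npos.
exists (p1, p2, n); first by split; rewrite /= in_itv; exact: itv_approx.
move=> y [/=]; rewrite !in_itv/= => y1 y2; apply: eA.
by split; [exact: (itv_dist h1 y1 n0)|exact: (itv_dist h2 y2 n0)].
Unshelve. all: by end_near. Qed.

Lemma continuous2_measurable f : continuous f -> measurable_fun setT f.
Proof.
move=> cf; apply: (measurability _ (measurable_realfun.RGenOpens.measurableE R)) => //.
move=> _ [_ [a [b ->] <-]]; rewrite setTI; apply: open2_measurable.
by apply: open_comp => // x _; exact: cf.
Qed.


Lemma ReD (a z w : R[i]) : complex.Re (a * z + w) =
  complex.Re a * complex.Re z - complex.Im a * complex.Im z + complex.Re w.
Proof. by case: a z w => [? ?] [? ?] [? ?]. Qed.

Lemma ImD (a z w : R[i]) : complex.Im (a * z + w) =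
  complex.Re a * complex.Im z + complex.Im a * complex.Re z + complex.Im w.
Proof. by case: a z w => [? ?] [? ?] [? ?]. Qed.

Definition cmeasurable u :=
  measurable_fun setT (fun x => complex.Re (u x)) /\
  measurable_fun setT (fun x => complex.Im (u x)).

Lemma cmeasurable_lin (a : R[i]) u v : cmeasurable u -> cmeasurable v ->
  cmeasurable (fun x => a * u x + v x).
Proof.
move=> [u1 u2] [v1 v2]; split.
  under eq_fun do rewrite ReD.
  by apply: measurable_funD => //; apply: measurable_funB; exact: measurable_funM.
under eq_fun do rewrite ImD.
by apply: measurable_funD => //; apply: measurable_funD; exact: measurable_funM.
Qed.

Lemma measurable_normc u : cmeasurable u ->
  measurable_fun setT (fun x => Normc.normc (u x)).
Proof.
move=> [u1 u2].
rewrite (_ : (fun _ => _) = Num.sqrt \o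
  (fun x => complex.Re (u x) ^+ 2 + complex.Im (u x) ^+ 2)); last first.
  by apply/funext => x /=; case: (u x).
apply: measurableT_comp.
  by apply: continuous_measurable_fun; exact: sqrt_continuous.
by apply: measurable_funD; exact: measurable_funX.
Qed.

Lemma normc_ge0 (z : R[i]) : 0 <= Normc.normc z.
Proof. by case: z => a b; exact: sqrtr_ge0. Qed.

Lemma normcD (z w : R[i]) :
  Normc.normc (z + w) <= Normc.normc z + Normc.normc w.
Proof.
have := ler_normD z w; rewrite !normc_def.
by case: z w => [a b] [c d]; rewrite -rmorphD lecR.
Qed.

Lemma normc_le (z : R[i]) :
  Normc.normc z <= `|complex.Re z| + `|complex.Im z|.
Proof.
case: z => a b /=.
rewrite [leRHS](_ : _ = Num.sqrt ((`|a| + `|b|) ^+ 2)); last first.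
  by rewrite sqrtr_sqr (ger0_norm (addr_ge0 (normr_ge0 a) (normr_ge0 b))).
rewrite ler_wsqrtr//.
rewrite sqrrD !real_normK ?num_real//.
have : 0 <= `|a| * `|b| by rewrite mulr_ge0.
rewrite mulr2n; lra.
Qed.

Lemma Lnorm_le f g : measurable_fun setT f -> measurable_fun setT g ->
  (forall x, 0 <= f x <= g x) ->
  (Lnorm (leb2 R) 2%:E (EFin \o f) <= Lnorm (leb2 R) 2%:E (EFin \o g))%E.
Proof.
move=> mf mg fg; rewrite unlock.
have p0 (h : plane R -> R) : measurable_fun setT h -> measurable_fun setT
    (fun x => (`|(EFin \o h) x| `^ 2)%E : \bar R).
  move=> mh; apply: (measurableT_comp (measurable_poweR 2)).
  by apply: measurableT_comp => //; exact: measurableT_comp.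
apply: gt0_ler_poweR; rewrite ?invr_ge0//.
- by rewrite in_itv/= leey andbT integral_ge0// => x _; exact: poweR_ge0.
- by rewrite in_itv/= leey andbT integral_ge0// => x _; exact: poweR_ge0.
apply: ge0_le_integral => //; [by move=> x _; exact: poweR_ge0|exact: p0|exact: p0|].
move=> x _; have /andP[f0 fgx] := fg x.
apply: gt0_ler_poweR => //=; rewrite ?in_itv/= ?leey ?lee_fin ?normr_ge0//.
by rewrite !ger0_norm// (le_trans f0).
Qed.

Lemma LnormZ_ge0 (a : R) f : 0 <= a -> measurable_fun setT f ->
  (Lnorm (leb2 R) 2%:E (fun x => (a * f x)%:E) =
   a%:E * Lnorm (leb2 R) 2%:E (EFin \o f))%E.
Proof.
move=> a0 mf; rewrite unlock.
under eq_integral => x _.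
  rewrite EFinM abseM poweRM// (_ : `|a%:E| = a%:E)%E; last first.
    by rewrite abse_EFin ger0_norm.
  rewrite poweR_EFin.
  over.
rewrite ge0_integralZl_EFin//.
- rewrite poweRM ?lee_fin ?powR_ge0 ?integral_ge0//.
    by rewrite poweR_EFin -powRrM mulfV ?powRr1.
  by move=> x _; exact: poweR_ge0.
- by move=> x _; exact: poweR_ge0.
- apply: (measurableT_comp (measurable_poweR 2)).
  by apply: measurableT_comp => //; apply: measurableT_comp.
- exact: powR_ge0.
Qed.

Lemma L2norm_ge0 u : (0 <= L2norm u)%E.
Proof. exact: Lnorm_ge0. Qed.

Lemma L2norm_lin (a : R[i]) u v : cmeasurable u -> cmeasurable v ->
  (L2norm (fun x => (a * u x + v x)%R)
   <= (Normc.normc a)%:E * L2norm u + L2norm v)%E.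
Proof.
move=> mu mv; have nu := measurable_normc mu; have nv := measurable_normc mv.
have ma : measurable_fun setT (fun x => Normc.normc a * Normc.normc (u x)).
  exact: measurable_funM.
apply: (@le_trans _ _ (Lnorm (leb2 R) 2%:E (EFin \o
    ((fun x => Normc.normc a * Normc.normc (u x)) \+
     (fun x => Normc.normc (v x)))))).
  apply: Lnorm_le.
  - exact: (measurable_normc (cmeasurable_lin a mu mv)).
  - exact: measurable_funD.
  - by move=> x; rewrite normc_ge0/= (le_trans (normcD _ _))// Normc.normcM.
rewrite (le_trans (eminkowski _ _ _ _))//; first by rewrite lee_fin ler1n.
by rewrite leeD2r// LnormZ_ge0// normc_ge0.
Qed.

Lemma L2_cmeasurable u : L2 u -> cmeasurable u.
Proof. by case. Qed.

Lemma L2_lin (a : R[i]) u v : L2 u -> L2 v -> L2 (fun x => a * u x + v x).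
Proof.
move=> Lu Lv; have [mu mv] := (L2_cmeasurable Lu, L2_cmeasurable Lv).
have [m1 m2] := cmeasurable_lin a mu mv; split => //.
apply: (le_lt_trans (L2norm_lin a mu mv)).
case: Lu Lv => [_ _ Lu] [_ _ Lv].
rewrite lte_add_pinfty// lte_mul_pinfty// ?lee_fin ?normc_ge0//.
Qed.

Lemma deriv_lin (e : plane R) (a b : R) f g :
  (forall x, derivable f x e) -> (forall x, derivable g x e) ->
  (forall x, derivable (fun y => a * f y + b * g y) x e) /\
  'D_e (fun y => a * f y + b * g y) = (fun y => a * 'D_e f y + b * 'D_e g y).
Proof.
move=> df dg.
have E : (fun y => a * f y + b * g y) = (a \*: f) + (b \*: g) by [].
split=> [x|]; first by rewrite E; apply: derivableD; exact: derivableZ.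
by apply/funext => x; rewrite E deriveD ?deriveZ//; exact: derivableZ.
Qed.

Lemma classC_lin n (a b : R) f g : classC n f -> classC n g ->
  classC n (fun y => a * f y + b * g y).
Proof.
elim: n f g => [|n IH] f g /=.
  move=> cf cg x; apply: cvgD; apply: cvgM;
    by [exact: cvg_cst|exact: cf|exact: cg].
move=> [f1 f2 f3 f4] [g1 g2 g3 g4].
have [d1 E1] := deriv_lin a b f1 g1; have [d2 E2] := deriv_lin a b f2 g2.
by split=> //; rewrite ?E1 ?E2; exact: IH.
Qed.

Lemma smooth_lin (a b : R) f g : smooth f -> smooth g ->
  smooth (fun y => a * f y + b * g y).
Proof. by move=> sf sg n; exact: classC_lin. Qed.

Lemma smooth_cont f : smooth f -> continuous f.
Proof. by move=> /(_ 0%N). Qed.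

Lemma smooth_D1 f : smooth f -> smooth ('D_e1 f).
Proof. by move=> sf n; have [] := sf n.+1. Qed.

Lemma smooth_D2 f : smooth f -> smooth ('D_e2 f).
Proof. by move=> sf n; have [] := sf n.+1. Qed.

Lemma Hop_alg (a b s t s' t' z f g : R) :
  - ((a * s + b * t) + (a * s' + b * t')) + z * (a * f + b * g) =
  a * (- (s + s') + z * f) + b * (- (t + t') + z * g).
Proof. by ring. Qed.

Lemma Hop_real_lin (a b : R) f g : smooth f -> smooth g ->
  Hop_real (fun y => a * f y + b * g y) =
  (fun x => a * Hop_real f x + b * Hop_real g x).
Proof.
move=> sf sg; rewrite /Hop_real /laplacian.
have [[f1 f2 _ _] [g1 g2 _ _]] := (sf 1%N, sg 1%N).
have [[f11 _ _ _] [g11 _ _ _]] := (smooth_D1 sf 1%N, smooth_D1 sg 1%N).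
have [[_ f22 _ _] [_ g22 _ _]] := (smooth_D2 sf 1%N, smooth_D2 sg 1%N).
rewrite (deriv_lin a b f1 g1).2 (deriv_lin a b f2 g2).2.
apply/funext => x; rewrite -Hop_alg; congr (- (_ + _) + _).
  exact: (congr1 (fun h => h x) (deriv_lin a b f11 g11).2).
exact: (congr1 (fun h => h x) (deriv_lin a b f22 g22).2).
Qed.

Lemma measurable_Hop_real f : smooth f -> measurable_fun setT (Hop_real f).
Proof.
move=> sf.
have m1 := continuous2_measurable (smooth_cont (smooth_D1 (smooth_D1 sf))).
have m2 := continuous2_measurable (smooth_cont (smooth_D2 (smooth_D2 sf))).
have mf := continuous2_measurable (smooth_cont sf).
have mL : measurable_fun setT (laplacian f) by exact: measurable_funD m1 m2.
have mN : measurable_fun setT (fun x => - laplacian f x).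
  exact: measurableT_comp.
have m3 : measurable_fun setT (fun x : plane R => x.1 ^+ 2 + x.2 ^+ 2).
  by apply: measurable_funD; apply: measurable_funX.
exact: measurable_funD mN (measurable_funM m3 mf).
Qed.

Lemma test_function_lin (a : R[i]) u v : test_function u -> test_function v ->
  test_function (fun x => a * u x + v x) /\
  Hop (fun x => a * u x + v x) = (fun x => a * Hop u x + Hop v x).
Proof.
move=> [u1 u2 [r ur]] [v1 v2 [s vs]].
have ReE : (fun x => complex.Re (a * u x + v x)) = (fun x =>
    1 * (complex.Re a * complex.Re (u x) + (- complex.Im a) * complex.Im (u x))
    + 1 * complex.Re (v x)).
  by apply/funext => x; rewrite ReD; ring.
have ImE : (fun x => complex.Im (a * u x + v x)) = (fun x =>
    1 * (complex.Re a * complex.Im (u x) + complex.Im a * complex.Re (u x))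
    + 1 * complex.Im (v x)).
  by apply/funext => x; rewrite ImD; ring.
split; first split.
- by rewrite ReE; do 2 apply: smooth_lin => //.
- by rewrite ImE; do 2 apply: smooth_lin => //.
- exists (Num.max r s) => x; rewrite gt_max => /andP[rx sx].
  by rewrite ur// vs// mulr0 addr0.
apply/funext => x; rewrite /Hop ReE ImE.
rewrite !Hop_real_lin//; try exact: smooth_lin.
by case: a {ReE ImE} => a b; apply/eqP; rewrite eq_complex/=;
  apply/andP; split; apply/eqP; ring.
Qed.

Lemma test_cmeasurable u : test_function u -> cmeasurable u.
Proof.
move=> [u1 u2 _]; split.
  exact: (continuous2_measurable (smooth_cont u1)).
exact: (continuous2_measurable (smooth_cont u2)).
Qed.

Lemma Hop_cmeasurable u : test_function u -> cmeasurable (Hop u).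
Proof.
move=> [u1 u2 _]; split.
  exact: (measurable_Hop_real u1).
exact: (measurable_Hop_real u2).
Qed.

Lemma cvg_lin (a : R[i]) (w z : nat -> plane R -> R[i]) u v :
  (forall n, cmeasurable (w n)) -> (forall n, cmeasurable (z n)) ->
  cmeasurable u -> cmeasurable v ->
  (fun n => L2norm (fun x => w n x - u x)) @ \oo --> 0%E ->
  (fun n => L2norm (fun x => z n x - v x)) @ \oo --> 0%E ->
  (fun n => L2norm (fun x => (a * w n x + z n x) - (a * u x + v x)))
    @ \oo --> 0%E.
Proof.
move=> mw mz mu mv wu zv.
have sub s t : cmeasurable s -> cmeasurable t ->
    cmeasurable (fun x => s x - t x).
  move=> ms mt; have := cmeasurable_lin (-1) mt ms.
  by congr cmeasurable; apply/funext => x; rewrite mulN1r addrC.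
apply: (@squeeze_cvge _ _ _ _ (cst 0%E) _ (fun n =>
   (Normc.normc a)%:E * L2norm (fun x => (w n x - u x)%R)
   + L2norm (fun x => (z n x - v x)%R))%E).
- apply: nearW => n; rewrite L2norm_ge0/=.
  rewrite (_ : (fun x => _) =
    (fun x => a * (w n x - u x) + (z n x - v x))); last first.
    by apply/funext => x; ring.
  by apply: L2norm_lin; exact: sub.
- exact: cvg_cst.
- rewrite -[X in _ --> X](adde0 0%E); apply: cvgeD => //.
  by rewrite -[X in _ --> X](mule0 (Normc.normc a)%:E); exact: cvgeZl.
Qed.

Lemma Hgraph_lin (a : R[i]) u v u' v' : Hgraph u v -> Hgraph u' v' ->
  Hgraph (fun x => a * u x + u' x) (fun x => a * v x + v' x).
Proof.
move=> [Lu Lv [w [tw wu Hw]]] [Lu' Lv' [z [tz zu Hz]]].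
split; [exact: L2_lin|exact: L2_lin|].
exists (fun n x => a * w n x + z n x); split.
- by move=> n; exact: (test_function_lin _ _ _).1.
- apply: cvg_lin => //; by [move=> n; exact: test_cmeasurable|
    exact: L2_cmeasurable].
- rewrite (_ : (fun n => _) = (fun n => L2norm (fun x =>
      (a * Hop (w n) x + Hop (z n) x) - (a * v x + v' x)))); last first.
    by apply/funext => n; rewrite (test_function_lin a (tw n) (tz n)).2.
  apply: cvg_lin => //; by [move=> n; exact: Hop_cmeasurable|
    exact: L2_cmeasurable].
Qed.

Lemma eigenfunction_lin N (a : R[i]) u v :
  eigenfunction N u -> eigenfunction N v ->
  eigenfunction N (fun x => a * u x + v x).
Proof.
move=> eu ev; have := Hgraph_lin a eu ev; rewrite /eigenfunction.
by congr Hgraph; apply/funext => x; ring.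
Qed.

Lemma eigenfunction_L2 N u : eigenfunction N u -> L2 u.
Proof. by case. Qed.

Lemma eigenfunction_comb N n (c : 'I_n.+1 -> R[i])
    (phi : 'I_n.+1 -> plane R -> R[i]) (s : seq 'I_n.+1) :
  (forall k, eigenfunction N (phi k)) ->
  eigenfunction N (fun x => \sum_(k <- s) c k * phi k x) /\
  (L2norm (fun x => (\sum_(k <- s) c k * phi k x)%R) <=
   \sum_(k <- s) (Normc.normc (c k))%:E * L2norm (phi k))%E.
Proof.
move=> ep; elim: s => [|k s [IH1 IH2]].
  have E : (fun x => \sum_(k <- [::]) c k * phi k x) = (fun=> 0).
    by apply/funext => x; rewrite big_nil.
  rewrite E big_nil; split.
    have := eigenfunction_lin (-1) (ep ord0) (ep ord0).
    by congr eigenfunction; apply/funext => x; rewrite mulN1r addNr.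
  rewrite /L2norm (_ : (fun=> _) = cst 0%E) ?Lnorm0//.
  by apply/funext => x; rewrite Normc.normc0.
have E : (fun x => \sum_(k <- k :: s) c k * phi k x) =
    (fun x => c k * phi k x + \sum_(k <- s) c k * phi k x).
  by apply/funext => x; rewrite big_cons.
rewrite E big_cons; split; first exact: eigenfunction_lin.
apply: (le_trans (L2norm_lin _ _ _)); [
  exact/L2_cmeasurable/eigenfunction_L2|
  exact/L2_cmeasurable/eigenfunction_L2/IH1|exact: leeD2l].
Qed.
End proofs.

Section propagator.
Context {R : realType}.
Implicit Types (f g : plane R -> R[i]) (tau : R).

(* p is the orthogonal projection of f onto the eigenspace E_M. *)
Definition eigenprojection (M : nat) f p : Prop :=
  eigenfunction M p /\
  forall q, eigenfunction M q -> inner (fun x => f x - p x) q = 0.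

Definition cis (theta : R) : R[i] := cos theta +i* sin theta.

(* [propagator tau f g] : e^{i tau H} f = g, where, H having the pure point
   spectrum {2M+2}, e^{i tau H} f is the sum in L^2 of the
   e^{i tau (2M+2)} Pi_M f. *)
Definition propagator tau f g : Prop :=
  [/\ L2 f, L2 g & exists p : nat -> plane R -> R[i],
    (forall M, eigenprojection M f (p M)) /\
    (fun n => L2norm (fun x =>
       (\sum_(M < n) cis (tau * eigenvalue_H M) * p M x) - g x)) @ \oo --> 0%E].

Definition window : set R := `[- (pi / 4), pi / 4].

(* [CR_trilinear f1 f2 f3 w] : the expression T(f1, f2, f3) is defined and equal
   to w. The L^2-valued integral over tau is a Bochner integral: the integrand
   [G] is weakly measurable (equivalently strongly measurable, L^2 being
   separable), its norm is integrable, and the integral is determined by its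
   inner products. *)
Definition CR_trilinear f1 f2 f3 w : Prop :=
  L2 w /\ exists G : R -> plane R -> R[i],
    [/\ {ae @lebesgue_measure R, forall tau, window tau ->
          exists v1 v2 v3,
            [/\ propagator (- tau) f1 v1, propagator (- tau) f2 v2,
                propagator (- tau) f3 v3 &
                propagator tau (fun x => v1 x * v2 x * (v3 x)^*) (G tau)]},
        forall tau, L2 (G tau),
        (@lebesgue_measure R).-integrable window (fun tau => L2norm (G tau)) &
        forall h, L2 h ->
          [/\ measurable_fun window (fun tau => complex.Re (inner (G tau) h)),
              measurable_fun window (fun tau => complex.Im (inner (G tau) h)) &
              inner w h = (2 * pi)%:C *
                cintegral (@lebesgue_measure R) window
                  (fun tau => inner (G tau) h)]].

(* i u' = T(u, u, u), the time derivative being taken in L^2. *)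
Definition CR_solution (u : R -> plane R -> R[i]) : Prop :=
  forall t, L2 (u t) /\ exists w, CR_trilinear (u t) (u t) (u t) w /\
    (fun h : R => L2norm (fun x =>
       'i * ((h^-1)%:C * (u (t + h) x - u t x)) - w x)) @ 0^' --> 0%E.

End propagator.

Section Heigenspace.
Variable R : realType.

Definition Heigenspace (N : nat) : Type :=
  {u : plane R -> R[i] | eigenfunction N u}.

Definition Heigenspace_fun N (u : Heigenspace N) : plane R -> R[i] := sval u.
Coercion Heigenspace_fun : Heigenspace >-> Funclass.

Definition Heigenspace_open N : set (set (Heigenspace N)) :=
  [set A : set (Heigenspace N) | forall u : Heigenspace N, A u ->
     exists2 e : R, 0 < e & forall v : Heigenspace N,
       (L2norm (fun x => (v x - u x)%R) < e%:E)%E -> A v].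

Lemma classC0 n : classC n (fun=> 0 : R).
Proof.
elim: n => [|n IH] /=; first by move=> x; exact: cvg_cst.
have D (e : plane R) : 'D_e (fun=> 0 : R) = (fun=> 0).
  by apply/funext => x; rewrite derive_cst.
by split=> [x|x||]; rewrite ?D//; exact: derivable_cst.
Qed.

Lemma L2norm0 : L2norm (fun=> 0 : R[i]) = 0%E.
Proof.
rewrite /L2norm (_ : (fun=> _) = cst 0%E) ?Lnorm0//.
by apply/funext => x; rewrite Normc.normc0.
Qed.

Lemma eigenfunction0 N : eigenfunction N (fun=> 0 : R[i]).
Proof.
have t0 : test_function (fun=> 0 : R[i]).
  split; [by move=> n; exact: classC0|by move=> n; exact: classC0|].
  by exists 0.
have H0 : Hop (fun=> 0 : R[i]) = (fun=> 0).
  have := (test_function_lin (-1) t0 t0).2.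
  have -> : (fun x : plane R => -1 * 0 + 0 : R[i]) = (fun=> 0).
    by apply/funext => x; rewrite mulr0 addr0.
  by move=> {1}->; apply/funext => x; rewrite mulN1r addNr.
have L0 : L2 (fun=> 0 : R[i]).
  by split; [exact: measurable_cst|exact: measurable_cst|rewrite L2norm0].
rewrite /eigenfunction.
have -> : (fun x : plane R => (eigenvalue_H N)%:C * 0 : R[i]) = (fun=> 0).
  by apply/funext => x; rewrite mulr0.
split=> //; exists (fun _ _ => 0); split => //.
  under eq_fun do under eq_fun do rewrite subrr.
  by rewrite L2norm0; exact: cvg_cst.
rewrite H0; under eq_fun do under eq_fun do rewrite subrr.
by rewrite L2norm0; exact: cvg_cst.
Qed.

HB.instance Definition _ N := gen_eqMixin (Heigenspace N).
HB.instance Definition _ N := gen_choiceMixin (Heigenspace N).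
HB.instance Definition _ N := isPointed.Build (Heigenspace N)
  (exist _ _ (@eigenfunction0 N)).

(* The Borel sigma-algebra of the L^2 norm. *)
HB.instance Definition _ N := Measurable.copy (Heigenspace N)
  (g_sigma_algebraType (@Heigenspace_open N)).

End Heigenspace.

Section gaussian.
Context d (Omega : measurableType d) (R : realType) (P : probability Omega R).
Implicit Types (X : {RV P >-> plane R}).

(* Complex random variables are represented by R^2-valued ones. *)
Definition to_complex (z : plane R) : R[i] := z.1 +i* z.2.

Definition std_complex_gaussian X : Prop :=
  forall A, measurable A -> distribution P X A =
    (\int[leb2 R]_(z in A) (pi^-1 * expR (- (z.1 ^+ 2 + z.2 ^+ 2)))%:E)%E.

Definition independent_family n (X : 'I_n -> {RV P >-> plane R}) : Prop :=
  forall (J : {set 'I_n}) (A : 'I_n -> set (plane R)),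
    (forall k, measurable (A k)) ->
    P [set w | forall k, k \in J -> A k (X k w)] =
    (\prod_(k in J) P (X k @^-1` A k))%E.

Section gammaN.
Variables (N : nat) (phi : 'I_N.+1 -> Heigenspace R N)
  (g : 'I_N.+1 -> {RV P >-> plane R}).

Definition gammaN_fun (w : Omega) : plane R -> R[i] := fun x =>
  ((Num.sqrt N.+1%:R)^-1)%:C * \sum_(k < N.+1) to_complex (g k w) * phi k x.

Lemma gammaN_sub w w' : (fun x => gammaN_fun w x - gammaN_fun w' x) = (fun x =>
  \sum_(k < N.+1) (((Num.sqrt N.+1%:R)^-1)%:C *
     (to_complex (g k w) - to_complex (g k w'))) * phi k x).
Proof.
apply/funext => x; rewrite /gammaN_fun -mulrBr -sumrB mulr_sumr.
by apply: eq_bigr => k _; rewrite -mulrBl mulrA.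
Qed.

Lemma gammaN_eigenfunction w : eigenfunction N (gammaN_fun w).
Proof.
have e k : eigenfunction N (phi k) by exact: (svalP (phi k)).
have := (eigenfunction_comb (fun k => ((Num.sqrt N.+1%:R)^-1)%:C *
  to_complex (g k w)) (index_enum 'I_N.+1) e).1.
congr eigenfunction; apply/funext => x; rewrite /gammaN_fun mulr_sumr.
by apply: eq_bigr => k _; rewrite mulrA.
Qed.

Definition gammaN (w : Omega) : Heigenspace R N :=
  exist _ _ (gammaN_eigenfunction w).

Let dist k (w : Omega) (q : rat * rat) : R :=
  `|(g k w).1 - ratr q.1| + `|(g k w).2 - ratr q.2|.
Let M k : R := fine (L2norm (phi k)).
Let K (w : Omega) (q : {ffun 'I_N.+1 -> rat * rat}) : R :=
  \sum_(k < N.+1) dist k w (q k) * M k.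

Let M_ge0 k : 0 <= M k.
Proof. by rewrite fine_ge0// L2norm_ge0. Qed.

Let MK k : L2norm (phi k) = (M k)%:E.
Proof.
have [_ _ h] := eigenfunction_L2 (svalP (phi k)).
by rewrite fineK// ge0_fin_numE ?L2norm_ge0.
Qed.

Let tri (a b q : R) : `|a - b| <= `|a - q| + `|b - q|.
Proof. by rewrite (distrC b q); exact: ler_distD. Qed.

Let norm_dist k w w' (q : rat * rat) :
  Normc.normc (((Num.sqrt N.+1%:R)^-1)%:C *
     (to_complex (g k w) - to_complex (g k w')) : R[i])
  <= dist k w q + dist k w' q.
Proof.
rewrite Normc.normcM.
have -> : Normc.normc ((Num.sqrt N.+1%:R)^-1)%:C = (Num.sqrt N.+1%:R)^-1 :> R.
  by rewrite /= expr0n/= addr0 sqrtr_sqr ger0_norm// invr_ge0 sqrtr_ge0.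
have s1 : (Num.sqrt N.+1%:R)^-1 <= 1 :> R.
  rewrite invf_le1 ?sqrtr_gt0//.
  by rewrite -[leLHS]sqrtr1 ler_wsqrtr// ler1n.
apply: (@le_trans _ _
  (1 * Normc.normc (to_complex (g k w) - to_complex (g k w')))).
  by rewrite ler_wpM2r// normc_ge0.
rewrite mul1r (le_trans (normc_le _))//= /dist.
by rewrite addrACA; apply: lerD; exact: tri.
Qed.

Let gammaN_dist w w' q :
  (L2norm (fun x => (gammaN_fun w x - gammaN_fun w' x)%R) <= (K w q + K w' q)%:E)%E.
Proof.
have e k : eigenfunction N (phi k) by exact: (svalP (phi k)).
rewrite gammaN_sub (le_trans (eigenfunction_comb _ _ e).2)//.
rewrite /K -big_split/= -sumEFin; apply: lee_sum => k _.
by rewrite MK -EFinM lee_fin -mulrDl ler_wpM2r// norm_dist.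
Qed.

Let K_measurable q : measurable_fun setT (K ^~ q).
Proof.
apply: measurable_sum => k; apply: measurable_funM => //.
have m1 : measurable_fun setT (fun w => (g k w).1).
  exact: measurableT_comp measurable_fst _.
have m2 : measurable_fun setT (fun w => (g k w).2).
  exact: measurableT_comp measurable_snd _.
by apply: measurable_funD; apply: measurableT_comp => //; exact: measurable_funB.
Qed.

Let K_small w (e : R) : 0 < e -> exists q, K w q < e.
Proof.
move=> e0; pose S := 1 + \sum_(k < N.+1) 2 * M k.
have S0 : 0 < S.
  by rewrite ltr_pwDl// sumr_ge0// => k _; rewrite mulr_ge0.
have h k : exists q : rat * rat, dist k w q <= 2 * (e / S).
  have [q1 h1] := rat_approx (g k w).1 (divr_gt0 e0 S0).
  have [q2 h2] := rat_approx (g k w).2 (divr_gt0 e0 S0).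
  exists (q1, q2); rewrite /dist/= distrC [X in _ + X]distrC.
  by rewrite mulr_natl mulr2n lerD// ltW.
have [q hq] := choice h.
exists [ffun k => q k].
apply: (@le_lt_trans _ _ (\sum_(k < N.+1) (e / S) * (2 * M k))).
  apply: ler_sum => k _; by rewrite ffunE mulrCA mulrA ler_wpM2r.
rewrite -mulr_sumr -mulrA -[ltRHS]mulr1 ltr_pM2l// mulrC ltr_pdivrMr// mul1r.
by rewrite ltrDr.
Qed.

Lemma gammaN_measurable : measurable_fun setT gammaN.
Proof.
apply: (measurability (@Heigenspace_open R N)) => // _ [A oA <-].
rewrite setTI.
apply: (@countable_cover_measurable _ _ ({ffun 'I_N.+1 -> rat * rat} * nat)%type
  (fun qn => [set w | K w qn.1 < qn.2.+1%:R^-1])) => [qn|w Aw].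
  rewrite -[X in measurable X]setTI.
  exact: (measurable_fun_ltr (K_measurable _) (measurable_cst _)).
have [e e0 eA] := oA _ Aw.
have [n n0] : exists n : nat, n.+1%:R^-1 < e / 2.
  have e20 : 0 < e / 2 by rewrite divr_gt0.
  near \oo => n; exists n; near: n.
  exact: (near_infty_natSinv_lt (PosNum e20)).
have npos : 0 < n.+1%:R^-1 :> R by rewrite invr_gt0.
have [q hq] := K_small w npos.
exists (q, n) => //= w' hq'; apply: eA.
rewrite (le_lt_trans (gammaN_dist w' w q))// lte_fin.
by rewrite [ltRHS]splitr ltrD// (lt_trans _ n0).
Unshelve. all: by end_near. Qed.

HB.instance Definition _ :=
  @isMeasurableFun.Build _ _ Omega (Heigenspace R N) gammaN gammaN_measurable.

Definition gammaN_RV : {RV P >-> Heigenspace R N} := gammaN.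

(* The law mu_N of gammaN_N. *)
Definition muN : probability (Heigenspace R N) R :=
  distribution P gammaN_RV.

End gammaN.
End gaussian.

Section flow.
Context {R : realType} (N : nat).
Implicit Types (Phi : R -> Heigenspace R N -> Heigenspace R N).

Definition orthonormal_basis n (phi : 'I_n -> Heigenspace R N) : Prop :=
  (forall j k, inner (phi j) (phi k) = (j == k)%:R) /\
  forall u : Heigenspace R N, exists c : 'I_n -> R[i],
    {ae leb2 R, forall x, u x = \sum_(k < n) c k * phi k x}.

(* The flow of (CR) restricted to E_N: by global well-posedness in L^2 and the
   stability of E_N these conditions determine [Phi t u0] almost everywhere. *)
Definition CR_flow Phi : Prop :=
  forall u0 : Heigenspace R N,
    {ae leb2 R, forall x, Phi 0 u0 x = u0 x} /\
    CR_solution (fun t => Phi t u0).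

Definition invariant_measure (mu : probability (Heigenspace R N) R) Phi :=
  forall t, measurable_fun setT (Phi t) /\
    forall A, measurable A -> mu (Phi t @^-1` A) = mu A.

Definition recurrent Phi (u0 : Heigenspace R N) : Prop :=
  exists t : nat -> R, t @ \oo --> +oo /\
    (fun n => L2norm (fun x => Phi (t n) u0 x - u0 x)) @ \oo --> 0%E.

End flow.

(* Main.v *)
(* Let xi u be the coordinates of u in E_N along the basis (phi_k), rescaled so
   that mu_N is the law of xi^-1 of a vector of independent standard complex
   Gaussians, seen in R^(2(N+1)).  Since e^{-i tau H} acts on E_N as a scalar of
   modulus one, T(u, u, u) is, up to the factor pi^2, the projection of |u|^2 u,
   and (CR) becomes a cubic Hamiltonian equation x' = X(x) whose field X is
   divergence free and tangent to the spheres.  Such a field preserves the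
   Gaussian measure.  No change of variables in several dimensions is needed to
   see it: after cutting X off by a function of |x|^2, which only rescales time
   along each orbit, one step of the Euler scheme that moves the coordinates one
   after the other changes the expectation of a bounded Lipschitz F by O(h^2),
   because a one-dimensional substitution in each coordinate gives the first
   order term E[F(x) (2 <x, X(x)> - div X(x))] = 0; these errors add up to O(h)
   over a bounded time.  Recurrence is Poincare's theorem for the time-one map,
   applied to the balls with rational centre and radius 1/(n+1). *)
From HB Require Import structures.
Require Import Defs.
From mathcomp Require Import all_boot all_order all_algebra.
From mathcomp Require Import all_classical all_reals all_analysis.
From mathcomp Require Import measurable_realfun complex.
From mathcomp Require Import ring lra.

Set Implicit Arguments.
Unset Strict Implicit.
Unset Printing Implicit Defensive.
Import Order.TTheory GRing.Theory Num.Theory.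
Import numFieldNormedType.Exports.

Local Open Scope classical_set_scope.
Local Open Scope ring_scope.

(** * Curves and Gronwall estimates *)

Section one_variable.
Context {R : realType}.
Implicit Types f df : R -> R.

(** The equation enters only through the hypothesis on [Phi]: that T(u, u, u) is defined along the
    flow is the source of the integrability of products of four basis functions. Elements of
    [Heigenspace] are functions, not classes, so uniqueness, the group law and the compatibility of
    [Phi t] with almost everywhere equality are obtained in the coordinates [xi], where Gronwall
    applies; every statement about [Phi] is transported through [xi]. The obstacle behind the cutoff
    is uniformity: the substitution on a line requires 1 + h dY > 0 for one h valid at all points,
    and the error terms require global bounds; a cubic field allows neither. F is merely Lipschitz
    because the test functions are distances to complements of open sets, truncated at 1; hence the
    derivative falls on the Gaussian weight and never on F. The bound O(h^2) is exploited as a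
    vanishing derivative of t -> E[F(f_t x)], where f_t is the flow. *)

Lemma is_derive_continuous f (x df : R) : is_derive x (1 : R) f df -> {for x, continuous f}.
Proof. by move=> [fx _]; apply: differentiable_continuous; exact/derivable1_diffP. Qed.

Lemma is_derive_within f df (a b : R) : (forall t : R, is_derive t (1 : R) f (df t)) ->
  {within `[a, b], continuous f}.
Proof.
by move=> fdf; apply: continuous_subspaceT => x; exact: is_derive_continuous (fdf x).
Qed.

Lemma is_derive_nonincr f df (a b : R) : (forall t : R, is_derive t (1 : R) f (df t)) ->
  (forall t, df t <= 0) -> a <= b -> f b <= f a.
Proof.
move=> fdf df0 ab.
have [c _ E] := MVT_segment ab (fun x _ => fdf x) (is_derive_within fdf).
by rewrite -subr_le0 E mulr_le0_ge0// subr_ge0.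
Qed.

Lemma is_derive_lipschitz f df (a b K : R) : (forall t : R, is_derive t (1 : R) f (df t)) ->
  (forall t, Num.min a b <= t <= Num.max a b -> `|df t| <= K) ->
  `|f b - f a| <= K * `|b - a|.
Proof.
move=> fdf; wlog ab : a b / a <= b => [H dfK|].
  have [/H/(_ dfK)//|ba] := leP a b.
  by rewrite distrC (distrC b); apply: (H b a (ltW ba)) => t; rewrite minC maxC; exact: dfK.
rewrite min_l// max_r// => dfK.
have [c + E] := MVT_segment ab (fun x _ => fdf x) (is_derive_within fdf).
by rewrite in_itv => /dfK H; rewrite E normrM ler_wpM2r.
Qed.

Lemma is_derive_sum_seq (J : Type) (s : seq J) (f : J -> R -> R) (df : J -> R) (t : R) :
  (forall j, is_derive (t : R) (1 : R) (f j) (df j)) ->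
  is_derive (t : R) (1 : R) (fun u => \sum_(j <- s) f j u) (\sum_(j <- s) df j).
Proof.
move=> fdf; elim: s => [|j s IH].
  rewrite big_nil (_ : (fun _ => _) = cst 0); first exact: is_derive_cst.
  by apply/funext => u; rewrite big_nil.
rewrite big_cons (_ : (fun _ => _) = f j + (fun u => \sum_(j <- s) f j u)).
  exact: is_deriveD.
by apply/funext => u; rewrite big_cons.
Qed.

End one_variable.

Section gronwall.
Context {R : realType} {I : finType}.
Implicit Types (x y : I -> R) (u v a b : R -> I -> R).

Definition sq x : R := \sum_i x i ^+ 2.

Lemma sq_ge0 x : 0 <= sq x.
Proof. by apply: sumr_ge0 => i _; exact: sqr_ge0. Qed.

Definition curve u a := forall t i, is_derive (t : R) (1 : R) (u ^~ i) (a t i).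

Lemma is_derive_sq u a t : curve u a ->
  is_derive (t : R) (1 : R) (sq \o u) (\sum_i 2 * (u t i * a t i)).
Proof.
move=> ua; apply: is_derive_sum_seq => i.
rewrite (_ : (fun _ => _) = (u ^~ i) ^+ 2); last by apply/funext => s; rewrite fctE.
by have := ua t i => H; apply: is_derive_eq; rewrite /GRing.scale /= expr1; ring.
Qed.

Lemma curve_sub u v a b : curve u a -> curve v b ->
  curve (fun t i => u t i - v t i) (fun t i => a t i - b t i).
Proof. by move=> ua vb t i; have := ua t i; have := vb t i => H1 H2; exact: is_deriveB. Qed.

(** For t >= 0 the function exp(-2 K s) |u(s)|^2 is nonincreasing, its derivative being 2 exp(-2 K
    s) (<u, a> - K |u|^2). The two-sided bound on <u, a> is stable under time reversal, which gives
    t < 0. *)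
Lemma gronwall_sq u a (K : R) : curve u a ->
  (forall t, `|\sum_i u t i * a t i| <= K * sq (u t)) ->
  forall t, sq (u t) <= expR (2 * K * `|t|) * sq (u 0).
Proof.
move=> ua uaK t.
wlog t0 : u a ua uaK t / 0 <= t => [H|].
  have [/(H _ _ ua uaK)//|t0] := leP 0 t.
  have := H (fun s i => u (- s) i) (fun s i => - a (- s) i) _ _ (- t).
  rewrite opprK oppr0 normrN; apply; rewrite ?oppr_ge0 ?ltW// => s.
    move=> i; have := ua (- s) i => H1.
    rewrite (_ : (fun _ => _) = (u ^~ i) \o -%R)//.
    by apply: is_derive_eq; rewrite mulrN1.
  rewrite -[X in `|X|](_ : - \sum_i u (- s) i * a (- s) i = _) ?normrN//.
  by rewrite -sumrN; apply: eq_bigr => i _; rewrite mulrN.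
pose f s := expR (- (2 * K) * s) * sq (u s).
have fd s : is_derive (s : R) (1 : R) f (expR (- (2 * K) * s) *
    ((\sum_i 2 * (u s i * a s i)) - 2 * K * sq (u s))).
  rewrite (_ : f = (expR \o ( *%R (- (2 * K)))) * (sq \o u))//.
  have H := is_derive_sq s ua.
  apply: is_derive_eq; rewrite /GRing.scale/=; ring.
have : f t <= f 0.
  apply: is_derive_nonincr fd _ t0 => s.
  rewrite mulr_ge0_le0 ?expR_ge0// -mulr_sumr.
  rewrite -mulrA -mulrBr mulr_ge0_le0// subr_le0.
  exact: le_trans (ler_norm _) (uaK s).
rewrite /f mulr0 expR0 mul1r mulNr expRN ger0_norm//.
by rewrite mulrC ler_pdivrMr ?expR_gt0// mulrC.
Qed.

Lemma gronwall_dist u v a b (K : R) : curve u a -> curve v b ->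
  (forall t, `|\sum_i (u t i - v t i) * (a t i - b t i)| <=
     K * sq (fun i => u t i - v t i)) ->
  forall t, sq (fun i => u t i - v t i) <=
    expR (2 * K * `|t|) * sq (fun i => u 0 i - v 0 i).
Proof. by move=> ua vb uvK; exact: (gronwall_sq (curve_sub ua vb) uvK). Qed.

Lemma curve_conserved u a : curve u a -> (forall t, \sum_i u t i * a t i = 0) ->
  forall t, sq (u t) = sq (u 0).
Proof.
move=> ua ua0 t; apply: (@is_derive_0_is_cst _ (sq \o u)) => s.
by have := is_derive_sq s ua; rewrite -mulr_sumr ua0 mulr0.
Qed.

End gronwall.

Section quadratic_remainder.
Context {R : realType}.
Implicit Types f : R -> R.

(** Serves for max(0, t)^2, whose second derivative jumps at 0, and for the expectation along a
    flow, which is known only up to O(h^2). *)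
Lemma is_derive_quadratic f (t d C e1 : R) : 0 < e1 ->
  (forall h, `|h| <= e1 -> `|f (t + h) - f t - h * d| <= C * h ^+ 2) ->
  is_derive t (1 : R) f d.
Proof.
move=> e10 H.
have L : (fun h : R => h^-1 *: ((f \o shift t) (h *: (1 : R)) - f t)) @ 0^' --> d.
  apply/cvgrPdist_le => /= e e0; near=> h.
  have h0 : h != 0 by near: h; exact: nbhs_dnbhs_neq.
  have h1 : `|h| <= e1.
    by near: h; apply: dnbhs0_le.
  have h2 : `|h| <= e / (`|C| + 1).
    by near: h; apply: dnbhs0_le; rewrite divr_gt0// ltr_wpDl.
  rewrite /GRing.scale/= mulr1 (addrC h) distrC.
  rewrite (_ : _ - d = h^-1 * (f (t + h) - f t - h * d)); last first.
    by rewrite [in RHS]mulrBr mulKf.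
  rewrite normrM normfV ler_pdivrMl ?normr_gt0//.
  apply: (le_trans (H h h1)); rewrite -(real_normK (num_real h)) expr2 mulrCA ler_wpM2l//.
  apply: (@le_trans _ _ ((`|C| + 1) * `|h|)).
    by rewrite ler_wpM2r// (le_trans (ler_norm _))// lerDl.
  by rewrite mulrC -ler_pdivlMr// ltr_wpDl.
by split; [apply/cvg_ex; exists d|exact/cvg_lim].
Unshelve. all: by end_near. Qed.

Lemma is_derive_max0_sqr (t : R) :
  is_derive t (1 : R) (fun t => Num.max 0 t ^+ 2) (2 * Num.max 0 t).
Proof.
apply: (@is_derive_quadratic _ _ _ 1 1 ltr01) => h _.
rewrite mul1r ler_norml.
case: (ltP 0 (t + h)) => [th|th]; case: (ltP 0 t) => [t0|t0];
  apply/andP; split; try nra.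
Qed.

Lemma max_dist (a b c : R) : `|Num.max a b - Num.max a c| <= `|b - c|.
Proof.
have := ler_norm (b - c); have := ler_norm (c - b); rewrite (distrC c b) ler_norml => h1 h2.
by case: (ltP a b) => ?; case: (ltP a c) => ?; apply/andP; split; lra.
Qed.

Lemma min_dist (a b c : R) : `|Num.min a b - Num.min a c| <= `|b - c|.
Proof.
have := ler_norm (b - c); have := ler_norm (c - b); rewrite (distrC c b) ler_norml => h1 h2.
by case: (ltP a b) => ?; case: (ltP a c) => ?; apply/andP; split; lra.
Qed.

End quadratic_remainder.

(** * Locally Lipschitz functions of finitely many coordinates *)

Section local_lipschitz.
Context {R : realType} {I : finType}.
Implicit Types (x y : I -> R) (f g : (I -> R) -> R).

Definition l1dist x y : R := \sum_i `|x i - y i|.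

Definition in_box r x := forall i, `|x i| <= r.

Definition lipschitz_with (K : R) f := forall x y, `|f x - f y| <= K * l1dist x y.

(** One constant bounds both f and its Lipschitz quotients on a box, which makes the class stable
    under products. It contains the cubic fields, which are not globally Lipschitz. *)
Definition locLip f := forall r : R, exists2 K : R, 0 <= K &
  (forall x, in_box r x -> `|f x| <= K) /\
  (forall x y, in_box r x -> in_box r y -> `|f x - f y| <= K * l1dist x y).

Definition upd x i s : I -> R := fun j => if j == i then s else x j.

Lemma l1dist_ge0 x y : 0 <= l1dist x y.
Proof. by apply: sumr_ge0. Qed.

Lemma le_l1dist x y i : `|x i - y i| <= l1dist x y.
Proof. by rewrite /l1dist (bigD1 i)//= lerDl sumr_ge0. Qed.

(** Cauchy-Schwarz, obtained by expanding the square into a double sum and using a b <= (a^2 + b^2)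
    / 2 in each term. *)
Lemma l1dist_sq x y : l1dist x y ^+ 2 <= #|I|%:R * sq (fun i => x i - y i).
Proof.
rewrite expr2 /l1dist mulr_suml.
apply: (@le_trans _ _ (\sum_i \sum_j ((x i - y i) ^+ 2 / 2 + (x j - y j) ^+ 2 / 2))).
  apply: ler_sum => i _; rewrite mulr_sumr; apply: ler_sum => j _.
  rewrite -(real_normK (num_real (x i - y i))) -(real_normK (num_real (x j - y j))).
  have := sqr_ge0 (`|x i - y i| - `|x j - y j|); nra.
under eq_bigr do rewrite big_split/= sumr_const -mulr_suml -/(sq _).
rewrite big_split/= sumr_const. rewrite sumrMnl -mulr_suml -/(sq (fun i => x i - y i)).
by rewrite -mulr_natl; lra.
Qed.

Lemma sq_le_l1dist x y : sq (fun i => x i - y i) <= l1dist x y ^+ 2.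
Proof.
rewrite expr2 {1}/l1dist mulr_suml; apply: ler_sum => i _.
by rewrite -(real_normK (num_real (x i - y i))) expr2 ler_wpM2l// le_l1dist.
Qed.

Lemma le_sq x i : x i ^+ 2 <= sq x.
Proof. by rewrite /sq (bigD1 i)//= lerDl sumr_ge0// => j _; exact: sqr_ge0. Qed.

Lemma in_box_sqrt x : in_box (Num.sqrt (sq x)) x.
Proof.
move=> i; rewrite -sqrtr_sqr ler_sqrt ?le_sq//; exact: sq_ge0.
Qed.

Lemma in_boxS r s x : r <= s -> in_box r x -> in_box s x.
Proof. by move=> rs xr i; exact: le_trans (xr i) rs. Qed.

Lemma locLip_cst c : locLip (cst c).
Proof.
move=> r; exists `|c|; first exact: normr_ge0.
by split=> // x y _ _; rewrite subrr normr0 mulr_ge0// l1dist_ge0.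
Qed.

Lemma locLip_coord i : locLip (fun x => x i).
Proof.
move=> r; exists (Num.max 1 r); first by rewrite le_max ler01.
split=> [x /(_ i) xr|x y _ _]; first by rewrite le_max xr orbT.
apply: (le_trans (le_l1dist x y i)).
by rewrite ler_peMl ?l1dist_ge0// le_max lexx.
Qed.

Lemma locLipD f g : locLip f -> locLip g -> locLip (fun x => f x + g x).
Proof.
move=> lf lg r; have [K K0 [fK Kf]] := lf r; have [L L0 [gL Lg]] := lg r.
exists (K + L); first exact: addr_ge0.
split=> [x xr|x y xr yr].
  by rewrite (le_trans (ler_normD _ _))// lerD ?fK ?gL.
by rewrite opprD addrACA (le_trans (ler_normD _ _))// mulrDl lerD ?Kf ?Lg.
Qed.

Lemma locLipM f g : locLip f -> locLip g -> locLip (fun x => f x * g x).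
Proof.
move=> lf lg r; have [K K0 [fK Kf]] := lf r; have [L L0 [gL Lg]] := lg r.
exists (2 * K * L); first by rewrite !mulr_ge0.
split=> [x xr|x y xr yr].
  rewrite normrM (@le_trans _ _ (K * L))//; first by rewrite ler_pM ?fK ?gL.
  by rewrite -mulrA; have := mulr_ge0 K0 L0; lra.
rewrite (_ : _ - _ = (f x - f y) * g x + f y * (g x - g y)); last by ring.
rewrite (le_trans (ler_normD _ _))// !normrM.
rewrite (_ : 2 * K * L * l1dist x y =
  (K * l1dist x y) * L + K * (L * l1dist x y)); last by ring.
by rewrite lerD// ler_pM ?Kf ?Lg ?fK ?gL.
Qed.

Lemma locLip_ext f g : (forall x, f x = g x) -> locLip f -> locLip g.
Proof. by move=> fg; rewrite (_ : g = f)//; apply/funext. Qed.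

Lemma locLipN f : locLip f -> locLip (fun x => - f x).
Proof.
move=> lf; apply: (locLip_ext _ (locLipM (locLip_cst (-1)) lf)) => x /=.
by rewrite mulN1r.
Qed.

Lemma locLip_sum J (s : seq J) (P : pred J) (F : J -> (I -> R) -> R) :
  (forall j, locLip (F j)) -> locLip (fun x => \sum_(j <- s | P j) F j x).
Proof.
move=> lF; elim: s => [|j s IH].
  by apply: (locLip_ext _ (locLip_cst 0)) => x; rewrite big_nil.
case/boolP : (P j) => Pj; last first.
  by apply: (locLip_ext _ IH) => x; rewrite big_cons (negbTE Pj).
by apply: (locLip_ext _ (locLipD (lF j) IH)) => x; rewrite big_cons Pj.
Qed.

Lemma locLip_max0 f : locLip f -> locLip (fun x => Num.max 0 (f x)).
Proof.
move=> lf r; have [K K0 [fK Kf]] := lf r; exists K => //; split=> [x xr|x y xr yr].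
  by apply: le_trans (fK x xr); case: (ltP 0 (f x)) => //; rewrite normr0.
exact: le_trans (max_dist _ _ _) (Kf x y xr yr).
Qed.

(* Clamping coordinates to [-r, r] is 1-Lipschitz and does not change a function
   that vanishes as soon as one coordinate leaves ]-r, r[. *)
Lemma locLip_compact f (r : R) : locLip f -> 0 <= r ->
  (forall x i, r <= `|x i| -> f x = 0) ->
  exists2 K : R, 0 <= K & (forall x, `|f x| <= K) /\ lipschitz_with K f.
Proof.
move=> lf r0 f0; have [K K0 [fK Kf]] := lf r.
pose c x i := Num.max (- r) (Num.min r (x i)).
have cr x : in_box r (c x).
  move=> i; rewrite /c ler_norml.
  by rewrite le_max lexx ge_max ge_min lexx /= andbT; lra.
have fc x : f x = f (c x).
  have [xr|nxr] := pselect (in_box r x).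
    congr f; apply/funext => i; rewrite /c.
    have := xr i; rewrite ler_norml => /andP[? ?].
    by rewrite min_r// max_r.
  have [i /negP] : exists i, ~ `|x i| <= r by
    apply: contrapT => /forallNP h; apply: nxr => i; exact: contrapT (h i).
  rewrite -ltNge => xi.
  (* The clamped coordinate is r or -r, where f vanishes too, so both sides are 0. *)
  rewrite (f0 x i (ltW xi)) (f0 (c x) i)// /c.
  move: xi; rewrite lter_normr => /orP[xi|xi].
    have -> : Num.min r (x i) = r by rewrite min_l ?ltW.
    have -> : Num.max (- r) r = r by rewrite max_r//; lra.
    exact: ler_norm.
  have -> : Num.min r (x i) = x i by rewrite min_r//; lra.
  have -> : Num.max (- r) (x i) = - r by rewrite max_l//; lra.
  by rewrite normrN ler_norm.
exists K => //; split=> [x|x y]; first by rewrite fc fK.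
rewrite fc (fc y) (le_trans (Kf _ _ _ _))// ler_wpM2l// ler_sum// => i _.
exact: le_trans (max_dist _ _ _) (min_dist _ _ _).
Qed.

Lemma upd_same x i s : upd x i s i = s.
Proof. by rewrite /upd eqxx. Qed.

Lemma upd_other x i s j : j != i -> upd x i s j = x j.
Proof. by rewrite /upd => /negbTE->. Qed.

Lemma upd_upd x i s t : upd (upd x i s) i t = upd x i t.
Proof. by apply/funext => j; rewrite /upd; case: eqP. Qed.

Lemma upd_id x i : upd x i (x i) = x.
Proof. by apply/funext => j; rewrite /upd; case: eqP => // ->. Qed.

Lemma sq_upd x i s : sq (upd x i s) = s ^+ 2 + \sum_(j | j != i) x j ^+ 2.
Proof.
rewrite /sq (bigD1 i)//= upd_same; congr (_ + _).
by apply: eq_bigr => j ji; rewrite upd_other.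
Qed.

Lemma l1dist_upd x i s t : l1dist (upd x i s) (upd x i t) = `|s - t|.
Proof.
rewrite /l1dist (bigD1 i)//= !upd_same big1 ?addr0// => j ji.
by rewrite !upd_other// subrr normr0.
Qed.

Lemma l1dist_triangle x y z : l1dist x z <= l1dist x y + l1dist y z.
Proof. by rewrite /l1dist -big_split; apply: ler_sum => i _; exact: ler_distD. Qed.

End local_lipschitz.

(** * Divergence-free fields tangent to the spheres *)

Section fields.
Context {R : realType} {I : finType}.
Implicit Types (x y : I -> R) (X DX Y : I -> (I -> R) -> R).
Implicit Types (f : R -> (I -> R) -> I -> R) (u v : R -> I -> R).

(** [DX i] is the derivative of [X i] along its own coordinate: only the diagonal of the Jacobian
    enters the divergence. Its local Lipschitz bounds control the one-dimensional substitutions. *)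
Record spherical_field X DX : Prop := SphericalField {
  sf_lip : forall i, locLip (X i);
  sf_dlip : forall i, locLip (DX i);
  sf_deriv : forall i x s, is_derive s (1 : R) (fun t => X i (upd x i t)) (DX i (upd x i s));
  sf_div : forall x, \sum_i DX i x = 0;
  sf_tangent : forall x, \sum_i x i * X i x = 0 }.

Definition flow_of X f : Prop :=
  (forall x, f 0 x = x) /\ forall x, curve (f ^~ x) (fun t i => X i (f t x)).

Lemma uniform_locLip X (r : R) : (forall i, locLip (X i)) ->
  exists2 K : R, 0 <= K & forall i x y, in_box r x -> in_box r y ->
    `|X i x - X i y| <= K * l1dist x y.
Proof.
move=> lX.
have /choice[K HK] : forall i, exists K : R, 0 <= K /\ forall x y, in_box r x -> in_box r y ->
    `|X i x - X i y| <= K * l1dist x y.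
  by move=> i; have [K K0 [_ ?]] := lX i r; exists K.
exists (\sum_i K i) => [|i x y xr yr]; first by rewrite sumr_ge0// => i _; case: (HK i).
rewrite (le_trans ((HK i).2 _ _ xr yr))// ler_wpM2r ?l1dist_ge0//.
by rewrite (bigD1 i)//= lerDl sumr_ge0// => j _; case: (HK j).
Qed.

Lemma one_sided_lipschitz X (K : R) x y : 0 <= K ->
  (forall i, `|X i x - X i y| <= K * l1dist x y) ->
  `|\sum_i (x i - y i) * (X i x - X i y)| <= K * #|I|%:R * sq (fun i => x i - y i).
Proof.
move=> K0 XK; apply: (@le_trans _ _ (\sum_i `|x i - y i| * (K * l1dist x y))).
  apply: (le_trans (ler_norm_sum _ _ _)); apply: ler_sum => i _.
  by rewrite normrM ler_wpM2l.
by rewrite -mulr_suml mulrCA -mulrA ler_wpM2l// -expr2 l1dist_sq.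
Qed.

Lemma lipschitz_curves X (K : R) u v : 0 <= K ->
  (forall i, lipschitz_with K (X i)) ->
  curve u (fun t i => X i (u t)) -> curve v (fun t i => X i (v t)) ->
  forall t, sq (fun i => u t i - v t i) <=
    expR (2 * (K * #|I|%:R) * `|t|) * sq (fun i => u 0 i - v 0 i).
Proof.
move=> K0 XK uX vX; apply: (gronwall_dist uX vX) => t.
by apply: one_sided_lipschitz => // i; exact: XK.
Qed.

(** Turns a Gronwall bound on squares into a Lipschitz bound for [l1dist]. The factor #|I| + 1
    stands in for sqrt #|I|, since #|I| <= (#|I| + 1)^2. *)
Lemma l1dist_le_sq x y x' y' (E : R) : 0 <= E ->
  sq (fun i => x i - y i) <= E ^+ 2 * sq (fun i => x' i - y' i) ->
  l1dist x y <= (#|I|%:R + 1) * E * l1dist x' y'.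
Proof.
move=> E0 H.
have C0 : 0 <= #|I|%:R + 1 :> R by [].
rewrite -(@ler_pXn2r _ 2%N)// ?nnegrE ?l1dist_ge0 ?mulr_ge0 ?l1dist_ge0//.
apply: (le_trans (l1dist_sq x y)).
apply: (@le_trans _ _ (#|I|%:R * (E ^+ 2 * l1dist x' y' ^+ 2))).
  rewrite ler_wpM2l//; apply: (le_trans H); rewrite ler_wpM2l ?sqr_ge0//.
  exact: sq_le_l1dist.
have -> : ((#|I|%:R + 1) * E * l1dist x' y') ^+ 2 =
  (#|I|%:R + 1) ^+ 2 * (E ^+ 2 * l1dist x' y' ^+ 2) by ring.
rewrite ler_wpM2r//; first by rewrite mulr_ge0 ?sqr_ge0.
have m0 : 0 <= #|I|%:R :> R by [].
by move: (#|I|%:R : R) m0 => m m0; nra.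
Qed.

Section flow.
Variables (X DX : I -> (I -> R) -> R) (f : R -> (I -> R) -> I -> R).
Hypotheses (sX : spherical_field X DX) (fX : flow_of X f).

Lemma curve_sq u : curve u (fun t i => X i (u t)) -> forall t, sq (u t) = sq (u 0).
Proof. by move=> uX; apply: (curve_conserved uX) => t; exact: (sf_tangent sX). Qed.

Lemma flow_sq t x : sq (f t x) = sq x.
Proof. by rewrite (curve_sq (fX.2 x)) fX.1. Qed.

(** Curves of the field stay on their spheres, so all those that start with [sq] at most r live in
    one box, where the field has a single Lipschitz constant for Gronwall. *)
Lemma locally_lipschitz_curves (r : R) : exists2 K : R, 0 <= K & forall u v,
  curve u (fun t i => X i (u t)) -> curve v (fun t i => X i (v t)) ->
  sq (u 0) <= r -> sq (v 0) <= r ->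
  forall t, sq (fun i => u t i - v t i) <= expR (K * `|t|) * sq (fun i => u 0 i - v 0 i).
Proof.
have [K K0 HK] := uniform_locLip (Num.sqrt r) (sf_lip sX).
exists (2 * (K * #|I|%:R)) => [|u v uX vX ur vr]; first by rewrite !mulr_ge0.
have b w t : curve w (fun t i => X i (w t)) -> sq (w 0) <= r -> in_box (Num.sqrt r) (w t).
  move=> wX wr; apply: (@in_boxS _ _ (Num.sqrt (sq (w t)))); last exact: in_box_sqrt.
  by rewrite ler_wsqrtr// (curve_sq wX).
apply: (gronwall_dist uX vX) => t.
by apply: one_sided_lipschitz => // i; apply: HK; exact: b.
Qed.

Lemma flow_unique u : curve u (fun t i => X i (u t)) -> forall t, u t = f t (u 0).
Proof.
move=> uX t; have [K K0 HK] := locally_lipschitz_curves (sq (u 0)).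
have := HK u (f ^~ (u 0)) uX (fX.2 _); rewrite fX.1 => /(_ (lexx _) (lexx _) t).
rewrite [X in _ * X]big1 ?mulr0 => [h|i _]; last by rewrite subrr expr0n.
apply/funext => i; apply/eqP; rewrite -subr_eq0 -sqrf_eq0 eq_le sqr_ge0 andbT.
exact: le_trans (le_sq (fun i => u t i - f t (u 0) i) i) h.
Qed.

Lemma flow_add s t x : f (s + t) x = f s (f t x).
Proof.
pose u r := f (r + t) x.
have uX : curve u (fun r i => X i (u r)).
  move=> r i; rewrite (_ : u ^~ i = (fun q => f q x i) \o (fun q => q + t))//.
  have H := fX.2 x (r + t) i.
  have H2 : is_derive r (1 : R) (fun q : R => q + t) 1.
    by rewrite -[X in is_derive _ _ _ X](addr0 1); apply: is_deriveD.
  by apply: is_derive_eq; rewrite /GRing.scale/= mulr1.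
by rewrite -/(u s) (flow_unique uX) /u add0r.
Qed.

End flow.

(** * Cutting a spherical field off *)

Section cutoff.
Variables (X DX : I -> (I -> R) -> R) (f : R -> (I -> R) -> I -> R).
Hypotheses (sX : spherical_field X DX) (fX : flow_of X f).
Variable e : R.
Hypothesis e0 : 0 < e.

(** Squaring the positive part gives a C^1 function with locally Lipschitz derivatives; it vanishes
    once |x|^2 >= 1 / e and tends to 1 as e tends to 0. *)
Definition cutoff x : R := Num.max 0 (1 - e * sq x) ^+ 2.

Definition cut_field i x : R := cutoff x * X i x.

Definition cut_dfield i x : R :=
  - 4 * e * x i * Num.max 0 (1 - e * sq x) * X i x + cutoff x * DX i x.

(* [sq] is conserved by the flow of [X], so the cutoff only rescales time. *)
Definition cut_flow t x := f (cutoff x * t) x.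

Lemma locLip_sq : locLip (@sq R I).
Proof.
apply: locLip_sum => i.
by apply: (locLip_ext _ (locLipM (locLip_coord i) (locLip_coord i))) => x; rewrite expr2.
Qed.

Lemma locLip_max_cut : locLip (fun x => Num.max 0 (1 - e * sq x)).
Proof.
apply: locLip_max0.
apply: (locLip_ext _ (locLipD (locLip_cst 1) (locLipM (locLip_cst (- e)) locLip_sq))) => x.
by rewrite /= mulNr.
Qed.

Lemma locLip_cutoff : locLip cutoff.
Proof.
by apply: (locLip_ext _ (locLipM locLip_max_cut locLip_max_cut)) => x; rewrite -expr2.
Qed.

Lemma is_derive_cutoff i x s : is_derive s (1 : R) (fun t => cutoff (upd x i t))
  (- 4 * e * s * Num.max 0 (1 - e * sq (upd x i s))).
Proof.
pose g t := 1 - e * sq (upd x i t).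
have dg : is_derive s (1 : R) g (- (2 * e * s)).
  have -> : g = (fun t => (1 - e * \sum_(j | j != i) x j ^+ 2) + (- e) * (t * t)).
    by apply/funext => t; rewrite /g sq_upd; ring.
  have d2 : is_derive s (1 : R) (fun t : R => t * t) (s * 1 + s * 1).
    exact: (@is_deriveM _ _ id id).
  rewrite -[X in is_derive _ _ _ X]add0r; apply: is_deriveD.
  have := @is_deriveZ _ _ _ (fun t : R => t * t) (- e) s 1 _ d2.
  by move=> H; apply: (is_derive_eq H); rewrite /GRing.scale/=; ring.
have dm := is_derive_max0_sqr (g s).
rewrite (_ : (fun _ => _) = (fun t => Num.max 0 t ^+ 2) \o g)//.
by apply: is_derive_eq; rewrite /GRing.scale/= /g; ring.
Qed.

(** The gradient of the cutoff is radial, so the divergence of the product gains only a multiple of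
    <x, X> = 0. *)
Lemma cut_spherical : spherical_field cut_field cut_dfield.
Proof.
split.
- by move=> i; apply: locLipM; [exact: locLip_cutoff|exact: (sf_lip sX)].
- move=> i; apply: locLipD; apply: locLipM; do ?[exact: (sf_lip sX)|
    exact: (sf_dlip sX)|exact: locLip_cutoff|exact: locLip_max_cut|apply: locLipM|
    exact: locLip_coord|exact: locLip_cst].
- move=> i x s; have dc := is_derive_cutoff i x s; have dX := sf_deriv sX i x s.
  rewrite (_ : (fun _ => _) = (fun t => cutoff (upd x i t)) * (fun t => X i (upd x i t)))//.
  by apply: is_derive_eq; rewrite /GRing.scale/= /cut_dfield upd_same; ring.
- move=> x; rewrite big_split/= -mulr_sumr (sf_div sX) mulr0 addr0.
  transitivity (- 4 * e * Num.max 0 (1 - e * sq x) * \sum_i x i * X i x).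
    by rewrite [RHS]mulr_sumr; apply: eq_bigr => i _; ring.
  by rewrite (sf_tangent sX) mulr0.
- move=> x; transitivity (cutoff x * \sum_i x i * X i x).
    by rewrite [RHS]mulr_sumr; apply: eq_bigr => i _; rewrite /cut_field; ring.
  by rewrite (sf_tangent sX) mulr0.
Qed.

Lemma cut_flow_of : flow_of cut_field cut_flow.
Proof.
split=> x; first by rewrite /cut_flow mulr0 fX.1.
move=> t i; rewrite (_ : (fun _ => _) = (fun s => f s x i) \o (fun s => cutoff x * s))//.
have H := fX.2 x (cutoff x * t) i.
apply: is_derive_eq.
rewrite /cut_field /cut_flow /cutoff !(flow_sq sX fX) /GRing.scale/=; ring.
Qed.

Lemma cut_max_far x i : Num.sqrt e^-1 <= `|x i| -> Num.max 0 (1 - e * sq x) = 0.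
Proof.
move=> xi; rewrite max_l// subr_le0 -ler_pdivrMl// mulr1.
apply: le_trans (le_sq x i); rewrite -(real_normK (num_real (x i))).
move: xi; rewrite -(@ler_pXn2r _ 2%N) ?nnegrE ?sqrtr_ge0//.
by rewrite sqr_sqrtr// invr_ge0 ltW.
Qed.

Lemma cut_field_far i j x : Num.sqrt e^-1 <= `|x j| -> cut_field i x = 0.
Proof. by move=> xj; rewrite /cut_field /cutoff (cut_max_far xj) expr0n mul0r. Qed.

Lemma cut_dfield_far i j x : Num.sqrt e^-1 <= `|x j| -> cut_dfield i x = 0.
Proof.
by move=> xj; rewrite /cut_dfield /cutoff (cut_max_far xj) expr0n !(mulr0, mul0r) addr0.
Qed.

End cutoff.

End fields.

(** * Gaussian integrals and independence *)

Section gauss_fun_estimates.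
Context {R : realType}.
Local Notation mu := (@lebesgue_measure R).
Local Notation p := (@gauss_fun R).

Lemma is_derive_gauss (s : R) : is_derive s (1 : R) p (- (2 * s * p s)).
Proof.
have d2 : is_derive s (1 : R) (fun t : R => - (t * t)) (- (s * 1 + s * 1)).
  by apply: is_deriveN; exact: (@is_deriveM _ _ id id).
rewrite (_ : (p : R -> R) = expR \o (fun t : R => - (t * t))).
  by apply: is_derive_eq; rewrite /GRing.scale/=; ring.
by apply/funext => t; rewrite /gauss_fun /= expr2.
Qed.

Lemma is_derive_gauss' (s : R) :
  is_derive s (1 : R) (fun t => - (2 * t * p t)) ((4 * s ^+ 2 - 2) * p s).
Proof.
have d := is_derive_gauss s.
have d2 : is_derive s (1 : R) (fun t => t * p t) (s * (- (2 * s * p s)) + p s * 1).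
  exact: (@is_deriveM _ _ id p).
rewrite (_ : (fun _ => _) = -2 \*: (fun t : R => t * p t)).
  have := @is_deriveZ _ _ _ (fun t : R => t * p t) (-2) s 1 _ d2.
  by move=> H; apply: (is_derive_eq H); rewrite /GRing.scale/=; ring.
by apply/funext => t; transitivity (- 2 * (t * p t)) => //; ring.
Qed.

Lemma gauss_ge0 (s : R) : 0 <= p s.
Proof. by rewrite /gauss_fun expR_ge0. Qed.

(** This is 1 + s^2 <= exp(s^2). It bounds the two derivatives of the density used below, through |2
    s| <= 1 + s^2 and |4 s^2 - 2| <= 4 (1 + s^2). *)
Lemma gauss_mul_le1 (s : R) : (1 + s ^+ 2) * p s <= 1.
Proof.
by rewrite /gauss_fun expRN ler_pdivrMr ?expR_gt0// mul1r expR_ge1Dx.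
Qed.

Lemma gauss_lipschitz (a b : R) : `|p b - p a| <= `|b - a|.
Proof.
rewrite -[leRHS]mul1r; apply: (is_derive_lipschitz is_derive_gauss) => t _.
rewrite normrN normrM (ger0_norm (gauss_ge0 t)) normrM (ger0_norm (ler0n _ 2)).
apply: le_trans (gauss_mul_le1 t); rewrite ler_wpM2r ?gauss_ge0//.
by rewrite -(real_normK (num_real t)); have := sqr_ge0 (`|t| - 1); nra.
Qed.

Lemma gauss'_lipschitz (a b : R) :
  `|- (2 * b * p b) - (- (2 * a * p a))| <= 6 * `|b - a|.
Proof.
apply: (is_derive_lipschitz is_derive_gauss') => t _.
have := gauss_mul_le1 t; have := gauss_ge0 t; have := sqr_ge0 t.
by move: (t ^+ 2) (p t) => u q u0 q0 uq; rewrite ler_norml; apply/andP; split; nra.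
Qed.

(** The mean value inequality for p minus its tangent line at a, whose derivative p'(a + t) - p'(a)
    is at most 6 |t| in absolute value. *)
Lemma gauss_taylor (a d : R) : `|p (a + d) - p a + 2 * a * d * p a| <= 6 * d ^+ 2.
Proof.
pose f t := p (a + t) + 2 * a * p a * t.
have df t : is_derive t (1 : R) f (- (2 * (a + t) * p (a + t)) + 2 * a * p a).
  have H := is_derive_gauss (a + t).
  have H1 : is_derive t (1 : R) (fun q : R => a + q) 1.
    by rewrite -[X in is_derive _ _ _ X]add0r; apply: is_deriveD.
  rewrite (_ : f = (p \o (fun q => a + q)) + (fun q => 2 * a * p a * q))//.
  by apply: is_derive_eq; rewrite /GRing.scale/=; ring.
have := @is_derive_lipschitz _ f _ 0 d (6 * `|d|) df.
have -> : 6 * `|d| * `|d - 0| = 6 * d ^+ 2 by rewrite subr0 -mulrA -expr2 real_normK ?num_real.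
move=> H.
rewrite (_ : _ + _ = f d - f 0); last by rewrite /f addr0 mulr0; ring.
apply: H => t td; rewrite (_ : _ + _ = - (2 * (a + t) * p (a + t)) - (- (2 * a * p a))); last by ring.
apply: (le_trans (gauss'_lipschitz _ _)); rewrite ler_wpM2l// (addrC a) addrK.
move: td => /andP[]; rewrite ge_min le_max => /orP[?|?] /orP[?|?];
 rewrite ler_norml; have := ler_norm d; have := ler_norm (- d); rewrite normrN => ? ?;
 by apply/andP; split; lra.
Qed.

End gauss_fun_estimates.

(** * First-order transport of the Gaussian weight on a line *)

Section transport.
Context {R : realType}.
Local Notation mu := (@lebesgue_measure R).
Local Notation p := (@gauss_fun R).
Variables (f Y dY : R -> R) (M L K r : R).
Hypotheses (r0 : 0 < r) (M0 : 0 <= M) (L0 : 0 <= L) (K0 : 0 <= K).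
Hypothesis fM : forall s, `|f s| <= M.
Hypothesis fL : forall s t, `|f s - f t| <= L * `|s - t|.
Hypothesis YdY : forall s : R, is_derive s (1 : R) Y (dY s).
Hypothesis dYc : continuous dY.
Hypothesis YK : forall s, `|Y s| <= K.
Hypothesis dYK : forall s, `|dY s| <= K.
Hypothesis Yr : forall s, r <= `|s| -> Y s = 0.
Hypothesis dYr : forall s, r <= `|s| -> dY s = 0.

(** [D * p] is the derivative of [Y * p]: [D] is the divergence of [Y] with respect to the weight
    p. *)
Let D s := dY s - 2 * s * Y s.

(** For a smooth f, integration by parts would turn the first-order term h int f' Y p into -h int D
    f p, whence the sign + here. For a Lipschitz f the substitution s -> s + h Y s moves the
    derivative onto the weight instead. *)
Definition transport_defect (h s : R) : R := f (s + h * Y s) - f s + h * (D s * f s).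

Let lipschitz_continuous (u : R -> R) (C : R) :
  (forall s t, `|u s - u t| <= C * `|s - t|) -> continuous u.
Proof.
move=> uC x; apply/cvgrPdist_le => /= e e0; near=> t.
apply: (le_trans (uC _ _)).
apply: (@le_trans _ _ ((`|C| + 1) * `|x - t|)).
  by rewrite ler_wpM2r// (le_trans (ler_norm _))// lerDl.
rewrite mulrC -ler_pdivlMr ?ltr_wpDl//.
by near: t; apply: cvgr_dist_le => //; rewrite divr_gt0// ltr_wpDl.
Unshelve. all: by end_near. Qed.

Let fc : continuous f. Proof. exact: lipschitz_continuous fL. Qed.

Let Yc : continuous Y.
Proof. by move=> x; exact: is_derive_continuous (YdY x). Qed.

Let sigma h s := s + h * Y s.

Let sigma_d h s : is_derive s (1 : R) (sigma h) (1 + h * dY s).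
Proof.
by have H := YdY s; apply: is_deriveD.
Qed.

Let sigma_c h : continuous (sigma h).
Proof. by move=> x; exact: is_derive_continuous (sigma_d h x). Qed.

(** [Y] vanishes at -r and r, so [sigma h] fixes both ends, and |h| K < 1 makes it increasing: it
    maps [-r, r] onto itself. *)
Lemma transport_substitution h : `|h| * K < 1 ->
  \int[mu]_(s in `[- r, r]) (f s * p s) =
  \int[mu]_(s in `[- r, r]) (f (sigma h s) * p (sigma h s) * (1 + h * dY s)).
Proof.
move=> hK; congr fine.
have sr : sigma h r = r by rewrite /sigma Yr ?mulr0 ?addr0// ger0_norm// ltW.
have sNr : sigma h (- r) = - r.
  by rewrite /sigma Yr ?mulr0 ?addr0// normrN ger0_norm// ltW.
have s'E : (sigma h)^`()%classic = fun s => 1 + h * dY s.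
  by apply/funext => s; rewrite derive1E; have [_ ->] := sigma_d h s.
have s'c : continuous (fun s => 1 + h * dY s).
  by move=> x; apply: cvgD; [exact: cvg_cst|apply: cvgM; [exact: cvg_cst|exact: dYc]].
have fpc : continuous (fun s => f s * p s).
  by move=> x; apply: cvgM; [exact: fc|exact: continuous_gauss_fun].
transitivity (\int[mu]_(s in `[sigma h (- r), sigma h r]) (f s * p s)%:E)%E.
  by rewrite sr sNr.
rewrite (@integration_by_substitution_increasing _ _ (fun s => f s * p s)).
- by apply: eq_integral => x _; rewrite s'E.
- by have := r0; lra.
- move=> x y _ _ xy; rewrite -subr_gt0.
  have [c _ E] := MVT_segment (ltW xy) (fun x _ => sigma_d h x) (is_derive_within (sigma_d h)).
  rewrite E mulr_gt0 ?subr_gt0//.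
  have : `|h * dY c| < 1 by rewrite normrM (le_lt_trans _ hK)// ler_wpM2l.
  by rewrite ltr_norml => /andP[? _]; lra.
- by rewrite s'E => x _; exact: s'c.
- by rewrite s'E; apply/cvg_ex; exists (1 + h * dY (- r)); apply: cvg_at_right_filter; exact: s'c.
- by rewrite s'E; apply/cvg_ex; exists (1 + h * dY r); apply: cvg_at_left_filter; exact: s'c.
- split.
  + by move=> x _; have [] := sigma_d h x.
  + by apply: cvg_at_right_filter; exact: sigma_c.
  + by apply: cvg_at_left_filter; exact: sigma_c.
- exact: continuous_subspaceT.
Qed.

(** The 7 is 6 + 1: the remainder of [gauss_taylor], and the product of h dY with the variation of p
    along the step. The second term is h D times the variation of f. *)
Let B h := (M * (7 * K ^+ 2) + L * (K ^+ 2 * (1 + 2 * r))) * h ^+ 2.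

Let pointwise h s : - r <= s <= r ->
  `|transport_defect h s * p s
    + (f s * p s - f (sigma h s) * p (sigma h s) * (1 + h * dY s))| <= B h.
Proof.
move=> rs.
(* The first-order terms cancel because D = dY - 2 s Y; every summand left is of order h^2. *)
rewrite (_ : _ + _ = f (sigma h s) * ((p s - p (sigma h s) - 2 * s * (h * Y s) * p s)
      + h * dY s * (p s - p (sigma h s)))
   + h * D s * p s * (f s - f (sigma h s))); last first.
  by rewrite /transport_defect -/(sigma h s) /D; ring.
have hY : `|h * Y s| <= `|h| * K by rewrite normrM ler_wpM2l.
have hdY : `|h * dY s| <= `|h| * K by rewrite normrM ler_wpM2l.
have ps : `|p s - p (sigma h s)| <= `|h| * K.
  by rewrite (le_trans (gauss_lipschitz _ _))// /sigma opprD addrA subrr sub0r normrN.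
have p1 : `|p s| <= 1.
  rewrite (ger0_norm (gauss_ge0 s)); have := gauss_mul_le1 s; have := gauss_ge0 s.
  by have := sqr_ge0 s; nra.
have Dr : `|D s| <= K * (1 + 2 * r).
  rewrite /D (le_trans (ler_normB _ _))// mulrDr mulr1 lerD// !normrM.
  rewrite (ger0_norm (ler0n _ 2)) mulrC ler_pM ?mulr_ge0// ler_wpM2l//.
  by rewrite ler_norml.
have -> : B h = M * (7 * K ^+ 2) * `|h| ^+ 2 + L * (K ^+ 2 * (1 + 2 * r)) * `|h| ^+ 2.
  by rewrite /B -(real_normK (num_real h)) mulrDl.
rewrite (le_trans (ler_normD _ _))// lerD//.
  have -> : M * (7 * K ^+ 2) * `|h| ^+ 2 =
      M * (6 * (`|h| * K) ^+ 2 + (`|h| * K) * (`|h| * K)) by ring.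
  rewrite normrM ler_pM//.
  rewrite (le_trans (ler_normD _ _))// lerD//; last by rewrite normrM ler_pM.
  rewrite (_ : _ - _ = - (p (s + h * Y s) - p s + 2 * s * (h * Y s) * p s)); last first.
    by rewrite /sigma; ring.
  rewrite normrN (le_trans (gauss_taylor _ _))// ler_wpM2l//.
  by rewrite -(real_normK (num_real (h * Y s))) ler_pXn2r// nnegrE ?mulr_ge0.
rewrite (_ : L * _ * _ = (`|h| * (K * (1 + 2 * r)) * 1) * (L * (`|h| * K))); last by ring.
rewrite normrM ler_pM//.
  by rewrite !normrM ler_pM ?mulr_ge0// ler_wpM2l.
rewrite (le_trans (fL _ _))// ler_wpM2l//.
by rewrite /sigma opprD addrA subrr sub0r normrN.
Qed.

Let defect_c h : continuous (transport_defect h).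
Proof.
move=> x; apply: cvgD.
  apply: cvgB; last exact: fc.
  by apply: (@continuous_comp _ _ _ (sigma h) f); [exact: sigma_c|exact: fc].
apply: cvgM; first exact: cvg_cst.
apply: cvgM; last exact: fc.
apply: cvgB; first exact: dYc.
by apply: cvgM; [apply: cvgM; [exact: cvg_cst|exact: cvg_id]|exact: Yc].
Qed.

Lemma transport_defect_far h s : r <= `|s| -> transport_defect h s = 0.
Proof.
by move=> rs; rewrite /transport_defect /D (Yr rs) (dYr rs) (mulr0 h) addr0; ring.
Qed.

Lemma integral_transport_defect h : `|h| * K < 1 ->
  `|\int[mu]_s (transport_defect h s * p s)| <=
    2 * r * ((M * (7 * K ^+ 2) + L * (K ^+ 2 * (1 + 2 * r))) * h ^+ 2).
Proof.
move=> hK.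
have -> : \int[mu]_s (transport_defect h s * p s) =
    \int[mu]_(s in `[- r, r]) (transport_defect h s * p s).
  rewrite [RHS]Rintegral_mkcond; apply: eq_Rintegral => s _.
  rewrite patchE; case: ifPn => // /negP sr; rewrite transport_defect_far ?mul0r//.
  rewrite leNgt; apply/negP => rs; apply: sr; rewrite inE/= in_itv/=.
  by move: (ltW rs); rewrite ler_norml.
have ci (u : R -> R) : continuous u -> mu.-integrable `[- r, r] (EFin \o u).
  move=> cu; apply: continuous_compact_integrable; first exact: segment_compact.
  exact: continuous_subspaceT.
have fp : continuous (fun s => f s * p s).
  by move=> x; apply: cvgM; [exact: fc|exact: continuous_gauss_fun].
have fsp : continuous (fun s => f (sigma h s) * p (sigma h s) * (1 + h * dY s)).
  move=> x; apply: cvgM.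
    by apply: (@continuous_comp _ _ _ (sigma h) (fun s => f s * p s)); [exact: sigma_c|exact: fp].
  by apply: cvgD; [exact: cvg_cst|apply: cvgM; [exact: cvg_cst|exact: dYc]].
have dp : continuous (fun s => transport_defect h s * p s).
  by move=> x; apply: cvgM; [exact: defect_c|exact: continuous_gauss_fun].
have dfp : continuous (fun s => f s * p s - f (sigma h s) * p (sigma h s) * (1 + h * dY s)).
  by move=> x; apply: cvgB; [exact: fp|exact: fsp].
(* The added difference has integral 0 by [transport_substitution], and with it the integrand is
   pointwise of order h^2. *)
have -> : \int[mu]_(s in `[- r, r]) (transport_defect h s * p s) =
   \int[mu]_(s in `[- r, r]) (transport_defect h s * p s
    + (f s * p s - f (sigma h s) * p (sigma h s) * (1 + h * dY s))).
  rewrite RintegralD//; [|exact: ci..].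
  rewrite RintegralB//; [|exact: ci..].
  by rewrite -transport_substitution// subrr addr0.
have sp : continuous (fun s => transport_defect h s * p s
    + (f s * p s - f (sigma h s) * p (sigma h s) * (1 + h * dY s))).
  by move=> x; apply: cvgD; [exact: dp|exact: dfp].
apply: (le_trans (le_normr_Rintegral _ _)) => //; first exact: ci.
rewrite (_ : 2 * r * _ = \int[mu]_(s in `[- r, r]) B h).
  apply: le_Rintegral => //.
  - by apply: ci => x; apply: cvg_norm; exact: sp.
  - by apply: ci => x; exact: cvg_cst.
  - by move=> s /=; rewrite in_itv/=; exact: pointwise.
rewrite Rintegral_cst//.
have -> : fine (mu `[- r, r]) = 2 * r.
  rewrite lebesgue_measure_itv /= lte_fin ifT; last by have := r0; lra.
  by rewrite -EFinB/= opprK; ring.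
by rewrite mulrC.
Qed.

End transport.

Section rational_points.
Context {R : realType} {I : finType}.
Implicit Types x y : I -> R.

Lemma l1distC x y : l1dist x y = l1dist y x.
Proof. by apply: eq_bigr => i _; exact: distrC. Qed.

Definition rat_point (q : {ffun I -> rat}) : I -> R := fun i => ratr (q i).

Lemma rat_point_dense x (e : R) : 0 < e -> exists q, l1dist x (rat_point q) < e.
Proof.
move=> e0; pose m : R := #|I|%:R + 1.
have m0 : 0 < m by rewrite ltr_wpDl.
have /choice[q qP] : forall i, exists q : rat, `|ratr q - x i| < e / m.
  by move=> i; apply: rat_approx; rewrite divr_gt0.
exists [ffun i => q i].
apply: (@le_lt_trans _ _ (\sum_(i : I) e / m)).
  by apply: ler_sum => i _; rewrite /rat_point ffunE distrC ltW.
rewrite sumr_const -[_ *+ #|_|]mulr_natl mulrCA gtr_pMr//.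
by rewrite ltr_pdivrMr// mul1r ltrDl.
Qed.

End rational_points.

(** * Measurability through finitely many real coordinates *)

Section measurability.
Context {R : realType} {I : finType} d (T : measurableType d) (Z : T -> I -> R).
Hypothesis mZ : forall i, measurable_fun setT (fun w => Z w i).

(** The space [I -> R] is given no sigma-algebra: measurability is only asserted of preimages under
    a map [Z] with measurable coordinates, and these open sets are the ones tested. *)
Definition l1open (O : set (I -> R)) := forall x, O x ->
  exists2 e : R, 0 < e & forall y, l1dist x y < e -> O y.

Lemma l1open_measurable (O : set (I -> R)) : l1open O -> measurable [set w | O (Z w)].
Proof.
move=> oO.
apply: (@countable_cover_measurable _ _ ({ffun I -> rat} * nat)%type
  (fun qn => [set w | l1dist (Z w) (rat_point qn.1) < qn.2.+1%:R^-1])) => [qn|w Ow].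
  rewrite -[X in measurable X]setTI.
  have m : measurable_fun setT (fun w => l1dist (Z w) (rat_point qn.1)).
    apply: measurable_sum => i; apply: measurableT_comp => //.
    exact: measurable_funB.
  exact: (measurable_fun_ltr m (measurable_cst _)).
have [e e0 eO] := oO _ Ow.
have [n n0] : exists n : nat, n.+1%:R^-1 < e / 2.
  have e20 : 0 < e / 2 by rewrite divr_gt0.
  near \oo => n; exists n; near: n.
  exact: (near_infty_natSinv_lt (PosNum e20)).
have npos : 0 < n.+1%:R^-1 :> R by rewrite invr_gt0.
have [q qZ] := rat_point_dense (Z w) npos.
exists (q, n) => // w' /= h'; apply: eO.
apply: (le_lt_trans (l1dist_triangle _ (rat_point q) _)).
rewrite [ltRHS]splitr ltrD//; first exact: lt_trans n0.
by rewrite l1distC (lt_trans h').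
Unshelve. all: by end_near. Qed.

Lemma in_box_near (x : I -> R) : exists r : R, forall y, l1dist x y < 1 -> in_box r y.
Proof.
exists (Num.sqrt (sq x) + 1) => y xy i.
rewrite (_ : y i = x i + (y i - x i)); last by ring.
rewrite (le_trans (ler_normD _ _))// lerD ?in_box_sqrt//.
by rewrite distrC (le_trans (le_l1dist x y i))// ltW.
Qed.

Lemma locLip_near (H : (I -> R) -> R) (x : I -> R) (e : R) : locLip H -> 0 < e ->
  exists2 d : R, 0 < d & forall y, l1dist x y < d -> `|H x - H y| < e.
Proof.
move=> lH e0; have [r rP] := in_box_near x.
have [K K0 [_ HK]] := lH r.
have dd : 0 < e / (K + 1) by rewrite divr_gt0// ltr_wpDl.
exists (Num.min 1 (e / (K + 1))); first by rewrite lt_min ltr01.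
move=> y; rewrite lt_min => /andP[y1 y2].
apply: (le_lt_trans (HK _ _ _ (rP _ y1))); first by
  apply: rP; rewrite /l1dist big1// => i _; rewrite subrr normr0.
apply: (@le_lt_trans _ _ ((K + 1) * l1dist x y)).
  by rewrite ler_wpM2r ?l1dist_ge0// lerDl.
by rewrite mulrC -ltr_pdivlMr// ltr_wpDl.
Qed.

Lemma locLip_measurable (H : (I -> R) -> R) : locLip H ->
  measurable_fun setT (fun w => H (Z w)).
Proof.
move=> lH; apply: (measurability _ (measurable_realfun.RGenOpens.measurableE R)) => //.
move=> _ [_ [a [b ->] <-]]; rewrite setTI.
apply: (l1open_measurable (O := [set x | `]a, b[%classic (H x)])) => x /=.
rewrite in_itv/= => /andP[ax xb].
have e0 : 0 < Num.min (H x - a) (b - H x) by rewrite lt_min !subr_gt0 ax.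
have [d0 d00 dP] := locLip_near x lH e0.
exists d0 => // y /dP; rewrite lt_min in_itv/= !ltr_norml => /andP[/andP[h1 h2] /andP[h3 h4]].
by apply/andP; split; lra.
Qed.

End measurability.

Section bounded_integrals.
Context d (T : measurableType d) (R : realType) (P : probability T R).

Lemma bounded_integrable (f : T -> R) (M : R) : measurable_fun setT f ->
  (forall x, `|f x| <= M) -> P.-integrable setT (EFin \o f).
Proof.
move=> mf fM; apply: (@le_integrable _ _ _ P setT measurableT (EFin \o f) (EFin \o cst M)) => //.
- exact/measurable_EFinP.
- by move=> x _ /=; rewrite lee_fin (le_trans (fM x))// ler_norm.
- by apply: finite_measure_integrable_cst.
Qed.

Lemma bounded_Rintegral (f : T -> R) (M : R) : measurable_fun setT f ->
  (forall x, `|f x| <= M) -> `|\int[P]_x f x| <= M.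
Proof.
move=> mf fM; have fi := bounded_integrable mf fM.
apply: (le_trans (le_normr_Rintegral _ _)) => //.
apply: (@le_trans _ _ (\int[P]_(x in setT) M)).
  apply: le_Rintegral => //.
    by apply: (@bounded_integrable _ M) => [|x]; rewrite ?normr_id//; exact: measurableT_comp.
  exact: finite_measure_integrable_cst.
rewrite Rintegral_cst//; have /= -> := probability_setT P.
by rewrite mulr1.
Qed.

End bounded_integrals.

Section plane_measure.
Context {R : realType}.

Lemma leb2_sigma_finite : sigma_finite setT (leb2 R).
Proof.
have /sigma_finiteP[F [TF ndF Foo]] := sigma_finiteT (@lebesgue_measure R).
exists (fun n => F n `*` F n).
  rewrite -setXTT [in LHS]TF predeqE => -[x y]; split.
    move=> [/= [n _ Fnx] [k _ Gky]]; exists (maxn n k) => //; split.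
    - by move: x Fnx; exact/subsetPset/ndF/leq_maxl.
    - by move: y Gky; exact/subsetPset/ndF/leq_maxr.
  by move=> [n _ []/= ? ?]; split; exists n.
move=> k; have [? ?] := Foo k.
split; first exact: measurableX.
by rewrite [ltLHS]product_measure1E// lte_mul_pinfty// ge0_fin_numE.
Qed.

(* The library only infers [sigma_finite] for products of subprobabilities. *)
Definition sleb2 : {sigma_finite_measure set (plane R) -> \bar R} :=
  HB.pack (Measure.sort (leb2 R))
    (Measure_isSigmaFinite.Build _ _ _ (Measure.sort (leb2 R)) leb2_sigma_finite).

End plane_measure.

Section gaussian_law.
Context d (Omega : measurableType d) (R : realType) (P : probability Omega R).
Variable X : {RV P >-> plane R}.
Hypothesis gX : std_complex_gaussian X.

Local Notation q := (fun z : plane R => pi^-1 * expR (- (z.1 ^+ 2 + z.2 ^+ 2)) : R).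
Local Notation mu2 := (@sleb2 R).

Lemma measurable_gauss_density : measurable_fun setT q.
Proof.
apply: measurable_funM => //; apply: measurableT_comp => //.
by apply: measurableT_comp => //; apply: measurable_funD; apply: measurable_funX.
Qed.

Lemma gauss_density_ge0 z : 0 <= q z.
Proof. by rewrite mulr_ge0 ?expR_ge0// invr_ge0 pi_ge0. Qed.

(** Its integral over the plane is the total mass of the law of [X], hence finite. *)
Lemma integrable_gauss_density : mu2.-integrable setT (EFin \o q).
Proof.
apply/integrableP; split; first by apply/measurable_EFinP; exact: measurable_gauss_density.
have := gX measurableT; rewrite probability_setT => h.
under eq_integral do rewrite gee0_abs ?lee_fin ?gauss_density_ge0//.
by rewrite -[ltLHS]h ltry.
Qed.

Lemma gaussian_dominates : distribution P X `<< mu2.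
Proof.
apply/null_content_dominatesP => A mA A0.
rewrite gX//; apply: null_set_integral => //.
by apply: measurable_funTS; apply/measurable_EFinP; exact: measurable_gauss_density.
Qed.

(** The law is given by its values on sets; its Radon-Nikodym derivative agrees almost everywhere
    with the density, since both have the same integral over every measurable set. *)
Lemma integral_gaussian (f : plane R -> R) (M : R) : measurable_fun setT f ->
  (forall z, `|f z| <= M) ->
  \int[distribution P X]_z f z = \int[mu2]_z (f z * q z).
Proof.
move=> mf fM; congr fine.
rewrite -(Radon_Nikodym_change_of_variables gaussian_dominates)//=; last first.
  exact: bounded_integrable mf fM.
apply: ae_eq_integral => //.
- apply: emeasurable_funM => //; first exact/measurable_EFinP.
  apply: (@measurable_int _ _ _ mu2); apply: Radon_Nikodym_integrable; exact: gaussian_dominates.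
- by apply/measurable_EFinP; apply: measurable_funM => //; exact: measurable_gauss_density.
- under [X in ae_eq _ _ _ X]eq_fun do rewrite EFinM.
  apply: ae_eqe_mul2l => /=.
  rewrite Radon_NikodymE//=; first exact: gaussian_dominates.
  move=> abmu; case: cid => /= h [h1 h2 h3].
  apply: integral_ae_eq => //=.
  + by apply/measurable_EFinP; exact: measurable_gauss_density.
  + by move=> E _ mE; rewrite -h3//= gX.
Qed.

End gaussian_law.

Section coordinates.
Context {R : realType} {n : nat}.
Local Notation I := ('I_n * bool)%type.

(** [false] selects the real part and [true] the imaginary part; the same convention indexes the
    real coordinates ['I_n * bool] throughout. *)
Definition plane_coord (b : bool) (z : plane R) : R := if b then z.2 else z.1.

Definition upd_plane (x : I -> R) (k : 'I_n) (z : plane R) : I -> R :=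
  fun i => if i.1 == k then plane_coord i.2 z else x i.

Lemma measurable_plane_coord b : measurable_fun setT (plane_coord b).
Proof.
by case: b; [exact: (@measurable_snd _ _ (measurableTypeR R) (measurableTypeR R))|
  exact: (@measurable_fst _ _ (measurableTypeR R) (measurableTypeR R))].
Qed.

End coordinates.

(** * Resampling one of the independent variables *)

Section resampling.
Context d (Omega : measurableType d) (R : realType) (P : probability Omega R).
Variables (n : nat) (g : 'I_n -> {RV P >-> plane R}).
Hypothesis indep : independent_family g.
Local Notation I := ('I_n * bool)%type.

Definition coords (w : Omega) : I -> R := fun i => plane_coord i.2 (g i.1 w).

Lemma measurable_coords i : measurable_fun setT (fun w => coords w i).
Proof.
by apply: (measurableT_comp (measurable_plane_coord i.2)); exact: measurable_funP.
Qed.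

Variable k : 'I_n.

(* They generate the sigma-algebra of the [g j] with j != k. *)
Definition cylinders : set (set Omega) := [set B | exists A : 'I_n -> set (plane R),
  [/\ forall j, measurable (A j), A k = setT & B = [set w | forall j, A j (g j w)]]].

Local Notation T := (g_sigma_algebraType cylinders).

Lemma cylinder_measurable B : cylinders B -> d.-measurable B.
Proof.
move=> [A [mA _ ->]].
rewrite (_ : [set w | _] = \bigcap_(j in [set: 'I_n]) (g j @^-1` A j)); last first.
  by apply/seteqP; split => [w h j _|w h j]; exact: h.
rewrite bigcap_fset_set//; last exact: finite_finset.
apply: bigsetI_measurable => j _.
by rewrite -[X in measurable X]setTI; exact: measurable_funP.
Qed.

Lemma cylindersI : setI_closed cylinders.
Proof.
move=> _ _ [A [mA Ak ->]] [B [mB Bk ->]]; exists (fun j => A j `&` B j).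
split; [by move=> j; exact: measurableI|by rewrite Ak Bk setTI|].
apply/seteqP; split => [w /= [h1 h2] j|w /= h]; first by split; [exact: h1|exact: h2].
by split => j; have [] := h j.
Qed.

Lemma cylindersT : cylinders setT.
Proof. by exists (fun=> setT); split => //; apply/seteqP; split. Qed.

Lemma g_measurable_T j : j != k -> measurable_fun setT (g j : T -> plane R).
Proof.
move=> jk _ A mA; rewrite setTI; apply: sub_sigma_algebra.
exists (fun i => if i == j then A else setT); split.
- by move=> i; case: ifP.
- by rewrite eq_sym (negbTE jk).
- apply/seteqP; split => w /= h; last by have := h j; rewrite eqxx.
  by move=> i; case: eqP => // ->.
Qed.

(** The identity, read as a random variable with values in [Omega] under the sigma-algebra of the
    other variables. Pairing it with [g k] replaces a joint law on n planes by a product of two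
    factors. *)
Definition toT (w : Omega) : T := w.

Lemma measurable_toT : measurable_fun setT toT.
Proof.
move=> _ A mA; rewrite setTI.
apply: (@smallest_sub _ (sigma_algebra setT) cylinders d.-measurable _ _ _ mA).
  exact: sigma_algebra_measurable.
exact: cylinder_measurable.
Qed.

HB.instance Definition _ := isMeasurableFun.Build _ _ Omega T toT measurable_toT.

Definition joint (w : Omega) : plane R * T := (g k w, toT w).

Lemma measurable_joint : measurable_fun setT joint.
Proof. by apply: measurable_fun_pair; [exact: measurable_funP|exact: measurable_toT]. Qed.

HB.instance Definition _ := isMeasurableFun.Build _ _ Omega (plane R * T)%type joint measurable_joint.

Local Notation lawk := (distribution P (g k)).
Local Notation lawT := (distribution P (toT : {RV P >-> T})).

(** Independence is applied to all indices and to all but k; the two products differ by the factor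
    of index k. *)
Lemma cylinder_indep A B : measurable A -> cylinders B ->
  P (g k @^-1` A `&` B) = (P (g k @^-1` A) * P B)%E.
Proof.
move=> mA [C [mC Ck ->]].
pose D j := if j == k then A else C j.
have mD j : measurable (D j) by rewrite /D; case: ifP.
have := indep [set: 'I_n]%SET mD.
rewrite (bigD1 k) ?inE//= {2}/D eqxx.
have -> : [set w | forall j, j \in [set: 'I_n]%SET -> D j (g j w)] =
    g k @^-1` A `&` [set w | forall j, C j (g j w)].
  apply/seteqP; split => [w /= h|w /= [h1 h2] j _].
    split=> [|j]; first by have := h k (finset.in_setT _); rewrite /D eqxx.
    have := h j (finset.in_setT _); rewrite /D; case: eqP => // -> _.
    by rewrite Ck.
  by rewrite /D; case: eqP => [->|_]; [exact: h1|exact: h2].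
move=> ->; congr (_ * _)%E.
have := indep ([set: 'I_n] :\ k)%SET mC.
have -> : [set w | forall j, j \in ([set: 'I_n] :\ k)%SET -> C j (g j w)] =
    [set w | forall j, C j (g j w)].
  apply/seteqP; split => [w /= h j|w /= h j _]; last exact: h.
  have [->|jk] := eqVneq j k; first by rewrite Ck.
  by apply: h; rewrite !inE jk.
move=> ->; apply: eq_big => [j|j]; rewrite !inE ?andbT//=.
by rewrite /D => /negbTE->.
Qed.

(** For fixed A both sides are finite measures in B that agree on the intersection-stable class of
    cylinders. *)
Lemma generated_indep A (B : set T) : measurable A -> measurable B ->
  P (g k @^-1` A `&` B) = (P (g k @^-1` A) * P B)%E.
Proof.
move=> mA mB.
have mgA : measurable (g k @^-1` A) by rewrite -[X in measurable X]setTI; exact: measurable_funP.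
pose m1 : {measure set T -> \bar R} :=
  measure_function_pushforward__canonical__measure_function_Measure (mrestr P mgA) measurable_toT.
have c0 : 0 <= fine (P (g k @^-1` A)) by apply: fine_ge0; exact: measure_ge0.
pose m2 : {measure set T -> \bar R} := mscale (NngNum c0) lawT.
have m2E C : m2 C = (P (g k @^-1` A) * P C)%E.
  by rewrite /m2 /= /mscale /= fineK// fin_num_measure.
rewrite -m2E setIC.
apply: (@measure_unique _ _ T cylinders (fun=> setT) _ _ _ _ m1 m2) => //.
- exact: cylindersI.
- by move=> _; exact: cylindersT.
- by rewrite bigcup_const//; exists 0%N.
- by move=> C cC; rewrite m2E -cylinder_indep// setIC.
- move=> _; apply: (@le_lt_trans _ _ (P setT)); last by rewrite probability_setT ltry.
  by rewrite /m1 /= /pushforward /mrestr preimage_setT setTI; apply: le_measure; rewrite ?inE.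
Qed.

Lemma joint_law X : measurable X -> (lawk \x lawT)%E X = distribution P joint X.
Proof. by apply: product_measure_unique => A B mA mB /=; exact: generated_indep. Qed.

Lemma measurable_upd_plane i :
  measurable_fun setT (fun zw : plane R * T => upd_plane (coords zw.2) k zw.1 i).
Proof.
rewrite /upd_plane; case: eqP => [_|/eqP ik].
  exact: (measurableT_comp (measurable_plane_coord i.2) measurable_fst).
apply: (measurableT_comp (measurable_plane_coord i.2)).
by apply: (measurableT_comp (g_measurable_T ik)); exact: measurable_snd.
Qed.

Lemma resampling_bound (H : (I -> R) -> R) (M B : R) : locLip H ->
  (forall x, `|H x| <= M) ->
  (forall x, `|\int[lawk]_z H (upd_plane x k z)| <= B) ->
  `|\int[P]_w H (coords w)| <= B.
Proof.
move=> lH HM HB.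
pose F (zw : plane R * T) := H (upd_plane (coords zw.2) k zw.1).
have mF : measurable_fun setT F by exact: (locLip_measurable measurable_upd_plane lH).
have FM z : `|F z| <= M by exact: HM.
have E1 : (\int[P]_w (H (coords w))%:E = \int[distribution P joint]_z (F z)%:E)%E.
  rewrite integral_distribution//; last 2 first.
  - exact/measurable_EFinP.
  - apply: bounded_integrable; last by move=> w; exact: FM.
    exact: (measurableT_comp mF measurable_joint).
  (* Writing the value [g k w] back at place k changes nothing in [coords w]. *)
  apply: eq_integral => w _ /=; congr (H _)%:E; apply/funext => i.
  by rewrite /upd_plane /=; case: eqP => // <-.
have E2 : (\int[distribution P joint]_z (F z)%:E = \int[lawk \x lawT]_z (F z)%:E)%E.
  by apply: eq_measure_integral => A mA _; exact: esym (joint_law mA).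
rewrite /Rintegral E1 E2 -integral21_prod_meas1; last exact: bounded_integrable mF FM.
have iz (w : T) : lawk.-integrable setT (fun z => (F (z, w))%:E).
  apply: bounded_integrable; last by move=> z; exact: FM.
  by apply: (measurableT_comp mF); exact: measurable_pair2.
have G w : fubini_G lawk (EFin \o F) w = (\int[lawk]_z F (z, w))%:E.
  by rewrite /Rintegral fineK//; apply: integrable_fin_num.
under eq_integral do rewrite G.
apply: bounded_Rintegral => [|w]; last exact: (HB (coords w)).
apply/measurable_EFinP.
rewrite (_ : _ \o _ = fubini_G lawk (EFin \o F)); last by apply/funext => w; rewrite G.
apply: (@measurable_fubini_G _ _ _ _ _ lawk lawT). exact: (@bounded_integrable _ _ _ (lawk \x lawT)%E F M).
Qed.

End resampling.

(** * Invariance of the Gaussian measure under the flow *)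

Section plane_gauss.
Context {R : realType}.
Local Notation mu := (@lebesgue_measure R).
Local Notation p := (@gauss_fun R).
Local Notation q := (fun z : plane R => pi^-1 * expR (- (z.1 ^+ 2 + z.2 ^+ 2)) : R).
Variables (phi : plane R -> R) (M B : R).
Hypotheses (mphi : measurable_fun setT phi) (phiM : forall z, `|phi z| <= M).
Hypothesis qi : (@sleb2 R).-integrable setT (EFin \o q).
Hypothesis B0 : 0 <= B.

Let qE z : q z = pi^-1 * (p z.1 * p z.2).
Proof. by rewrite /gauss_fun -expRD -opprD. Qed.

Let phiqi : (@sleb2 R).-integrable setT (fun z => (phi z * q z)%:E).
Proof.
have mq : measurable_fun setT q by exact: measurable_gauss_density.
apply: (@le_integrable _ _ _ (@sleb2 R) setT measurableT _ (fun z => (M%:E * (q z)%:E)%E)).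
- by apply/measurable_EFinP; exact: measurable_funM.
- move=> z _; rewrite -EFinM !abse_EFin lee_fin !normrM ler_wpM2r//.
  by rewrite (le_trans (phiM z))// ler_norm.
- exact: integrableZl.
Qed.

Let slice (psi : R -> R) (t : R) : measurable_fun setT psi -> (forall s, `|psi s| <= M) ->
  (`|\int[mu]_s (psi s * p s)| <= B) ->
  mu.-integrable setT (fun s => (psi s * (pi^-1 * (p s * p t)))%:E) /\
  (`|\int[mu]_s (psi s * (pi^-1 * (p s * p t)))%:E| <= (pi^-1 * B * p t)%:E)%E.
Proof.
move=> mpsi psiM psiB.
have i1 : mu.-integrable setT (fun s => (psi s * p s)%:E).
  apply: (@le_integrable _ _ _ mu setT measurableT _ (fun z => (M%:E * (p z)%:E)%E)).
  - by apply/measurable_EFinP; apply: measurable_funM => //; exact: measurable_gauss_fun.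
  - move=> z _; rewrite -EFinM !abse_EFin lee_fin !normrM ler_wpM2r//.
    by rewrite (le_trans (psiM z))// ler_norm.
  - by apply: integrableZl => //; exact: integrableT_gauss.
have -> : (fun s => (psi s * (pi^-1 * (p s * p t)))%:E) =
    (fun s => ((pi^-1 * p t)%:E * (psi s * p s)%:E)%E).
  by apply/funext => s; rewrite -EFinM; congr EFin; ring.
split; first exact: integrableZl.
have i1f := integrable_fin_num measurableT i1.
rewrite integralZl// -(fineK i1f) -EFinM abse_EFin lee_fin normrM.
rewrite (ger0_norm (x := pi^-1 * p t)) ?mulr_ge0 ?gauss_ge0 ?invr_ge0 ?pi_ge0//.
by rewrite mulrAC ler_wpM2r ?gauss_ge0// ler_wpM2l ?invr_ge0 ?pi_ge0.
Qed.

(** The integral of p over the line is sqrt pi, so the second integration costs the factor sqrt pi /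
    pi <= 1. *)
Let outer (G : R -> \bar R) : measurable_fun setT G ->
  (forall t, (`|G t| <= (pi^-1 * B * p t)%:E)%E) -> (`|\int[mu]_t G t| <= B%:E)%E.
Proof.
move=> mG GB.
apply: (le_trans (le_abse_integral mu measurableT mG)).
apply: (@le_trans _ _ (\int[mu]_t (pi^-1 * B * p t)%:E)%E).
  apply: ge0_le_integral => //.
  - exact: measurableT_comp.
  - by apply/measurable_EFinP; apply: measurable_funM => //; exact: measurable_gauss_fun.
under eq_integral do rewrite EFinM.
rewrite integralZl//; last exact: integrableT_gauss.
rewrite integralT_gauss -EFinM lee_fin mulrC mulrA ler_piMl//.
have pi1 : 1 <= pi :> R by have := @pi_ge2 R; lra.
rewrite -ler_pdivlMr ?invr_gt0 ?pi_gt0// invrK mul1r.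
rewrite -[leRHS]ger0_norm ?pi_ge0// -sqrtr_sqr ler_sqrt ?sqr_ge0// expr2.
by rewrite ler_peMl// (le_trans _ pi1).
Qed.

(** There is one version for each real coordinate of the plane: the coordinate that the Euler step
    moves has to be integrated first. *)
Lemma plane_gauss_bound1 :
  (forall t, `|\int[mu]_s (phi (s, t) * p s)| <= B) ->
  `|\int[@sleb2 R]_z (phi z * q z)| <= B.
Proof.
move=> H; have fi := integrable_fin_num measurableT phiqi.
rewrite -lee_fin -abse_EFin /Rintegral (fineK fi).
rewrite -[integral _ _ _](@integral21_prod_meas1 _ _ _ _ _ mu mu _ phiqi).
have S t := @slice (fun s => phi (s, t)) t.
apply: outer; first exact: (@measurable_fubini_G _ _ _ _ _ mu mu _ phiqi).
move=> t; rewrite /fubini_G; under eq_integral do rewrite qE /=.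
apply: (S t _ _ (H t)).2 => //.
by apply: (measurableT_comp mphi); exact: measurable_pair2.
Qed.

Lemma plane_gauss_bound2 :
  (forall t, `|\int[mu]_s (phi (t, s) * p s)| <= B) ->
  `|\int[@sleb2 R]_z (phi z * q z)| <= B.
Proof.
move=> H; have fi := integrable_fin_num measurableT phiqi.
rewrite -lee_fin -abse_EFin /Rintegral (fineK fi).
rewrite -[integral _ _ _](@integral12_prod_meas1 _ _ _ _ _ mu mu _ phiqi).
have S t := @slice (fun s => phi (t, s)) t.
apply: outer; first exact: (@measurable_fubini_F _ _ _ _ _ mu mu _ phiqi).
move=> t; rewrite /fubini_F; under eq_integral do rewrite qE /= [p t * _]mulrC.
apply: (S t _ _ (H t)).2 => //.
by apply: (measurableT_comp mphi); exact: measurable_pair1.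
Qed.

End plane_gauss.

Section lipschitz_functions.
Context {R : realType} {I : finType}.
Implicit Types (x y : I -> R) (F : (I -> R) -> R).

Lemma lipschitz_locLip F (M L : R) : 0 <= L -> (forall x, `|F x| <= M) ->
  lipschitz_with L F -> locLip F.
Proof.
move=> L0 FM FL r; exists (Num.max M L); first by rewrite le_max L0 orbT.
split=> [x _|x y _ _]; first by rewrite le_max FM.
by apply: (le_trans (FL x y)); rewrite ler_wpM2r ?l1dist_ge0// le_max lexx orbT.
Qed.

End lipschitz_functions.

(** * One Euler step in one coordinate *)

Section one_coordinate.
Context d (Omega : measurableType d) (R : realType) (P : probability Omega R).
Variables (n : nat) (g : 'I_n -> {RV P >-> plane R}).
Hypothesis indep : independent_family g.
Hypothesis gauss : forall k, std_complex_gaussian (g k).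
Local Notation I := ('I_n * bool)%type.

Variables (Y dY : (I -> R) -> R) (i : I) (r K : R).
Hypotheses (r0 : 0 < r) (K0 : 0 <= K).
Hypothesis YdY : forall x s, is_derive s (1 : R) (fun t => Y (upd x i t)) (dY (upd x i s)).
Hypothesis YK : forall x, `|Y x| <= K.
Hypothesis YL : lipschitz_with K Y.
Hypothesis dYK : forall x, `|dY x| <= K.
Hypothesis dYL : lipschitz_with K dY.
Hypothesis Yr : forall x, r <= `|x i| -> Y x = 0.
Hypothesis dYr : forall x, r <= `|x i| -> dY x = 0.

Definition euler_step (h : R) (x : I -> R) : I -> R := upd x i (x i + h * Y x).

(** Along a line in direction i this is [transport_defect]. *)
Definition euler_defect (F : (I -> R) -> R) h x : R :=
  F (euler_step h x) - F x + h * ((dY x - 2 * x i * Y x) * F x).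

Lemma l1dist_euler h x y :
  l1dist (euler_step h x) (euler_step h y) <= (1 + `|h| * K) * l1dist x y.
Proof.
rewrite {1}/l1dist (bigD1 i)//= /euler_step !upd_same.
apply: (@le_trans _ _ (`|x i - y i| + `|h| * `|Y x - Y y| + \sum_(j | j != i) `|x j - y j|)).
  rewrite lerD//; last by apply: ler_sum => j ji; rewrite !upd_other.
  rewrite (_ : _ - _ = (x i - y i) + h * (Y x - Y y)); last by ring.
  by rewrite (le_trans (ler_normD _ _))// normrM.
have E : l1dist x y = `|x i - y i| + \sum_(j | j != i) `|x j - y j|.
  by rewrite /l1dist (bigD1 i).
rewrite addrAC -E.
by rewrite mulrDl mul1r lerD// -mulrA ler_wpM2l// YL.
Qed.

Lemma lipschitz_euler F (L : R) h : 0 <= L -> lipschitz_with L F ->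
  lipschitz_with (L * (1 + `|h| * K)) (F \o euler_step h).
Proof.
move=> L0 FL x y; apply: (le_trans (FL _ _)); rewrite -mulrA ler_wpM2l//.
exact: l1dist_euler.
Qed.

Lemma coord_mul_bound x : `|x i * Y x| <= r * K.
Proof.
have [xr|xr] := leP r `|x i|; first by rewrite (Yr xr) mulr0 normr0 mulr_ge0 // ltW.
by rewrite normrM ler_pM// ltW.
Qed.

Lemma divergence_bound x : `|dY x - 2 * x i * Y x| <= K * (1 + 2 * r).
Proof.
rewrite (le_trans (ler_normB _ _))// mulrDr mulr1 lerD//.
have := coord_mul_bound x => xK; rewrite -[2 * _ * _]mulrA normrM (ger0_norm (ler0n _ 2)); lra.
Qed.

(** The bound of [integral_transport_defect] is weakened to a multiple of M + L by a constant of r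
    and K alone, a form that can be iterated over the coordinates. *)
Definition defect_cst : R := 2 * r * (7 * K ^+ 2 + K ^+ 2 * (1 + 2 * r)).

Lemma defect_cst_ge0 : 0 <= defect_cst.
Proof.
rewrite /defect_cst mulr_ge0//; first by rewrite mulr_ge0// ltW.
rewrite addr_ge0//; first by rewrite mulr_ge0// sqr_ge0.
by rewrite mulr_ge0 ?sqr_ge0// addr_ge0// mulr_ge0// ltW.
Qed.

(** Three reductions: resample the plane variable that contains coordinate i, freeze the other real
    coordinate of this plane, and apply the one-dimensional estimate on the remaining line. *)
Lemma euler_defect_expectation F (M L h : R) : 0 <= M -> 0 <= L ->
  (forall x, `|F x| <= M) -> lipschitz_with L F -> `|h| * K < 1 ->
  `|\int[P]_w euler_defect F h (coords g w)| <= defect_cst * (M + L) * h ^+ 2.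
Proof.
move=> M0 L0 FM FL hK.
have lF : locLip F by exact: lipschitz_locLip FL.
have lY : locLip Y by exact: lipschitz_locLip YL.
have ldY : locLip dY by exact: lipschitz_locLip dYL.
have lH : locLip (euler_defect F h).
  have lFe : locLip (F \o euler_step h).
    apply: (@lipschitz_locLip _ _ _ M (L * (1 + `|h| * K))).
    - by rewrite mulr_ge0// addr_ge0// mulr_ge0.
    - by move=> x; exact: FM.
    - exact: lipschitz_euler.
  apply: locLipD; first by apply: locLipD => //; exact: locLipN.
  apply: locLipM; first exact: locLip_cst.
  apply: locLipM => //; apply: locLipD => //; apply: locLipN; apply: locLipM => //.
  by apply: locLipM; [exact: locLip_cst|exact: locLip_coord].
have HM x : `|euler_defect F h x| <= M + M + `|h| * (K * (1 + 2 * r) * M).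
  rewrite (le_trans (ler_normD _ _))// lerD//.
    by rewrite (le_trans (ler_normB _ _))// lerD.
  by rewrite normrM ler_wpM2l// normrM ler_pM// divergence_bound.
have B0 : 0 <= defect_cst * (M + L) * h ^+ 2.
  by rewrite mulr_ge0 ?sqr_ge0// mulr_ge0 ?addr_ge0// defect_cst_ge0.
apply: (resampling_bound indep (k := i.1) lH HM) => x.
pose phi z := euler_defect F h (upd_plane x i.1 z).
have mphi : measurable_fun setT phi.
  apply: (locLip_measurable (Z := fun z => upd_plane x i.1 z)) => // j.
  rewrite /upd_plane; case: eqP => // _; exact: measurable_plane_coord.
have phiM z : `|phi z| <= M + M + `|h| * (K * (1 + 2 * r) * M) by exact: HM.
rewrite (integral_gaussian (gauss i.1) mphi phiM).
have core x' : `|\int[lebesgue_measure]_s (euler_defect F h (upd x' i s) * gauss_fun s)|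
    <= defect_cst * (M + L) * h ^+ 2.
  have E s : euler_defect F h (upd x' i s) = transport_defect (fun t => F (upd x' i t))
      (fun t => Y (upd x' i t)) (fun t => dY (upd x' i t)) h s.
    by rewrite /euler_defect /transport_defect /euler_step upd_upd upd_same.
  under eq_Rintegral do rewrite E.
  apply: (@le_trans _ _ (2 * r * ((M * (7 * K ^+ 2) + L * (K ^+ 2 * (1 + 2 * r))) * h ^+ 2))).
    apply: integral_transport_defect => //.
    + by move=> s t; rewrite (le_trans (FL _ _))// l1dist_upd.
    + move=> s; apply/cvgrPdist_le => /= e e0; near=> t.
      rewrite (le_trans (dYL _ _))// l1dist_upd.
      apply: (@le_trans _ _ ((K + 1) * `|s - t|)); first by rewrite ler_wpM2r// lerDl.
      rewrite mulrC -ler_pdivlMr ?ltr_wpDl//.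
      by near: t; apply: cvgr_dist_le => //; rewrite divr_gt0// ltr_wpDl.
    + by move=> s rs; apply: Yr; rewrite upd_same.
    + by move=> s rs; apply: dYr; rewrite upd_same.
  rewrite mulrA ler_wpM2r ?sqr_ge0// /defect_cst -[leRHS]mulrA.
  apply: ler_wpM2l; first by rewrite mulr_ge0// ltW.
  have a1 : 0 <= 7 * K ^+ 2 by rewrite mulr_ge0// sqr_ge0.
  have a2 : 0 <= K ^+ 2 * (1 + 2 * r).
    by rewrite mulr_ge0 ?sqr_ge0// addr_ge0// mulr_ge0// ltW.
  have key a b : 0 <= a -> 0 <= b -> M * a + L * b <= (a + b) * (M + L).
    by move=> a0 b0; have := mulr_ge0 M0 b0; have := mulr_ge0 L0 a0; lra.
  exact: key.
(* Whether i is a real or an imaginary part decides the order of the two integrations. *)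
have [b E] : exists b, i = (i.1, b) by exists i.2; case: (i).
have iq := integrable_gauss_density (gauss i.1).
case: b E => E.
  apply: (plane_gauss_bound2 mphi phiM iq B0) => t.
  have Eu s : upd_plane x i.1 (t, s) = upd (upd_plane x i.1 (t, 0)) i s.
    apply/funext => -[j c]; rewrite /upd_plane /upd E /= -pair_eqE /pair_eq /=.
    by case: eqP => //= _; case: c.
  by rewrite /phi; under eq_Rintegral do rewrite Eu; exact: core.
apply: (plane_gauss_bound1 mphi phiM iq B0) => t.
have Eu s : upd_plane x i.1 (s, t) = upd (upd_plane x i.1 (0, t)) i s.
  apply/funext => -[j c]; rewrite /upd_plane /upd E /= -pair_eqE /pair_eq /=.
  by case: eqP => //= _; case: c.
by rewrite /phi; under eq_Rintegral do rewrite Eu; exact: core.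
Unshelve. all: by end_near. Qed.

End one_coordinate.

Section expectation.
Context d (Omega : measurableType d) (R : realType) (P : probability Omega R).
Variables (n : nat) (g : 'I_n -> {RV P >-> plane R}).
Local Notation I := ('I_n * bool)%type.
Implicit Types (F G : (I -> R) -> R) (x y : I -> R).

Definition bounded_locLip F := locLip F /\ exists M, forall x, `|F x| <= M.

Definition esp F : R := \int[P]_w F (coords g w).

Lemma bounded_locLip_integrable F : bounded_locLip F ->
  P.-integrable setT (fun w => (F (coords g w))%:E).
Proof.
move=> [lF [M FM]]; apply: bounded_integrable; last by move=> w; exact: FM.
exact: (locLip_measurable (measurable_coords g) lF).
Qed.

Lemma bounded_locLipD F G : bounded_locLip F -> bounded_locLip G ->
  bounded_locLip (fun x => F x + G x).
Proof.
move=> [lF [M FM]] [lG [N GN]]; split; first exact: locLipD.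
by exists (M + N) => x; rewrite (le_trans (ler_normD _ _))// lerD.
Qed.

Lemma bounded_locLipM F G : bounded_locLip F -> bounded_locLip G ->
  bounded_locLip (fun x => F x * G x).
Proof.
move=> [lF [M FM]] [lG [N GN]]; split; first exact: locLipM.
by exists (M * N) => x; rewrite normrM ler_pM.
Qed.

Lemma bounded_locLipZ (c : R) F : bounded_locLip F -> bounded_locLip (fun x => c * F x).
Proof.
apply: bounded_locLipM; split; first exact: locLip_cst.
by exists `|c|.
Qed.

Lemma bounded_locLip_sum (s : seq I) (D : I -> (I -> R) -> R) :
  (forall i, bounded_locLip (D i)) -> bounded_locLip (fun x => \sum_(i <- s) D i x).
Proof.
move=> bD; elim: s => [|i s IH].
  under eq_fun do rewrite big_nil.
  by split; [exact: locLip_cst|exists 0 => x; rewrite normr0].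
under eq_fun do rewrite big_cons.
exact: bounded_locLipD.
Qed.

Lemma espD F G : bounded_locLip F -> bounded_locLip G ->
  esp (fun x => F x + G x) = esp F + esp G.
Proof. by move=> bF bG; rewrite /esp RintegralD//; exact: bounded_locLip_integrable. Qed.

Lemma espZ c F : bounded_locLip F -> esp (fun x => c * F x) = c * esp F.
Proof. by move=> bF; rewrite /esp RintegralZl//; exact: bounded_locLip_integrable. Qed.

Lemma espB F G : bounded_locLip F -> bounded_locLip G ->
  esp (fun x => F x - G x) = esp F - esp G.
Proof.
move=> bF bG; under [in LHS]eq_fun do rewrite -mulN1r.
by rewrite espD ?espZ ?mulN1r//; exact: bounded_locLipZ.
Qed.

Lemma le_esp F (B : R) : bounded_locLip F -> (forall x, `|F x| <= B) -> `|esp F| <= B.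
Proof.
move=> [lF _] FB; apply: bounded_Rintegral => [|w]; last exact: FB.
exact: (locLip_measurable (measurable_coords g) lF).
Qed.

Lemma lipschitz_bounded_locLip F (M L : R) : 0 <= L -> (forall x, `|F x| <= M) ->
  lipschitz_with L F -> bounded_locLip F.
Proof. by move=> L0 FM FL; split; [exact: lipschitz_locLip FL|exists M]. Qed.

Lemma esp_dist F G (B : R) : bounded_locLip F -> bounded_locLip G ->
  (forall x, `|F x - G x| <= B) -> `|esp F - esp G| <= B.
Proof.
move=> bF bG FG; rewrite -espB//; apply: le_esp => //.
apply: bounded_locLipD => //.
under eq_fun do rewrite -mulN1r; exact: bounded_locLipZ.
Qed.

End expectation.

(** * Expectation along the flow of a compactly supported field *)

Section compact_field.
Context d (Omega : measurableType d) (R : realType) (P : probability Omega R).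
Variables (n : nat) (g : 'I_n -> {RV P >-> plane R}).
Hypothesis indep : independent_family g.
Hypothesis gauss : forall k, std_complex_gaussian (g k).
Local Notation I := ('I_n * bool)%type.
Implicit Types (F G : (I -> R) -> R) (x y : I -> R).

Variables (Y dY : I -> (I -> R) -> R) (f : R -> (I -> R) -> I -> R) (r K : R).
Hypotheses (sY : spherical_field Y dY) (fY : flow_of Y f).
Hypotheses (r0 : 0 < r) (K0 : 0 <= K).
Hypothesis YK : forall i x, `|Y i x| <= K.
Hypothesis YL : forall i, lipschitz_with K (Y i).
Hypothesis dYK : forall i x, `|dY i x| <= K.
Hypothesis dYL : forall i, lipschitz_with K (dY i).
Hypothesis Yr : forall i x, r <= `|x i| -> Y i x = 0.
Hypothesis dYr : forall i x, r <= `|x i| -> dY i x = 0.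

Let m : R := #|{: I}|%:R.
Let m0 : 0 <= m. Proof. by []. Qed.
Let D i x := dY i x - 2 * x i * Y i x.
Let K' := K * (1 + 2 * r).

Let K'0 : 0 <= K'.
Proof. by rewrite mulr_ge0// addr_ge0// mulr_ge0// ltW. Qed.

Let DK i x : `|D i x| <= K'.
Proof. exact: (divergence_bound r0 K0 (YK i) (dYK i) (@Yr i)). Qed.

Let bD i : bounded_locLip (D i).
Proof.
split; last by exists K' => x; exact: DK.
apply: locLipD; first exact: (sf_dlip sY).
apply: locLipN; apply: locLipM; last exact: (sf_lip sY).
by apply: locLipM; [exact: locLip_cst|exact: locLip_coord].
Qed.

(** All coordinates in s move at once, with the field evaluated at the starting point. This explicit
    step is compared with the flow on one side and with successive one-coordinate steps on the
    other. *)
Definition partial_euler (h : R) (s : seq I) x : I -> R :=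
  fun i => if i \in s then x i + h * Y i x else x i.

Let sum_le (u : I -> R) (c : R) : (forall i, u i <= c) -> \sum_i u i <= m * c.
Proof.
move=> uc; apply: (@le_trans _ _ (\sum_(i : I) c)); first exact: ler_sum.
by rewrite sumr_const -mulr_natl.
Qed.

Lemma l1dist_partial_euler h s x y :
  l1dist (partial_euler h s x) (partial_euler h s y) <= (1 + m * (`|h| * K)) * l1dist x y.
Proof.
rewrite mulrDl mul1r -mulrA.
apply: (@le_trans _ _ (\sum_i (`|x i - y i| + `|h| * K * l1dist x y))).
  apply: ler_sum => i _; rewrite /partial_euler; case: ifP => _.
    rewrite (_ : _ - _ = (x i - y i) + h * (Y i x - Y i y)); last by ring.
    rewrite (le_trans (ler_normD _ _))// lerD// normrM -mulrA ler_wpM2l//.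
    exact: YL.
  by rewrite lerDl !mulr_ge0// l1dist_ge0.
rewrite big_split/= lerD//; apply: sum_le => i //.
Qed.

Lemma l1dist_partial_euler_id h s x : l1dist (partial_euler h s x) x <= m * (`|h| * K).
Proof.
apply: sum_le => i; rewrite /partial_euler; case: ifP => _.
  by rewrite addrAC subrr add0r normrM ler_wpM2l.
by rewrite subrr normr0 mulr_ge0.
Qed.

(** Moving coordinate i first shifts by at most |h| K the point where the other components are
    evaluated, and so changes each of their moves by at most |h| K times |h| K. As i is not in s, it
    is not moved twice. *)
Lemma partial_euler_cons h i s x : i \notin s ->
  l1dist (partial_euler h (i :: s) x) (partial_euler h s (euler_step (Y i) i h x)) <=
  m * (`|h| * K * (`|h| * K)).
Proof.
move=> si; apply: sum_le => j; rewrite /partial_euler inE /euler_step.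
have [->|ji] /= := eqVneq j i.
  by rewrite (negbTE si) upd_same subrr normr0 !mulr_ge0.
case: ifP => _; rewrite upd_other// ?subrr ?normr0 ?mulr_ge0//.
rewrite (_ : _ - _ = h * (Y j x - Y j (upd x i (x i + h * Y i x)))); last by ring.
rewrite normrM -mulrA ler_wpM2l// (le_trans (YL _ _ _))// ler_wpM2l//.
rewrite -{1}(upd_id x i) l1dist_upd opprD addrA subrr sub0r normrN normrM.
by rewrite ler_wpM2l.
Qed.

Let lip_comp F (M L h : R) s : 0 <= L -> (forall x, `|F x| <= M) -> lipschitz_with L F ->
  `|h| * K < 1 -> lipschitz_with (L * (1 + m)) (F \o partial_euler h s).
Proof.
move=> L0 FM FL hK x y; apply: (le_trans (FL _ _)); rewrite -mulrA ler_wpM2l//.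
apply: (le_trans (l1dist_partial_euler _ _ _ _)); rewrite ler_wpM2r ?l1dist_ge0//.
by rewrite lerD2l ler_piMr// ltW.
Qed.

Lemma euler_step_expectation F (M L h : R) i : 0 <= M -> 0 <= L ->
  (forall x, `|F x| <= M) -> lipschitz_with L F -> `|h| * K < 1 ->
  `|esp g (F \o euler_step (Y i) i h) - esp g F + h * esp g (fun x => D i x * F x)|
    <= defect_cst r K * (M + L) * h ^+ 2.
Proof.
move=> M0 L0 FM FL hK.
have bF : bounded_locLip F by exact: lipschitz_bounded_locLip FL.
have bFe : bounded_locLip (F \o euler_step (Y i) i h).
  apply: (@lipschitz_bounded_locLip _ _ _ M (L * (1 + `|h| * K))).
  - by rewrite mulr_ge0// addr_ge0// mulr_ge0.
  - by move=> x; exact: FM.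
  - exact: (@lipschitz_euler R n (Y i) i K (YL i) F L h L0 FL).
rewrite -espB// -espZ; last exact: bounded_locLipM.
rewrite -espD; last 2 first.
- apply: bounded_locLipD => //.
  by under eq_fun do rewrite -mulN1r; exact: bounded_locLipZ.
- by apply: bounded_locLipZ; exact: bounded_locLipM.
apply: (euler_defect_expectation indep gauss (Y := Y i) (dY := dY i) (i := i)
  (r := r) (K := K)) => //.
- by move=> x s; exact: (sf_deriv sY).
- by move=> x xr; exact: Yr.
- by move=> x xr; exact: dYr.
Qed.

(** Induction on s: with G = F o [partial_euler h s], the step over i :: s is close to G after one
    step in coordinate i, and G is again bounded and Lipschitz, so the one-coordinate estimate
    applies to it. The constant is uniform in F because F will later be composed with the flow at
    every time. *)
Lemma partial_euler_expectation s : uniq s -> exists2 C : R, 0 <= C &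
  forall F (M L h : R), 0 <= M -> 0 <= L ->
  (forall x, `|F x| <= M) -> lipschitz_with L F -> `|h| * K < 1 ->
  `|esp g (F \o partial_euler h s) - esp g F
     + h * esp g (fun x => (\sum_(i <- s) D i x) * F x)| <= C * (M + L) * h ^+ 2.
Proof.
elim: s => [_|i s IH /= /andP[si us]].
  exists 0 => // F M L h M0 L0 FM FL hK.
  rewrite (_ : F \o _ = F); last by apply/funext.
  rewrite (_ : (fun x => _) = (fun x => 0 * F x)); last by apply/funext => x; rewrite big_nil.
  rewrite espZ; last exact: lipschitz_bounded_locLip FL.
  by rewrite mul0r mulr0 addr0 subrr normr0 !mul0r.
have [C C0 HC] := IH us.
have dc0 := defect_cst_ge0 K r0.
(* In this order: replacing the joint step by successive ones ([e1]), the one-coordinate estimate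
   for [G] ([e2]), replacing [G] by F in the first-order term ([e4]), and the induction hypothesis
   ([e3]). *)
exists (m * K ^+ 2 + defect_cst r K * (1 + m) + K' * (m * K) + C).
  exact: addr_ge0 (addr_ge0 (addr_ge0 (mulr_ge0 m0 (sqr_ge0 K))
    (mulr_ge0 dc0 (addr_ge0 ler01 m0))) (mulr_ge0 K'0 (mulr_ge0 m0 K0))) C0.
move=> F M L h M0 L0 FM FL hK.
set G := F \o partial_euler h s.
have GM x : `|G x| <= M by exact: FM.
have Lm0 : 0 <= L * (1 + m) by rewrite mulr_ge0// addr_ge0.
have GL : lipschitz_with (L * (1 + m)) G by exact: lip_comp FM FL hK.
have bF : bounded_locLip F by exact: lipschitz_bounded_locLip FL.
have bG : bounded_locLip G by exact: lipschitz_bounded_locLip GL.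
have bFi : bounded_locLip (F \o partial_euler h (i :: s)).
  by apply: (lipschitz_bounded_locLip (M := M) Lm0) => [x|]; [exact: FM|exact: lip_comp FM FL hK].
have bGe : bounded_locLip (G \o euler_step (Y i) i h).
  apply: (@lipschitz_bounded_locLip _ _ _ M (L * (1 + m) * (1 + `|h| * K))).
  - by rewrite mulr_ge0// addr_ge0// mulr_ge0.
  - by move=> x; exact: GM.
  - exact: (@lipschitz_euler R n (Y i) i K (YL i) G (L * (1 + m)) h Lm0 GL).
have e1 : `|esp g (F \o partial_euler h (i :: s)) - esp g (G \o euler_step (Y i) i h)|
    <= L * (m * (`|h| * K * (`|h| * K))).
  apply: esp_dist => // x; rewrite /G /= (le_trans (FL _ _))// ler_wpM2l//.
  exact: partial_euler_cons.
have e2 := @euler_step_expectation G M (L * (1 + m)) h i M0 Lm0 GM GL hK.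
have e3 := HC F M L h M0 L0 FM FL hK.
have e4 : `|esp g (fun x => D i x * G x) - esp g (fun x => D i x * F x)|
    <= K' * (L * (m * (`|h| * K))).
  apply: esp_dist; [exact: bounded_locLipM|exact: bounded_locLipM|move=> x].
  rewrite -mulrBr normrM ler_pM// (le_trans (FL _ _))// ler_wpM2l//.
  exact: l1dist_partial_euler_id.
have -> : esp g (fun x => (\sum_(j <- i :: s) D j x) * F x) =
    esp g (fun x => D i x * F x) + esp g (fun x => (\sum_(j <- s) D j x) * F x).
  rewrite -espD; [|exact: bounded_locLipM|].
    by congr esp; apply/funext => x; rewrite big_cons mulrDl.
  by apply: bounded_locLipM => //; exact: bounded_locLip_sum.
move: e1 e2 e3 e4.
move: (esp g (F \o partial_euler h (i :: s))) (esp g (G \o euler_step (Y i) i h))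
  (esp g G) (esp g F) (esp g (fun x => D i x * G x)) (esp g (fun x => D i x * F x))
  (esp g (fun x => (\sum_(j <- s) D j x) * F x)) => a1 a2 a3 a4 a5 a6 a7 e1 e2 e3 e4.
rewrite (_ : a1 - a4 + h * (a6 + a7) = (a1 - a2) + (a2 - a3 + h * a5)
  + (a3 - a4 + h * a7) + h * (a6 - a5)); last by ring.
have e4' : `|h * (a6 - a5)| <= `|h| * (K' * (L * (m * (`|h| * K)))).
  by rewrite normrM ler_wpM2l// distrC.
apply: (@le_trans _ _ (`|a1 - a2| + `|a2 - a3 + h * a5| + `|a3 - a4 + h * a7|
    + `|h * (a6 - a5)|)).
  by do 3 (rewrite (le_trans (ler_normD _ _))// lerD2r).
apply: (@le_trans _ _ (L * (m * (`|h| * K * (`|h| * K)))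
  + defect_cst r K * (M + L * (1 + m)) * h ^+ 2 + C * (M + L) * h ^+ 2
  + `|h| * (K' * (L * (m * (`|h| * K)))))).
  by rewrite !lerD.
rewrite -(real_normK (num_real h)) -subr_ge0.
rewrite (_ : _ - _ = (m * K ^+ 2 * M + defect_cst r K * m * M + K' * (m * K) * M) * `|h| ^+ 2).
  apply: mulr_ge0; last exact: sqr_ge0.
  exact: addr_ge0 (addr_ge0 (mulr_ge0 (mulr_ge0 m0 (sqr_ge0 K)) M0)
    (mulr_ge0 (mulr_ge0 dc0 m0) M0)) (mulr_ge0 (mulr_ge0 K'0 (mulr_ge0 m0 K0)) M0).
ring.
Qed.

(** The speed is at most K in each coordinate, so over a time h the field changes along an orbit by
    at most m K^2 |h|, and each coordinate deviates from the straight line by at most m K^2 h^2. *)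
Let flow_euler h x : l1dist (f h x) (partial_euler h (index_enum I) x) <=
  m * (m * K ^+ 2 * h ^+ 2).
Proof.
have speed t i : `|f t x i - x i| <= K * `|t|.
  have := @is_derive_lipschitz _ (fun s => f s x i) _ 0 t K (fun s => fY.2 x s i).
  by rewrite fY.1 subr0; apply.
apply: sum_le => i; rewrite /partial_euler mem_index_enum /=.
pose w s := f s x i - s * Y i x.
have dw (s : R) : is_derive s (1 : R) w (Y i (f s x) - Y i x).
  have H := fY.2 x s i; apply: is_deriveB; apply: is_derive_eq; rewrite /GRing.scale/=; ring.
have -> : f h x i - (x i + h * Y i x) = w h - w 0.
  by rewrite /w fY.1 mul0r; ring.
apply: (le_trans (@is_derive_lipschitz _ w _ 0 h (m * K ^+ 2 * `|h|) dw _)); last first.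
  by rewrite subr0 -mulrA -expr2 real_normK ?num_real.
move=> t th; apply: (le_trans (YL _ _ _)).
rewrite (_ : m * K ^+ 2 * `|h| = K * (m * (K * `|h|))); last by ring.
rewrite ler_wpM2l//; apply: sum_le => j; apply: (le_trans (speed t j)).
rewrite ler_wpM2l//.
move: th => /andP[]; rewrite ge_min le_max => /orP[?|?] /orP[?|?];
 rewrite ler_norml; have := ler_norm h; have := ler_norm (- h); rewrite normrN => ? ?;
 by apply/andP; split; lra.
Qed.

(** Summed over all coordinates, the first-order term becomes E[(div Y - 2 <x, Y>) F], which is 0
    because Y is divergence free and tangent to the spheres. *)
Lemma flow_step_expectation : exists2 C : R, 0 <= C &
  forall F (M L h : R), 0 <= M -> 0 <= L ->
  (forall x, `|F x| <= M) -> lipschitz_with L F -> bounded_locLip (F \o f h) ->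
  `|h| * K < 1 -> `|esp g (F \o f h) - esp g F| <= C * (M + L) * h ^+ 2.
Proof.
have [C C0 HC] := partial_euler_expectation (index_enum_uniq I).
exists (C + m * (m * K ^+ 2)); first by rewrite addr_ge0// !mulr_ge0// sqr_ge0.
move=> F M L h M0 L0 FM FL bFf hK.
have := HC F M L h M0 L0 FM FL hK.
rewrite (_ : (fun x => _) = (fun x => 0 * F x)); last first.
  apply/funext => x; congr (_ * _); rewrite big_split/= (sf_div sY) add0r sumrN.
  transitivity (- (2 * \sum_i x i * Y i x)); last by rewrite (sf_tangent sY) mulr0 oppr0.
  by congr (- _); rewrite [RHS]mulr_sumr; apply: eq_bigr => i _; rewrite mulrA.
have bF : bounded_locLip F by exact: lipschitz_bounded_locLip FL.
rewrite espZ// mul0r mulr0 addr0 => e1.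
have e2 : `|esp g (F \o f h) - esp g (F \o partial_euler h (index_enum I))|
    <= L * (m * (m * K ^+ 2 * h ^+ 2)).
  apply: esp_dist => //.
    apply: (lipschitz_bounded_locLip (M := M) (L := L * (1 + m))) => [|x|].
    - by rewrite mulr_ge0// addr_ge0.
    - exact: FM.
    - exact: lip_comp FM FL hK.
  by move=> x; rewrite (le_trans (FL _ _))// ler_wpM2l// flow_euler.
rewrite -(subrKA (esp g (F \o partial_euler h (index_enum I)))) (le_trans (ler_normD _ _))//.
apply: (le_trans (lerD e2 e1)); rewrite -subr_ge0.
rewrite (_ : _ - _ = m * (m * K ^+ 2) * M * h ^+ 2); last by ring.
exact: mulr_ge0 (mulr_ge0 (mulr_ge0 m0 (mulr_ge0 m0 (sqr_ge0 K))) M0) (sqr_ge0 h).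
Qed.

Let lip_flow F (M L t : R) : 0 <= M -> 0 <= L -> (forall x, `|F x| <= M) -> lipschitz_with L F ->
  lipschitz_with (L * ((m + 1) * expR (K * m * `|t|))) (F \o f t).
Proof.
move=> M0 L0 FM FL x y; apply: (le_trans (FL _ _)); rewrite -mulrA ler_wpM2l//.
apply: l1dist_le_sq; first exact: expR_ge0.
have := lipschitz_curves K0 YL (fY.2 x) (fY.2 y) t.
(* The Gronwall factor exp(2 K m |t|) is read as the square of exp(K m |t|). *)
by rewrite !fY.1 -expRM_natl mulr_natl -mulr_natl !mulrA.
Qed.

(** Since f_(s+h) = f_s o f_h, the one-step estimate for F o f_s bounds the increment of s ->
    E[F o f_s] by O(h^2) at every s, so this function has derivative 0. *)
Lemma compact_flow_expectation F (M L t : R) : 0 <= M -> 0 <= L ->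
  (forall x, `|F x| <= M) -> lipschitz_with L F -> esp g (F \o f t) = esp g F.
Proof.
move=> M0 L0 FM FL.
have [C C0 HC] := flow_step_expectation.
have bFf s : bounded_locLip (F \o f s).
  apply: (lipschitz_bounded_locLip (M := M) _ _ (lip_flow s M0 L0 FM FL)) => [|x].
    by rewrite mulr_ge0// mulr_ge0 ?expR_ge0// addr_ge0.
  exact: FM.
rewrite (_ : esp g F = esp g (F \o f 0)); last by congr esp; apply/funext => x /=; rewrite fY.1.
apply: (@is_derive_0_is_cst _ (fun s => esp g (F \o f s))) => s.
pose Ls := L * ((m + 1) * expR (K * m * `|s|)).
have Ls0 : 0 <= Ls by rewrite mulr_ge0// mulr_ge0 ?expR_ge0// addr_ge0.
(* The radius (K + 1)^-1 ensures |h| K < 1. *)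
apply: (@is_derive_quadratic _ _ _ _ (C * (M + Ls)) (K + 1)^-1).
  by rewrite invr_gt0 ltr_wpDl.
move=> h hK; rewrite mulr0 subr0.
have hK1 : `|h| * K < 1.
  rewrite (@le_lt_trans _ _ ((K + 1)^-1 * K))//; first by rewrite ler_wpM2r.
  by rewrite mulrC ltr_pdivrMr ?ltr_wpDl// mul1r ltrDl.
have -> : F \o f (s + h) = (F \o f s) \o f h.
  by apply/funext => x /=; rewrite (flow_add sY fY).
have bb : bounded_locLip ((F \o f s) \o f h).
  rewrite (_ : _ \o f h = F \o f (s + h)); first exact: bFf.
  by apply/funext => x /=; rewrite (flow_add sY fY).
exact: (HC (F \o f s) M Ls h M0 Ls0 (fun x => FM _) (lip_flow s M0 L0 FM FL) bb hK1).
Qed.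

End compact_field.

Section locally_lipschitz_flow.
Context {R : realType} {I : finType}.
Variables (X DX : I -> (I -> R) -> R) (f : R -> (I -> R) -> I -> R).
Hypotheses (sX : spherical_field X DX) (fX : flow_of X f).

Lemma sq_in_box r (x : I -> R) : in_box r x -> sq x <= #|I|%:R * r ^+ 2.
Proof.
move=> xr; apply: (@le_trans _ _ (\sum_(i : I) r ^+ 2)).
  apply: ler_sum => i _; have r0 := le_trans (normr_ge0 _) (xr i).
  by rewrite -(real_normK (num_real (x i))) ler_pXn2r// ?nnegrE.
by rewrite sumr_const mulr_natl.
Qed.

Lemma flow_locally_lipschitz (r t : R) : exists2 C : R, 0 <= C & forall x y,
  in_box r x -> in_box r y -> l1dist (f t x) (f t y) <= C * l1dist x y.
Proof.
have [K K0 HK] := locally_lipschitz_curves sX (#|I|%:R * r ^+ 2).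
exists ((#|I|%:R + 1) * expR (K * `|t| / 2)).
  by rewrite mulr_ge0 ?expR_ge0// addr_ge0.
move=> x y xr yr; apply: l1dist_le_sq; first exact: expR_ge0.
have := HK _ _ (fX.2 x) (fX.2 y); rewrite !fX.1 => /(_ (sq_in_box xr) (sq_in_box yr) t).
by rewrite -expRM_natl [2%:R * _]mulrC divfK.
Qed.

Lemma locLip_flow F (M L t : R) : 0 <= L -> (forall x, `|F x| <= M) -> lipschitz_with L F ->
  locLip (F \o f t).
Proof.
move=> L0 FM FL r; have [C C0 HC] := flow_locally_lipschitz r t.
exists (Num.max M (L * C)); first by rewrite le_max mulr_ge0 ?orbT.
split=> [x _|x y xr yr]; first by rewrite le_max FM.
apply: (le_trans (FL _ _)); apply: (@le_trans _ _ (L * C * l1dist x y)).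
  by rewrite -mulrA ler_wpM2l// HC.
by rewrite ler_wpM2r ?l1dist_ge0// le_max lexx orbT.
Qed.

End locally_lipschitz_flow.

Lemma uniform_compact (R : realType) (I : finType) (Z : I -> (I -> R) -> R) (r : R) :
  (forall i, locLip (Z i)) -> 0 <= r -> (forall i j x, r <= `|x j| -> Z i x = 0) ->
  exists2 K : R, 0 <= K & (forall i x, `|Z i x| <= K) /\ forall i, lipschitz_with K (Z i).
Proof.
move=> lZ r0 Zr.
have /choice[K HK] : forall i, exists K : R, 0 <= K /\
    ((forall x, `|Z i x| <= K) /\ lipschitz_with K (Z i)).
  move=> i; have [K K0 HK] := locLip_compact (lZ i) r0 (fun x j => @Zr i j x).
  by exists K.
have Ki i : K i <= \sum_j K j.
  by rewrite (bigD1 i)//= lerDl sumr_ge0// => j _; case: (HK j).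
exists (\sum_i K i) => [|]; first by rewrite sumr_ge0// => i _; case: (HK i).
split=> [i x|i x y]; have [_ [h1 h2]] := HK i.
  exact: le_trans (h1 x) (Ki i).
by apply: (le_trans (h2 x y)); rewrite ler_wpM2r ?l1dist_ge0.
Qed.

Lemma cvg_sum_seq (R : realType) (J T : Type) (F : set_system T) (FF : Filter F) (s : seq J)
  (u : J -> T -> R) (l : J -> R) : (forall j, u j @ F --> l j) ->
  (fun k => \sum_(j <- s) u j k) @ F --> \sum_(j <- s) l j.
Proof.
move=> ul; elim: s => [|j s IH].
  by rewrite big_nil; under eq_fun do rewrite big_nil; exact: cvg_cst.
by rewrite big_cons; under eq_fun do rewrite big_cons; exact: cvgD.
Qed.

(** * Removal of the cutoff *)

Section liouville.
Context d (Omega : measurableType d) (R : realType) (P : probability Omega R).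
Variables (n : nat) (g : 'I_n -> {RV P >-> plane R}).
Hypothesis indep : independent_family g.
Hypothesis gauss : forall k, std_complex_gaussian (g k).
Local Notation I := ('I_n * bool)%type.
Variables (X DX : I -> (I -> R) -> R) (f : R -> (I -> R) -> I -> R).
Hypotheses (sX : spherical_field X DX) (fX : flow_of X f).

Lemma cut_flow_expectation (e t M L : R) (F : (I -> R) -> R) : 0 < e -> 0 <= M -> 0 <= L ->
  (forall x, `|F x| <= M) -> lipschitz_with L F ->
  esp g (F \o cut_flow f e t) = esp g F.
Proof.
move=> e0 M0 L0 FM FL.
have sY := cut_spherical sX e.
have r0 : 0 < Num.sqrt e^-1 by rewrite sqrtr_gt0 invr_gt0.
have [K1 K10 [Y1 Y2]] := uniform_compact (sf_lip sY) (ltW r0)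
  (fun i j x => @cut_field_far _ _ X e e0 i j x).
have [K2 K20 [D1 D2]] := uniform_compact (sf_dlip sY) (ltW r0)
  (fun i j x => @cut_dfield_far _ _ X DX e e0 i j x).
pose K := Num.max K1 K2.
apply: (compact_flow_expectation indep gauss sY (cut_flow_of sX fX e) (r := Num.sqrt e^-1)
  (K := K) r0 _ _ _ _ _ _ _ t M0 L0 FM FL).
- by rewrite le_max K10.
- by move=> i x; rewrite le_max Y1.
- by move=> i x y; rewrite (le_trans (Y2 i x y))// ler_wpM2r ?l1dist_ge0// le_max lexx.
- by move=> i x; rewrite le_max D1 orbT.
- by move=> i x y; rewrite (le_trans (D2 i x y))// ler_wpM2r ?l1dist_ge0// le_max lexx orbT.
- by move=> i x xi; exact: cut_field_far xi.
- by move=> i x xi; exact: cut_dfield_far xi.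
Qed.

(** As e = 1 / (k + 1) tends to 0, the cutoff at the fixed x tends to 1, so the rescaled time tends
    to t, and orbits are continuous in time. *)
Lemma cut_flow_cvg (F : (I -> R) -> R) (L t : R) x : 0 <= L -> lipschitz_with L F ->
  (fun k : nat => F (cut_flow f k.+1%:R^-1 t x)) @ \oo --> F (f t x).
Proof.
move=> L0 FL.
have c1 : (fun k : nat => cutoff k.+1%:R^-1 x) @ \oo --> (1 : R).
  rewrite -[X in _ --> X](_ : Num.max 0 (1 - 0 * sq x) ^+ 2 = 1); last first.
    by rewrite mul0r subr0 max_r// expr1n.
  have h0 : (fun k : nat => 1 - k.+1%:R^-1 * sq x) @ \oo --> (1 - 0 * sq x).
    apply: cvgB; first exact: cvg_cst.
    by apply: cvgM; [exact: cvg_harmonic|exact: cvg_cst].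
  have h1 : (fun k : nat => Num.max 0 (1 - k.+1%:R^-1 * sq x)) @ \oo --> Num.max 0 (1 - 0 * sq x).
    apply/cvgrPdist_le => e e0; have /cvgrPdist_le/(_ _ e0) h0e := h0.
    near=> k; apply: (le_trans (max_dist _ _ _)); near: k; exact: h0e.
  rewrite expr2; under eq_fun do rewrite /cutoff expr2.
  exact: cvgM.
have ci i : (fun k : nat => f (cutoff k.+1%:R^-1 x * t) x i) @ \oo --> f t x i.
  have ct : (fun k : nat => cutoff k.+1%:R^-1 x * t) @ \oo --> t.
    by rewrite -[X in _ --> X]mul1r; apply: cvgM => //; exact: cvg_cst.
  exact: (continuous_cvg _ (is_derive_continuous (fX.2 x t i)) ct).
have cd : (fun k : nat => L * l1dist (f t x) (cut_flow f k.+1%:R^-1 t x)) @ \oo --> 0.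
  rewrite -(mulr0 L); apply: cvgM; first exact: cvg_cst.
  rewrite -[X in _ --> X](_ : l1dist (f t x) (f t x) = 0); last first.
    by rewrite /l1dist big1// => i _; rewrite subrr normr0.
  rewrite /l1dist; apply: cvg_sum_seq => i; apply: cvg_norm.
  by apply: cvgB; [exact: cvg_cst|exact: ci].
apply/cvgrPdist_le => e e0; have /cvgrPdist_le/(_ _ e0) cde := cd; near=> k.
apply: (le_trans (FL _ _)).
apply: (le_trans (ler_norm _)); rewrite -normrN -[X in `|X|]add0r.
by near: k; exact: cde.
Unshelve. all: by end_near. Qed.

(** The expectations along the cut flows all equal [esp g F]; dominated convergence, with the
    constant M as majorant, gives the same value for the flow itself. *)
Lemma flow_expectation (t M L : R) (F : (I -> R) -> R) : 0 <= M -> 0 <= L ->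
  (forall x, `|F x| <= M) -> lipschitz_with L F ->
  esp g (F \o f t) = esp g F.
Proof.
move=> M0 L0 FM FL.
have lc := locLip_flow sX fX t L0 FM FL.
have lk k : locLip (F \o cut_flow f k.+1%:R^-1 t).
  have e0 : 0 < k.+1%:R^-1 :> R by rewrite invr_gt0.
  exact: (locLip_flow (cut_spherical sX _) (cut_flow_of sX fX _) t L0 FM FL).
have cv : (fun k => esp g (F \o cut_flow f k.+1%:R^-1 t)) @ \oo --> esp g (F \o f t).
  have h1 : {ae P, forall w, setT w ->
      (fun k => (F (cut_flow f k.+1%:R^-1 t (coords g w)))%:E) @ \oo --> (F (f t (coords g w)))%:E}.
    by apply: aeW => w _; apply: cvg_EFin; [exact: nearW|exact: cut_flow_cvg FL].
  have h2 : {ae P, forall w k, setT w ->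
      (`|(F (cut_flow f k.+1%:R^-1 t (coords g w)))%:E| <= cst M%:E w)%E}.
    by apply: aeW => w k _; rewrite lee_fin.
  have [iF _ cF] := dominated_convergence measurableT
    (fun k => measurableT_comp (@EFin_measurable _ setT) (locLip_measurable (measurable_coords g) (lk k)))
    (measurableT_comp (@EFin_measurable _ setT) (locLip_measurable (measurable_coords g) lc))
    h1 (finite_measure_integrable_cst P M measurableT) h2.
  apply: fine_cvg; rewrite /esp /Rintegral fineK //.
  exact: (integrable_fin_num measurableT iF).
have e k : esp g (F \o cut_flow f k.+1%:R^-1 t) = esp g F.
  by apply: cut_flow_expectation FM FL => //; rewrite invr_gt0.
move: cv; rewrite (_ : (fun k => _) = cst (esp g F)); last by apply/funext => k; rewrite e.
by move/(cvg_lim (@Rhausdorff R)) => <-; rewrite (cvg_lim (@Rhausdorff R) (cvg_cst _)).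
Qed.

End liouville.

(** * The space L^2 *)

Local Open Scope complex_scope.
Local Notation Re := complex.Re.
Local Notation Im := complex.Im.
Local Notation normc := Normc.normc.

Section complex_integral.
Context d (T : measurableType d) (R : realType) (mu : {measure set T -> \bar R}) (D : set T).
Hypothesis mD : measurable D.
Implicit Types (f g : T -> R[i]).

Definition cintegrable f := mu.-integrable D (fun x => (Re (f x))%:E) /\
  mu.-integrable D (fun x => (Im (f x))%:E).

Lemma cintegrable_lin (a : R[i]) f g : cintegrable f -> cintegrable g ->
  cintegrable (fun x => a * f x + g x).
Proof.
move=> [f1 f2] [g1 g2]; split.
  under eq_fun do rewrite ReD EFinD EFinB !EFinM.
  by apply: integrableD => //; apply: integrableB => //; exact: integrableZl.
under eq_fun do rewrite ImD 2!EFinD !EFinM.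
by apply: integrableD => //; apply: integrableD => //; exact: integrableZl.
Qed.

Lemma cintegral_lin (a : R[i]) f g : cintegrable f -> cintegrable g ->
  cintegral mu D (fun x => a * f x + g x) = a * cintegral mu D f + cintegral mu D g.
Proof.
move=> [f1 f2] [g1 g2].
have Z (c : R) (h : T -> R) : mu.-integrable D (fun x => (h x)%:E) ->
    mu.-integrable D (fun x => (c * h x)%:E).
  by move=> hi; under eq_fun do rewrite EFinM; exact: integrableZl.
have B (h k : T -> R) : mu.-integrable D (fun x => (h x)%:E) ->
    mu.-integrable D (fun x => (k x)%:E) -> mu.-integrable D (fun x => (h x - k x)%:E).
  by move=> hi ki; under eq_fun do rewrite EFinB; exact: integrableB.
have A (h k : T -> R) : mu.-integrable D (fun x => (h x)%:E) ->
    mu.-integrable D (fun x => (k x)%:E) -> mu.-integrable D (fun x => (h x + k x)%:E).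
  by move=> hi ki; under eq_fun do rewrite EFinD; exact: integrableD.
apply/eqP; rewrite eq_complex ReD ImD /cintegral /=; apply/andP; split; apply/eqP.
  under eq_Rintegral do rewrite ReD.
  rewrite RintegralD//; last by apply: B; exact: Z.
  by rewrite RintegralB// ?RintegralZl//; exact: Z.
under eq_Rintegral do rewrite ImD.
rewrite RintegralD//; last by apply: A; exact: Z.
by rewrite RintegralD// ?RintegralZl//; exact: Z.
Qed.

Lemma cintegrable0 : cintegrable (fun=> 0).
Proof. by split; exact: integrable0. Qed.

Lemma cintegral0 : cintegral mu D (fun=> 0) = 0.
Proof. by rewrite /cintegral/= /Rintegral integral0_eq. Qed.

Lemma cintegrable_sum (J : Type) (s : seq J) (c : J -> R[i]) (F : J -> T -> R[i]) :
  (forall j, cintegrable (F j)) -> cintegrable (fun x => \sum_(j <- s) c j * F j x).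
Proof.
move=> iF; elim: s => [|j s IH].
  by under eq_fun do rewrite big_nil; exact: cintegrable0.
by under eq_fun do rewrite big_cons; exact: cintegrable_lin.
Qed.

Lemma cintegral_sum (J : Type) (s : seq J) (c : J -> R[i]) (F : J -> T -> R[i]) :
  (forall j, cintegrable (F j)) ->
  cintegral mu D (fun x => \sum_(j <- s) c j * F j x) =
  \sum_(j <- s) c j * cintegral mu D (F j).
Proof.
move=> iF; elim: s => [|j s IH].
  by under eq_fun do rewrite big_nil; rewrite big_nil cintegral0.
under eq_fun do rewrite big_cons.
by rewrite cintegral_lin// ?IH ?big_cons//; exact: cintegrable_sum.
Qed.

Lemma ReJ (z : R[i]) : Re z^* = Re z. Proof. by case: z. Qed.
Lemma ImJ (z : R[i]) : Im z^* = - Im z. Proof. by case: z. Qed.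

Lemma cintegral_conj f : cintegrable f ->
  cintegral mu D (fun x => (f x)^*) = (cintegral mu D f)^*.
Proof.
move=> [f1 f2]; apply/eqP; rewrite eq_complex ReJ ImJ /cintegral/=.
under eq_Rintegral do rewrite ReJ; rewrite eqxx /=.
apply/eqP; under eq_Rintegral do rewrite ImJ -mulN1r.
by rewrite RintegralZl// mulN1r.
Qed.

Definition cmeas f := measurable_fun D (fun x => Re (f x)) /\ measurable_fun D (fun x => Im (f x)).

Lemma ae_cintegral f g : cmeas f -> cmeas g -> {ae mu, forall x, D x -> f x = g x} ->
  cintegral mu D f = cintegral mu D g.
Proof.
move=> [f1 f2] [g1 g2] fg; apply/eqP; rewrite eq_complex; apply/andP; split; apply/eqP;
  congr fine; apply: ae_eq_integral => //; try exact/measurable_EFinP.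
- by apply: filterS fg => x h Dx; rewrite h.
- by apply: filterS fg => x h Dx; rewrite h.
Qed.

Lemma normRe (z : R[i]) : `|Re z| <= normc z.
Proof. by case: z => a b /=; rewrite -sqrtr_sqr ler_wsqrtr// lerDl sqr_ge0. Qed.

Lemma normIm (z : R[i]) : `|Im z| <= normc z.
Proof. by case: z => a b /=; rewrite -sqrtr_sqr ler_wsqrtr// lerDr sqr_ge0. Qed.

Lemma le_cintegrable f (h : T -> R) : cmeas f -> mu.-integrable D (fun x => (h x)%:E) ->
  (forall x, normc (f x) <= h x) -> cintegrable f.
Proof.
move=> [f1 f2] hi fh; split; apply: (le_integrable mD _ _ hi); try exact/measurable_EFinP.
- move=> x _; rewrite !abse_EFin lee_fin (le_trans (normRe _))// (le_trans (fh x))//.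
  exact: ler_norm.
- move=> x _; rewrite !abse_EFin lee_fin (le_trans (normIm _))// (le_trans (fh x))//.
  exact: ler_norm.
Qed.

Lemma le_Rintegral_norm (u h : T -> R) : mu.-integrable D (fun x => (u x)%:E) ->
  mu.-integrable D (fun x => (h x)%:E) -> (forall x, `|u x| <= h x) ->
  `|\int[mu]_(x in D) u x| <= \int[mu]_(x in D) h x.
Proof.
move=> ui hi uh; apply: (le_trans (le_normr_Rintegral mD ui)).
by apply: le_Rintegral => //; exact: integrable_norm.
Qed.

End complex_integral.

Section inner_product.
Context {R : realType}.
Local Notation mu := (leb2 R).
Implicit Types (u v w : plane R -> R[i]).

Definition nm u : R := fine (L2norm u).

Lemma nm_ge0 u : 0 <= nm u.
Proof. by rewrite fine_ge0// L2norm_ge0. Qed.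

Lemma L2normE u : L2 u -> L2norm u = (nm u)%:E.
Proof. by move=> [_ _ h]; rewrite fineK// ge0_fin_numE ?L2norm_ge0. Qed.

Lemma L2_sq_integral u : L2 u ->
  (\int[mu]_x ((normc (u x)) ^+ 2)%:E = (nm u ^+ 2)%:E)%E.
Proof.
move=> Lu; have := L2normE Lu; rewrite /L2norm unlock.
under eq_integral => x _.
  rewrite abse_EFin poweR_EFin (ger0_norm (normc_ge0 _)) (@powR_mulrn _ _ 2) ?normc_ge0//.
  over.
move=> h.
have I0 : (0 <= \int[mu]_x ((normc (u x)) ^+ 2)%:E)%E.
  by apply: integral_ge0 => x _; rewrite lee_fin sqr_ge0.
move: h; set I := integral _ _ _.
have : (0 <= I)%E by [].
case: I => [s s0|_|//].
  rewrite poweR_EFin => -[<-]; congr EFin.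
  by rewrite -powR_mulrn ?powR_ge0// -powRrM mulVf// powRr1.
(* An infinite integral would make the norm infinite. *)
by rewrite poweRyr ?invr_eq0.
Qed.

Lemma L2_sq_integrable u : L2 u -> mu.-integrable setT (fun x => (normc (u x) ^+ 2)%:E).
Proof.
move=> Lu; apply/integrableP; split.
  by apply/measurable_EFinP; apply: measurable_funX; exact: measurable_normc (L2_cmeasurable Lu).
under eq_integral do rewrite abse_EFin ger0_norm ?sqr_ge0//.
by rewrite L2_sq_integral// ltry.
Qed.

Lemma cmeasurable_mulJ u v : cmeasurable u -> cmeasurable v ->
  cmeasurable (fun x => u x * (v x)^*).
Proof.
have ReM (a b : R[i]) : Re (a * b^*) = Re a * Re b + Im a * Im b.
  by case: a b => [? ?] [? ?] /=; rewrite mulrN opprK.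
have ImM (a b : R[i]) : Im (a * b^*) = - (Re a * Im b) + Im a * Re b.
  by case: a b => [? ?] [? ?] /=; rewrite mulrN.
move=> [u1 u2] [v1 v2]; split.
  by under eq_fun do rewrite ReM; apply: measurable_funD; exact: measurable_funM.
under eq_fun do rewrite ImM; apply: measurable_funD; last exact: measurable_funM.
by apply: measurableT_comp => //; exact: measurable_funM.
Qed.

Lemma normcJ (z : R[i]) : normc z^* = normc z.
Proof. by case: z => a b /=; rewrite sqrrN. Qed.

Lemma L2_norm_mul u v : L2 u -> L2 v ->
  mu.-integrable setT (fun x => (normc (u x) * normc (v x))%:E).
Proof.
move=> Lu Lv; have iu := L2_sq_integrable Lu; have iv := L2_sq_integrable Lv.
have mnu := measurable_normc (L2_cmeasurable Lu); have mnv := measurable_normc (L2_cmeasurable Lv).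
apply: (le_integrable measurableT _ _ (integrableD measurableT iu iv)) => //.
  by apply/measurable_EFinP; exact: measurable_funM.
move=> x _; rewrite -EFinD !abse_EFin lee_fin !ger0_norm ?addr_ge0 ?mulr_ge0 ?sqr_ge0 ?normc_ge0//.
have := sqr_ge0 (normc (u x) - normc (v x)).
have := normc_ge0 (u x); have := normc_ge0 (v x); nra.
Qed.

Lemma inner_integrable u v : L2 u -> L2 v -> cintegrable mu setT (fun x => u x * (v x)^*).
Proof.
move=> Lu Lv; apply: (le_cintegrable measurableT _ (L2_norm_mul Lu Lv)).
  exact: cmeasurable_mulJ (L2_cmeasurable Lu) (L2_cmeasurable Lv).
by move=> x; rewrite Normc.normcM normcJ.
Qed.

Lemma cauchy_schwarz u v : L2 u -> L2 v ->
  \int[mu]_x (normc (u x) * normc (v x)) <= nm u * nm v.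
Proof.
move=> Lu Lv; have i := L2_norm_mul Lu Lv.
have mnu := measurable_normc (L2_cmeasurable Lu); have mnv := measurable_normc (L2_cmeasurable Lv).
have := @hoelder _ _ _ mu _ _ 2 2 mnu mnv (ltr0n _ 2) (ltr0n _ 2).
rewrite Lnorm1 -[Lnorm _ _ (EFin \o (fun x => normc (u x)))]/(L2norm u).
rewrite -[Lnorm _ _ (EFin \o (fun x => normc (v x)))]/(L2norm v) !L2normE// -EFinM.
under eq_integral do rewrite /= ger0_norm ?mulr_ge0 ?normc_ge0//.
rewrite -lee_fin /Rintegral fineK; last exact: integrable_fin_num.
by apply; lra.
Qed.

Lemma inner_bound u v : L2 u -> L2 v ->
  `|Re (inner u v)| <= nm u * nm v /\ `|Im (inner u v)| <= nm u * nm v.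
Proof.
move=> Lu Lv; have [i1 i2] := inner_integrable Lu Lv.
have cs := cauchy_schwarz Lu Lv.
split; apply: (le_trans _ cs); apply: le_Rintegral_norm => //; try exact: L2_norm_mul.
- by move=> x; rewrite (le_trans (normRe _))// Normc.normcM normcJ.
- by move=> x; rewrite (le_trans (normIm _))// Normc.normcM normcJ.
Qed.

Lemma inner_lin (a : R[i]) u v w : L2 u -> L2 v -> L2 w ->
  inner (fun x => a * u x + v x) w = a * inner u w + inner v w.
Proof.
move=> Lu Lv Lw; rewrite /inner -cintegral_lin//; [|exact: inner_integrable..].
by congr cintegral; apply/funext => x; rewrite mulrDl mulrA.
Qed.

Lemma inner_conj u v : L2 u -> L2 v -> inner v u = (inner u v)^*.
Proof.
move=> Lu Lv; rewrite /inner -cintegral_conj//; last exact: inner_integrable.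
congr cintegral; apply/funext => x.
by rewrite rmorphM /= conjcK mulrC.
Qed.

Lemma L20 : L2 (fun=> 0 : R[i]).
Proof. exact: eigenfunction_L2 (eigenfunction0 R 0). Qed.

Lemma inner0 w : L2 w -> inner (fun=> 0) w = 0.
Proof.
by move=> Lw; rewrite /inner; under eq_fun do rewrite mul0r; exact: cintegral0.
Qed.

Lemma L2Z (a : R[i]) u : L2 u -> L2 (fun x => a * u x).
Proof.
by move=> Lu; have := L2_lin a Lu L20; congr L2; apply/funext => x; rewrite addr0.
Qed.

Lemma L2B u v : L2 u -> L2 v -> L2 (fun x => u x - v x).
Proof.
by move=> Lu Lv; have := L2_lin (-1) Lv Lu; congr L2; apply/funext => x; rewrite mulN1r addrC.
Qed.

Lemma innerZl (a : R[i]) u w : L2 u -> L2 w -> inner (fun x => a * u x) w = a * inner u w.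
Proof.
move=> Lu Lw; have := inner_lin a Lu L20 Lw; rewrite inner0// addr0 => <-.
by congr inner; apply/funext => x; rewrite addr0.
Qed.

Lemma innerB u v w : L2 u -> L2 v -> L2 w ->
  inner (fun x => u x - v x) w = inner u w - inner v w.
Proof.
move=> Lu Lv Lw; have := inner_lin (-1) Lv Lu Lw; rewrite mulN1r addrC => <-.
by congr inner; apply/funext => x; rewrite mulN1r addrC.
Qed.

Lemma L2_sum (J : Type) (s : seq J) (c : J -> R[i]) (F : J -> plane R -> R[i]) :
  (forall j, L2 (F j)) -> L2 (fun x => \sum_(j <- s) c j * F j x).
Proof.
move=> LF; elim: s => [|j s IH]; first by under eq_fun do rewrite big_nil; exact: L20.
by under eq_fun do rewrite big_cons; exact: L2_lin.
Qed.

Lemma inner_sum (J : Type) (s : seq J) (c : J -> R[i]) (F : J -> plane R -> R[i]) w :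
  (forall j, L2 (F j)) -> L2 w ->
  inner (fun x => \sum_(j <- s) c j * F j x) w = \sum_(j <- s) c j * inner (F j) w.
Proof.
move=> LF Lw; elim: s => [|j s IH].
  by under eq_fun do rewrite big_nil; rewrite big_nil inner0.
under eq_fun do rewrite big_cons.
by rewrite inner_lin// ?IH ?big_cons//; exact: L2_sum.
Qed.

Lemma inner_ae u u' v v' : L2 u -> L2 u' -> L2 v -> L2 v' ->
  {ae mu, forall x, u x = u' x} -> {ae mu, forall x, v x = v' x} ->
  inner u v = inner u' v'.
Proof.
move=> Lu Lu' Lv Lv' uu' vv'; apply: ae_cintegral => //.
- exact: cmeasurable_mulJ (L2_cmeasurable Lu) (L2_cmeasurable Lv).
- exact: cmeasurable_mulJ (L2_cmeasurable Lu') (L2_cmeasurable Lv').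
- by apply: filterS2 uu' vv' => x -> ->.
Qed.

Lemma inner_self u : L2 u -> inner u u = (nm u ^+ 2)%:C.
Proof.
move=> Lu; apply/eqP; rewrite eq_complex /inner /cintegral /=; apply/andP; split; apply/eqP.
  rewrite /Rintegral -[RHS]/(fine (nm u ^+ 2)%:E) -(L2_sq_integral Lu); congr fine.
  apply: eq_integral => x _; congr EFin; case: (u x) => a b /=.
  by rewrite sqr_sqrtr ?addr_ge0 ?sqr_ge0// mulrN opprK !expr2.
rewrite /Rintegral integral0_eq// => x _; congr EFin.
by case: (u x) => a b /=; rewrite mulrN [b * a]mulrC addNr.
Qed.

Lemma nm0_ae u : L2 u -> nm u = 0 -> {ae mu, forall x, u x = 0}.
Proof.
move=> Lu n0; have h := L2normE Lu; rewrite n0 in h.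
have mn := measurable_normc (L2_cmeasurable Lu).
have := @Lnorm_eq0_eq0 _ _ _ mu _ 2%:E (measurableT_comp (@EFin_measurable R setT) mn) _ h.
rewrite lte_fin ltr0n => /(_ isT); apply: filterS => x /(_ I) [] /Normc.eq0_normc.
by [].
Qed.

Lemma L2norm_ae u v : L2 u -> L2 v -> {ae mu, forall x, u x = v x} -> L2norm u = L2norm v.
Proof.
move=> Lu Lv uv; rewrite !L2normE//; congr EFin.
have := inner_ae Lu Lv Lu Lv uv uv; rewrite !inner_self// => -[/eqP].
by rewrite eqrXn2 ?nm_ge0// => /eqP.
Qed.

(** The filter is arbitrary because this serves both the approximating sequences of [Hgraph] and the
    difference quotients as h tends to 0. *)
Lemma inner_cvg (T : Type) (F : set_system T) (FF : Filter F) (w : T -> plane R -> R[i]) u v :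
  (forall t, L2 (w t)) -> L2 u -> L2 v ->
  (fun t => L2norm (fun x => w t x - u x)) @ F --> 0%E ->
  (fun t => Re (inner (w t) v)) @ F --> Re (inner u v) /\
  (fun t => Im (inner (w t) v)) @ F --> Im (inner u v).
Proof.
move=> Lw Lu Lv /fine_cvg wu.
have c0 : (fun t => nm (fun x => w t x - u x) * nm v) @ F --> 0.
  by rewrite -(mul0r (nm v)); apply: cvgM => //; exact: cvg_cst.
have b t := inner_bound (L2B (Lw t) Lu) Lv.
have ib t : inner (fun x => w t x - u x) v = inner (w t) v - inner u v.
  exact: innerB.
split; apply/cvgrPdist_le => e e0; have /cvgrPdist_le/(_ _ e0) c0e := c0;
  apply: filterS c0e => t; rewrite sub0r normrN => h; apply: le_trans h;
  rewrite distrC (ger0_norm (mulr_ge0 (nm_ge0 _) (nm_ge0 _))).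
- by have [+ _] := b t; rewrite ib raddfB.
- by have [_] := b t; rewrite ib raddfB.
Qed.

End inner_product.

(** * The harmonic oscillator *)

(** The shape in which Green's identity is used: u and v will be the derivatives of the Wronskians
    in the two directions, and the potential cancels in a - b. *)
Lemma Rintegral_eq_of_null d (T : measurableType d) (R : realType)
  (mu : {measure set T -> \bar R}) (a b u v : T -> R) :
  mu.-integrable setT (fun x => (a x)%:E) -> mu.-integrable setT (fun x => (b x)%:E) ->
  mu.-integrable setT (fun x => (u x)%:E) -> mu.-integrable setT (fun x => (v x)%:E) ->
  (forall x, a x - b x = - (u x + v x)) ->
  (\int[mu]_x (u x)%:E = 0)%E -> (\int[mu]_x (v x)%:E = 0)%E ->
  \int[mu]_x a x = \int[mu]_x b x.
Proof.
move=> ia ib iu iv E u0 v0; apply/eqP; rewrite -subr_eq0 -RintegralB//; apply/eqP.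
under eq_Rintegral do rewrite E -mulN1r.
rewrite RintegralZl//; last exact: (integrableD measurableT iu iv).
by rewrite RintegralD// /Rintegral u0 v0 addr0 mulr0.
Qed.

(** * Green's identity for compactly supported functions *)

Section compact_support.
Context {R : realType}.
Implicit Types (f g q : plane R -> R) (e x : plane R) (r : R).

Definition supported_in r f := forall x, r < `|x| -> f x = 0.

(** With the maximum norm, a function supported in a ball is supported in a square, which fits
    Fubini. *)
Lemma plane_norm x : `|x| = Num.max `|x.1| `|x.2|.
Proof. by []. Qed.

Lemma supported_derive r f e : supported_in r f -> supported_in r ('D_e f).
Proof.
move=> f0 x rx; rewrite (near_eq_derive (g := cst 0)) ?derive_cst//.
have : \forall y \near x, r < `|y|.
  have nc := @norm_continuous _ _ x; exact: (@cvgr_gt R _ _ _ _ _ nc _ rx).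
by apply: filterS => y /f0.
Qed.

Definition box r : set (plane R) := `[-r, r]%classic `*` `[-r, r]%classic.

Lemma box_norm r x : ~ box r x -> r < `|x|.
Proof.
move=> nb; rewrite ltNge plane_norm ge_max; apply/negP => /andP[h1 h2]; apply: nb.
by split; rewrite /= in_itv/= -ler_norml.
Qed.

Lemma measurable_box r : measurable (box r).
Proof. by apply: measurableX; exact: measurable_itv. Qed.

Lemma compact_support_bounded r f : continuous f -> supported_in r f ->
  exists M, forall x, `|f x| <= M.
Proof.
move=> cf f0.
have cb : compact (box r) by apply: compact_setX; exact: segment_compact.
have [M [_ HM]] := compact_bounded (continuous_compact (continuous_subspaceT cf) cb).
exists (Num.max 0 (M + 1)) => x; rewrite le_max.
have [xb|/box_norm/f0 ->] := pselect (box r x); last by rewrite normr0 lexx.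
by apply/orP; right; apply: (HM (M + 1) _ (f x)); [rewrite ltrDl|exists x].
Qed.

Lemma integrable_compact_support r f : continuous f -> supported_in r f ->
  (leb2 R).-integrable setT (EFin \o f).
Proof.
move=> cf f0; have [M fM] := compact_support_bounded cf f0.
have fr : f = f \_ (box r).
  apply/funext => x; rewrite patchE; case: ifPn => // /negP xb.
  by rewrite f0//; apply: box_norm => h; apply: xb; rewrite inE.
rewrite fr -restrict_EFin; apply: (integrable_mkcond _ (measurable_box r)).1.
have bfin : (leb2 R (box r) < +oo)%E.
  rewrite /leb2 [ltLHS]product_measure1E; [|exact: measurable_itv..].
  pose J : set R := `[- r, r]%classic.
  have lf : (lebesgue_measure J < +oo)%E.
    by rewrite lebesgue_measure_itv /=; case: ifP; rewrite ?ltry.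
  by rewrite lte_mul_pinfty// ge0_fin_numE.
apply: measurable_bounded_integrable => //.
- exact: measurable_box.
- by apply: measurable_funTS; exact: continuous2_measurable.
- exists M; split; first exact: num_real.
  by move=> x Mx y _ /=; rewrite (le_trans (fM y))// ltW.
Qed.

Lemma slice_integral0 r (h Q : R -> R) : continuous h ->
  (forall s : R, is_derive s (1 : R) Q (h s)) -> (forall s, r < `|s| -> Q s = 0) ->
  (forall s, r < `|s| -> h s = 0) -> (\int[@lebesgue_measure R]_s (h s)%:E = 0)%E.
Proof.
(* [b] exceeds r and is positive even when r is negative, so Q vanishes at both ends of [-b, b]. *)
move=> ch hQ Q0 h0; pose b := `|r| + 1.
have b0 : 0 < b by rewrite ltr_wpDl.
have rb : r < b by rewrite /b (le_lt_trans (ler_norm r))// ltrDl.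
rewrite (_ : (fun s => (h s)%:E) = (EFin \o h) \_ `[- b, b]%classic); last first.
  apply/funext => s; rewrite patchE; case: ifPn => // /negP sb /=.
  rewrite h0//; apply: (lt_trans rb); rewrite ltNge; apply/negP => h'; apply: sb.
  by rewrite inE/= in_itv/= -ler_norml.
rewrite -integral_mkcond (continuous_FTC2 (F := Q)).
- by rewrite !Q0 ?normrN ?ger0_norm ?ltW// subee.
- by have := b0; lra.
- exact: continuous_subspaceT.
- split; [by move=> x _; have [] := hQ x|
    by apply: cvg_at_right_filter; exact: is_derive_continuous (hQ _)|
    by apply: cvg_at_left_filter; exact: is_derive_continuous (hQ _)].
- by move=> x _; rewrite derive1E; have [_ ->] := hQ x.
Qed.

Lemma is_derive_slice1 f (s t : R) : derivable f (s, t) e1 ->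
  is_derive s (1 : R) (fun u => f (u, t)) ('D_e1 f (s, t)).
Proof.
have E : (fun h : R => h^-1 *: (((fun u => f (u, t)) \o shift s) (h *: (1 : R)) - f (s, t))) =
    (fun h : R => h^-1 *: ((f \o shift (s, t)) (h *: e1) - f (s, t))).
  apply/funext => h /=; congr (_ *: (f _ - _)).
  by rewrite /e1; congr pair; rewrite /= /GRing.scale/= ?mulr0 ?add0r.
by move=> df; split; rewrite /derivable /derive E.
Qed.

Lemma is_derive_slice2 f (s t : R) : derivable f (s, t) e2 ->
  is_derive t (1 : R) (fun u => f (s, u)) ('D_e2 f (s, t)).
Proof.
have E : (fun h : R => h^-1 *: (((fun u => f (s, u)) \o shift t) (h *: (1 : R)) - f (s, t))) =
    (fun h : R => h^-1 *: ((f \o shift (s, t)) (h *: e2) - f (s, t))).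
  apply/funext => h /=; congr (_ *: (f _ - _)).
  by rewrite /e2; congr pair; rewrite /= /GRing.scale/= ?mulr0 ?add0r.
by move=> df; split; rewrite /derivable /derive E.
Qed.

Lemma slice_norm1 (s t : R) : `|s| <= `|(s, t) : plane R|.
Proof. by rewrite plane_norm le_max lexx. Qed.

Lemma slice_norm2 (s t : R) : `|t| <= `|(s, t) : plane R|.
Proof. by rewrite plane_norm le_max lexx orbT. Qed.

Lemma slice_continuous1 (t : R) : continuous (fun s : R => (s, t) : plane R).
Proof.
move=> s; exact: (@cvg_pair _ _ _ (nbhs s) (nbhs s) (nbhs t) _ _ _
  (fun x : R => x) (fun=> t) cvg_id (cvg_cst t)).
Qed.

Lemma slice_continuous2 (t : R) : continuous (fun s : R => (t, s) : plane R).
Proof.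
move=> s; exact: (@cvg_pair _ _ _ (nbhs s) (nbhs t) (nbhs s) _ _ _
  (fun=> t) (fun x : R => x) (cvg_cst t) cvg_id).
Qed.

(** Integrating first along the direction of the derivative makes every slice the integral of the
    derivative of a compactly supported function. *)
Lemma integral_D1 r q : (forall x, derivable q x e1) -> continuous ('D_e1 q) ->
  supported_in r q -> (\int[leb2 R]_x ('D_e1 q x)%:E = 0)%E.
Proof.
move=> dq cq q0; have Dq0 := supported_derive e1 q0.
have iq := integrable_compact_support cq Dq0.
rewrite -[LHS](@integral21_prod_meas1 _ _ _ _ _ (@lebesgue_measure R) (@lebesgue_measure R) _ iq).
apply: integral0_eq => t _; rewrite /fubini_G.
apply: (@slice_integral0 r _ (fun s => q (s, t))).
- move=> s; apply: (@continuous_comp _ _ _ (fun s => (s, t) : plane R) ('D_e1 q)); last exact: cq.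
  exact: slice_continuous1.
- by move=> s; exact: is_derive_slice1.
- by move=> s rs; apply: q0; exact: lt_le_trans (slice_norm1 s t).
- by move=> s rs; apply: Dq0; exact: lt_le_trans (slice_norm1 s t).
Qed.

Lemma integral_D2 r q : (forall x, derivable q x e2) -> continuous ('D_e2 q) ->
  supported_in r q -> (\int[leb2 R]_x ('D_e2 q x)%:E = 0)%E.
Proof.
move=> dq cq q0; have Dq0 := supported_derive e2 q0.
have iq := integrable_compact_support cq Dq0.
rewrite -[LHS](@integral12_prod_meas1 _ _ _ _ _ (@lebesgue_measure R) (@lebesgue_measure R) _ iq).
apply: integral0_eq => t _; rewrite /fubini_F.
apply: (@slice_integral0 r _ (fun s => q (t, s))).
- move=> s; apply: (@continuous_comp _ _ _ (fun s => (t, s) : plane R) ('D_e2 q)); last exact: cq.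
  exact: slice_continuous2.
- by move=> s; exact: is_derive_slice2.
- by move=> s rs; apply: q0; exact: lt_le_trans (slice_norm2 t s).
- by move=> s rs; apply: Dq0; exact: lt_le_trans (slice_norm2 t s).
Qed.

(** In the derivative of f' g - f g' the products of first derivatives cancel. *)
Lemma wronskian_derive e f g : (forall x, derivable f x e) -> (forall x, derivable g x e) ->
  (forall x, derivable ('D_e f) x e) -> (forall x, derivable ('D_e g) x e) ->
  (forall x, derivable ('D_e f * g - f * 'D_e g) x e) /\
  'D_e ('D_e f * g - f * 'D_e g) = (fun x => 'D_e ('D_e f) x * g x - f x * 'D_e ('D_e g) x).
Proof.
move=> f1 g1 f2 g2; split=> [x|].
  by apply: derivableB; exact: derivableM.
apply/funext => x; rewrite deriveB; [|exact: derivableM..].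
rewrite (deriveM (f2 x) (g1 x)) (deriveM (f1 x) (g2 x)).
move: ('D_e ('D_e f) x) ('D_e ('D_e g) x) ('D_e f x) ('D_e g x) (f x) (g x).
by move=> a b c d h k; rewrite /GRing.scale/=; ring.
Qed.

Lemma supportedM r f g : supported_in r g -> supported_in r (f * g).
Proof. by move=> g0 x /g0 H; rewrite fctE H mulr0. Qed.

Lemma continuousM2 f g : continuous f -> continuous g -> continuous (fun x => f x * g x).
Proof. by move=> cf cg x; apply: cvgM; [exact: cf|exact: cg]. Qed.

Lemma continuousB2 f g : continuous f -> continuous g -> continuous (fun x => f x - g x).
Proof. by move=> cf cg x; apply: cvgB; [exact: cf|exact: cg]. Qed.

Lemma smooth_green r f g : smooth f -> smooth g -> supported_in r f -> supported_in r g ->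
  (\int[leb2 R]_x ('D_e1 ('D_e1 f) x * g x - f x * 'D_e1 ('D_e1 g) x)%:E = 0)%E /\
  (\int[leb2 R]_x ('D_e2 ('D_e2 f) x * g x - f x * 'D_e2 ('D_e2 g) x)%:E = 0)%E.
Proof.
move=> sf sg f0 g0.
have [[f1 f2 _ _] [g1 g2 _ _]] := (sf 1%N, sg 1%N).
have [[f11 _ _ _] [g11 _ _ _]] := (smooth_D1 sf 1%N, smooth_D1 sg 1%N).
have [[_ f22 _ _] [_ g22 _ _]] := (smooth_D2 sf 1%N, smooth_D2 sg 1%N).
have sup e : supported_in r ('D_e f * g - f * 'D_e g).
  by move=> x rx; rewrite !fctE (g0 x rx) (f0 x rx) mulr0 mul0r subrr.
split.
  have [dW EW] := wronskian_derive f1 g1 f11 g11.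
  have cW : continuous ('D_e1 ('D_e1 f * g - f * 'D_e1 g)).
    rewrite EW; exact: continuousB2
      (continuousM2 (smooth_cont (smooth_D1 (smooth_D1 sf))) (smooth_cont sg))
      (continuousM2 (smooth_cont sf) (smooth_cont (smooth_D1 (smooth_D1 sg)))).
  rewrite -[RHS](@integral_D1 r _ dW cW (sup e1)); apply: eq_integral => x _.
  by congr EFin; exact: esym (congr1 (fun h => h x) EW).
have [dW EW] := wronskian_derive f2 g2 f22 g22.
have cW : continuous ('D_e2 ('D_e2 f * g - f * 'D_e2 g)).
  rewrite EW; exact: continuousB2
    (continuousM2 (smooth_cont (smooth_D2 (smooth_D2 sf))) (smooth_cont sg))
    (continuousM2 (smooth_cont sf) (smooth_cont (smooth_D2 (smooth_D2 sg)))).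
rewrite -[RHS](@integral_D2 r _ dW cW (sup e2)); apply: eq_integral => x _.
by congr EFin; exact: esym (congr1 (fun h => h x) EW).
Qed.

Lemma continuous_Hop f : smooth f -> continuous (Hop_real f).
Proof.
move=> sf x; apply: cvgD.
  apply: cvgN; apply: cvgD.
    exact: smooth_cont (smooth_D1 (smooth_D1 sf)) x.
  exact: smooth_cont (smooth_D2 (smooth_D2 sf)) x.
apply: cvgM; last exact: smooth_cont.
by apply: cvgD; rewrite /= expr2; apply: cvgM; by [exact: cvg_fst|exact: cvg_snd].
Qed.

Lemma Hop_green r f g : smooth f -> smooth g -> supported_in r f -> supported_in r g ->
  \int[leb2 R]_x (Hop_real f x * g x) = \int[leb2 R]_x (f x * Hop_real g x).
Proof.
move=> sf sg f0 g0; have [G1 G2] := smooth_green sf sg f0 g0.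
have cH h k : smooth h -> smooth k -> supported_in r k ->
    (leb2 R).-integrable setT (fun x => (Hop_real h x * k x)%:E).
  move=> sh sk k0; apply: (@integrable_compact_support r (Hop_real h * k)).
    exact: continuousM2 (continuous_Hop sh) (smooth_cont sk).
  exact: supportedM.
have i1 := cH f g sf sg g0.
have i2 : (leb2 R).-integrable setT (fun x => (f x * Hop_real g x)%:E).
  by have := cH g f sg sf f0; under eq_fun do rewrite mulrC.
have c2 e h k : continuous ('D_e ('D_e h)) -> continuous ('D_e ('D_e k)) ->
    smooth h -> smooth k -> supported_in r h -> supported_in r k ->
    (leb2 R).-integrable setT (fun x => ('D_e ('D_e h) x * k x - h x * 'D_e ('D_e k) x)%:E).
  move=> ch ck sh sk h0 k0.
  apply: (@integrable_compact_support r ('D_e ('D_e h) * k - h * 'D_e ('D_e k))).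
    exact: continuousB2 (continuousM2 ch (smooth_cont sk)) (continuousM2 (smooth_cont sh) ck).
  by move=> x rx; rewrite !fctE (h0 x rx) (k0 x rx) mulr0 mul0r subrr.
have j1 := c2 e1 f g (smooth_cont (smooth_D1 (smooth_D1 sf)))
  (smooth_cont (smooth_D1 (smooth_D1 sg))) sf sg f0 g0.
have j2 := c2 e2 f g (smooth_cont (smooth_D2 (smooth_D2 sf)))
  (smooth_cont (smooth_D2 (smooth_D2 sg))) sf sg f0 g0.
apply: (Rintegral_eq_of_null i1 i2 j1 j2 _ G1 G2) => x; rewrite /Hop_real /laplacian.
move: ('D_e1 ('D_e1 f) x) ('D_e2 ('D_e2 f) x) ('D_e1 ('D_e1 g) x) ('D_e2 ('D_e2 g) x) (f x) (g x).
by move=> a b c d h k; ring.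
Qed.

End compact_support.

Section L2_criteria.
Context {R : realType}.
Local Notation mu := (leb2 R).
Implicit Types (u v w : plane R -> R[i]).

Lemma L2_of_integrable u : cmeasurable u ->
  mu.-integrable setT (fun x => (normc (u x) ^+ 2)%:E) -> L2 u.
Proof.
move=> [u1 u2] iu; split => //; rewrite /L2norm unlock.
under eq_integral => x _.
  rewrite abse_EFin poweR_EFin (ger0_norm (normc_ge0 _)) (@powR_mulrn _ _ 2) ?normc_ge0//.
  over.
rewrite -(fineK (integrable_fin_num measurableT iu)) poweR_EFin.
exact: ltry.
Qed.

Lemma normc_sq (z : R[i]) : normc z ^+ 2 = Re z ^+ 2 + Im z ^+ 2.
Proof. by case: z => a b /=; rewrite sqr_sqrtr// addr_ge0 ?sqr_ge0. Qed.

Lemma L2_ae u v : L2 u -> cmeasurable v -> {ae mu, forall x, u x = v x} -> L2 v.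
Proof.
move=> Lu mv uv; apply: L2_of_integrable => //.
have mn := measurable_normc mv; have mn' := measurable_normc (L2_cmeasurable Lu).
have /integrableP[_ iu] := L2_sq_integrable Lu.
have mm (w : plane R -> R[i]) : measurable_fun setT (fun x => normc (w x)) ->
    measurable_fun setT (fun x => (normc (w x) ^+ 2)%:E).
  by move=> mw; apply/measurable_EFinP; exact: measurable_funX.
apply/integrableP; split; first exact: mm.
rewrite (le_lt_trans _ iu)// le_eqVlt; apply/orP; left; apply/eqP.
apply: ae_eq_integral => //; try (apply: measurableT_comp => //; exact: mm).
by apply: filterS uv => x -> _.
Qed.

Lemma L2_compact_support u r : continuous (fun x => Re (u x)) -> continuous (fun x => Im (u x)) ->
  supported_in r (fun x => Re (u x)) -> supported_in r (fun x => Im (u x)) -> L2 u.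
Proof.
move=> c1 c2 s1 s2; apply: L2_of_integrable.
  by split; exact: continuous2_measurable.
under eq_fun do rewrite normc_sq.
apply: (@integrable_compact_support R r (fun x => Re (u x) ^+ 2 + Im (u x) ^+ 2)).
  by move=> x; apply: cvgD; rewrite expr2; under eq_fun do rewrite expr2;
    apply: cvgM; by [exact: c1|exact: c2].
by move=> x rx; rewrite (s1 x rx) (s2 x rx) expr0n addr0.
Qed.

End L2_criteria.

(** * Symmetry of the oscillator and orthogonality of its eigenspaces *)

Section symmetry.
Context {R : realType}.
Local Notation mu := (leb2 R).
Implicit Types (u v w z : plane R -> R[i]).

Lemma supported_Hop r (f : plane R -> R) : supported_in r f -> supported_in r (Hop_real f).
Proof.
move=> f0 x rx; rewrite /Hop_real /laplacian f0// mulr0 addr0.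
by rewrite !(supported_derive _ (supported_derive _ f0))// addr0 oppr0.
Qed.

Lemma test_supported u : test_function u -> exists r,
  supported_in r (fun x => Re (u x)) /\ supported_in r (fun x => Im (u x)).
Proof. by move=> [_ _ [r ur]]; exists r; split=> x /ur ->. Qed.

Lemma test_L2 u : test_function u -> L2 u.
Proof.
move=> tu; have [r [s1 s2]] := test_supported tu; case: tu => u1 u2 _.
by apply: (L2_compact_support _ _ s1 s2); exact: smooth_cont.
Qed.

Lemma test_Hop_L2 u : test_function u -> L2 (Hop u).
Proof.
move=> tu; have [r [s1 s2]] := test_supported tu; case: tu => u1 u2 _.
by apply: (L2_compact_support (r := r)); [exact: continuous_Hop|exact: continuous_Hop|
  exact: supported_Hop|exact: supported_Hop].
Qed.

Lemma ReMJ (a b : R[i]) : Re (a * b^*) = Re a * Re b + Im a * Im b.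
Proof. by case: a b => [? ?] [? ?] /=; rewrite mulrN opprK. Qed.

Lemma ImMJ (a b : R[i]) : Im (a * b^*) = Im a * Re b - Re a * Im b.
Proof. by case: a b => [? ?] [? ?] /=; rewrite mulrN addrC. Qed.

Lemma inner_Hop w z : test_function w -> test_function z -> inner (Hop w) z = inner w (Hop z).
Proof.
move=> tw tz; have [r1 [a1 b1]] := test_supported tw; have [r2 [c2 d2]] := test_supported tz.
case: tw tz => sa sb _ [sc sd _]; pose r := Num.max r1 r2.
have S f : supported_in r1 f -> supported_in r f.
  by move=> f0 x; rewrite /r gt_max => /andP[/f0].
have S' f : supported_in r2 f -> supported_in r f.
  by move=> f0 x; rewrite /r gt_max => /andP[_ /f0].
have cH h k : smooth h -> smooth k -> supported_in r k ->
    mu.-integrable setT (fun x => (Hop_real h x * k x)%:E).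
  move=> sh sk k0; apply: (@integrable_compact_support R r (Hop_real h * k)).
    exact: continuousM2 (continuous_Hop sh) (smooth_cont sk).
  exact: supportedM.
have cH' h k : smooth h -> smooth k -> supported_in r k ->
    mu.-integrable setT (fun x => (k x * Hop_real h x)%:E).
  by move=> sh sk k0; have := cH h k sh sk k0; under eq_fun do rewrite mulrC.
apply/eqP; rewrite eq_complex /inner /cintegral /=; apply/andP; split; apply/eqP.
  under eq_Rintegral do rewrite ReMJ /=.
  under [RHS]eq_Rintegral do rewrite ReMJ /=.
  rewrite RintegralD//; [|by apply: cH => //; exact: S'..].
  rewrite [RHS]RintegralD//; [|by apply: cH' => //; exact: S..].
  by rewrite !(Hop_green (r := r))//; by [exact: S|exact: S'].
under eq_Rintegral do rewrite ImMJ /=.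
under [RHS]eq_Rintegral do rewrite ImMJ /=.
rewrite RintegralB//; [|by apply: cH => //; exact: S'..].
rewrite [RHS]RintegralB//; [|by apply: cH' => //; exact: S..].
by rewrite !(Hop_green (r := r))//; by [exact: S|exact: S'].
Qed.

Lemma complex_ext (a b : R[i]) : Re a = Re b -> Im a = Im b -> a = b.
Proof. by case: a b => ? ? [? ?] /= -> ->. Qed.

Lemma inner_cvg_unique (w z : nat -> plane R -> R[i]) u u' v v' :
  (forall n, L2 (w n)) -> (forall n, L2 (z n)) -> L2 u -> L2 u' -> L2 v -> L2 v' ->
  (fun n => L2norm (fun x => w n x - u x)) @ \oo --> 0%E ->
  (fun n => L2norm (fun x => z n x - u' x)) @ \oo --> 0%E ->
  (forall n, inner (w n) v = inner (z n) v') -> inner u v = inner u' v'.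
Proof.
move=> Lw Lz Lu Lu' Lv Lv' wu zu' E.
have [h1 h2] := inner_cvg _ Lw Lu Lv wu.
have [h3 h4] := inner_cvg _ Lz Lu' Lv' zu'.
apply: complex_ext.
  move: h1; under eq_fun do rewrite E.
  by move=> h1; rewrite -(cvg_lim (@Rhausdorff R) h1) (cvg_lim (@Rhausdorff R) h3).
move: h2; under eq_fun do rewrite E.
by move=> h2; rewrite -(cvg_lim (@Rhausdorff R) h2) (cvg_lim (@Rhausdorff R) h4).
Qed.

(** The symmetry on test functions passes to the closed graph one argument at a time. Limits are
    taken in the first argument of [inner], so for the second one both sides are conjugated. *)
Lemma Hgraph_symmetric u u' v v' : Hgraph u u' -> Hgraph v v' -> inner u' v = inner u v'.
Proof.
move=> [Lu Lu' [w [tw wu Hw]]] [Lv Lv' [z [tz zv Hz]]].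
have Lw n := test_L2 (tw n); have LHw n := test_Hop_L2 (tw n).
have Lz n := test_L2 (tz n); have LHz n := test_Hop_L2 (tz n).
apply: (inner_cvg_unique LHw Lw Lu' Lu Lv Lv' Hw wu) => n.
rewrite (inner_conj Lv (LHw n)) (inner_conj Lv' (Lw n)); congr (_^*).
apply: (inner_cvg_unique Lz LHz Lv Lv' (LHw n) (Lw n) zv Hz) => k.
by rewrite (inner_conj (LHw n) (Lz k)) inner_Hop// -inner_conj.
Qed.

Lemma innerZr_real (a : R) u v : L2 u -> L2 v ->
  inner u (fun x => a%:C * v x) = a%:C * inner u v.
Proof.
move=> Lu Lv; rewrite (inner_conj (L2Z _ Lv) Lu) innerZl// (inner_conj Lv Lu).
by case: (inner v u) => p q; apply: complex_ext => /=; ring.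
Qed.

Lemma eigen_orthogonal N M u v : eigenfunction N u -> eigenfunction M v -> N != M ->
  inner u v = 0.
Proof.
move=> eu ev NM; have Lu := eigenfunction_L2 eu; have Lv := eigenfunction_L2 ev.
have := Hgraph_symmetric eu ev; rewrite innerZl// innerZr_real// => /eqP.
rewrite -subr_eq0 -mulrBl mulf_eq0 => /orP[|/eqP//].
rewrite -rmorphB /= => /eqP [] /eqP; rewrite subr_eq0 /eigenvalue_H eqr_nat.
by rewrite eqn_add2r eqn_mul2l /= (negbTE NM).
Qed.

Lemma eigenfunctionB N u v : eigenfunction N u -> eigenfunction N v ->
  eigenfunction N (fun x => u x - v x).
Proof.
move=> eu ev; have := eigenfunction_lin (-1) ev eu.
by congr eigenfunction; apply/funext => x; rewrite mulN1r addrC.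
Qed.

Lemma inner_self0 u : L2 u -> inner u u = 0 -> {ae mu, forall x, u x = 0}.
Proof.
move=> Lu; rewrite inner_self// => -[/eqP]; rewrite sqrf_eq0 => /eqP; exact: nm0_ae.
Qed.

Lemma eigenprojection_same N u p : eigenfunction N u -> eigenprojection N u p ->
  {ae mu, forall x, p x = u x}.
Proof.
move=> eu [ep up]; have e := eigenfunctionB eu ep.
have := inner_self0 (eigenfunction_L2 e) (up _ e).
by apply: filterS => x /eqP; rewrite subr_eq0 => /eqP.
Qed.

Lemma eigenprojection_other N M u p : eigenfunction N u -> N != M -> eigenprojection M u p ->
  {ae mu, forall x, p x = 0}.
Proof.
move=> eu NM [ep up]; have Lp := eigenfunction_L2 ep; apply: inner_self0 => //.
have := up p ep; rewrite innerB//; last exact: eigenfunction_L2 eu.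
by rewrite (eigen_orthogonal eu ep NM) sub0r => /eqP; rewrite oppr_eq0 => /eqP.
Qed.

End symmetry.

(** * The propagator and the trilinear term on an eigenspace *)

Section propagator_on_eigenspace.
Context {R : realType}.
Local Notation mu := (leb2 R).
Implicit Types (u v w z f q : plane R -> R[i]).

(** Only the term M = N of the spectral sum survives, so up to null sets the partial sums are
    constant beyond the index N. *)
Lemma propagator_eigen N tau u v : eigenfunction N u -> propagator tau u v ->
  {ae mu, forall x, v x = cis (tau * eigenvalue_H N) * u x}.
Proof.
move=> eu [Lu Lv [p [pP pv]]].
have Lp M : L2 (p M) by have [/eigenfunction_L2] := pP M.
pose c := cis (tau * eigenvalue_H N).
have pE : {ae mu, forall x, forall M, p M x = if M == N then u x else 0}.
  apply: ae_foralln => M; case: eqVneq => [->|MN].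
    exact: eigenprojection_same eu (pP N).
  by apply: eigenprojection_other eu _ (pP M); rewrite eq_sym.
pose S n x := \sum_(M < n) cis (tau * eigenvalue_H M) * p M x.
have LS n : L2 (S n) by apply: L2_sum => j.
have SE n : (N < n)%N -> L2norm (fun x => S n x - v x) = L2norm (fun x => c * u x - v x).
  move=> Nn; apply: L2norm_ae; [exact: L2B|by apply: L2B => //; exact: L2Z|].
  apply: filterS pE => x pE; congr (_ - _); rewrite /S (bigD1 (Ordinal Nn))//= pE eqxx.
  by rewrite big1 ?addr0// => j jN; rewrite pE ifF ?mulr0//; apply: contraNF jN => /eqP jN; apply/eqP/val_inj.
have L0 : L2norm (fun x => c * u x - v x) = 0%E.
  have : (fun n => L2norm (fun x => S (n + N.+1)%N x - v x)) @ \oo --> 0%E.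
    by rewrite (cvg_shiftn N.+1 (fun n => L2norm (fun x => S n x - v x))).
  under eq_fun do rewrite SE ?ltn_addl//.
  by move/cvg_lim => <-//; rewrite lim_cst.
have LB : L2 (fun x => c * u x - v x) by apply: L2B => //; exact: L2Z.
have := nm0_ae LB; rewrite /nm L0 => /(_ erefl); apply: filterS => x /eqP.
by rewrite subr_eq0 => /eqP.
Qed.

(** This handles the outer propagator: the cubic term may leave E_N, and only its pairings with E_N
    are tracked. *)
Lemma propagator_inner N tau f v q : eigenfunction N q -> propagator tau f v ->
  inner v q = cis (tau * eigenvalue_H N) * inner f q.
Proof.
move=> eq [Lf Lv [p [pP pv]]].
have Lp M : L2 (p M) by have [/eigenfunction_L2] := pP M.
have Lq := eigenfunction_L2 eq.
pose c := cis (tau * eigenvalue_H N).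
pose S n x := \sum_(M < n) cis (tau * eigenvalue_H M) * p M x.
have LS n : L2 (S n) by apply: L2_sum => j.
have SE n : (N < n)%N -> inner (S n) q = c * inner f q.
  move=> Nn; rewrite inner_sum// (bigD1 (Ordinal Nn))//= big1 ?addr0 => [|j jN].
    congr (_ * _); have [_ /(_ q eq)] := pP N; rewrite innerB// => /eqP.
    by rewrite subr_eq0 eq_sym => /eqP.
  have [ep _] := pP j; rewrite (eigen_orthogonal ep eq) ?mulr0//.
have pv' : (fun n => L2norm (fun x => S (n + N.+1)%N x - v x)) @ \oo --> 0%E.
  by rewrite (cvg_shiftn N.+1 (fun n => L2norm (fun x => S n x - v x))).
rewrite -innerZl//.
apply: (inner_cvg_unique (w := fun n => S (n + N.+1)%N) (z := fun n x => c * f x)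
  (u' := fun x => c * f x) _ _ _ _ _ _ pv') => //.
- by move=> n; exact: L2Z.
- exact: L2Z.
- have -> : (fun n : nat => L2norm (fun x => c * f x - c * f x)) = cst 0%E.
    by apply/funext => n; under eq_fun do rewrite subrr; exact: L2norm0.
  exact: cvg_cst.
- by move=> n; rewrite SE ?ltn_addl// innerZl.
Qed.

Definition cubic u : plane R -> R[i] := fun x => u x * u x * (u x)^*.

Lemma cisMJ (a : R) : cis a * (cis a)^* = 1.
Proof.
apply: complex_ext => /=; last by rewrite mulrN mulrC addNr.
by rewrite mulrN opprK -!expr2 cos2Dsin2.
Qed.

Lemma cisN (a : R) : cis (- a) = ((cis a)^*)%R.
Proof. by rewrite /cis cosN sinN. Qed.

Lemma cmeasurableM u v : cmeasurable u -> cmeasurable v -> cmeasurable (fun x => u x * v x).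
Proof.
move=> mu mv; have mJ : cmeasurable (fun x => (v x)^*).
  case: mv => v1 v2; split; first by under eq_fun do rewrite ReJ.
  by under eq_fun do rewrite ImJ; exact: measurableT_comp.
rewrite (_ : (fun x => _) = (fun x => u x * ((v x)^*)^*)); first exact: cmeasurable_mulJ.
by apply/funext => x; rewrite Num.Theory.conjCK.
Qed.

Lemma cmeasurable_cubic u : cmeasurable u -> cmeasurable (cubic u).
Proof. by move=> mu; apply: cmeasurable_mulJ => //; exact: cmeasurableM. Qed.

Lemma measure_window : lebesgue_measure (@window R) = (pi / 2)%:E.
Proof.
rewrite /window lebesgue_measure_itv /= lte_fin ifT; last by have := @pi_gt0 R; lra.
by rewrite -EFinB; congr EFin; field.
Qed.

Lemma measurable_window : measurable (@window R).
Proof. exact: measurable_itv. Qed.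

(** Let c be the phase of e^{i tau H} on E_N. The three inner propagators contribute conj c, conj c
    and c, the outer one c on the component in E_N; as |c| = 1, the pairings of the integrand with
    E_N do not depend on tau. The factor pi^2 is 2 pi times the length pi / 2 of the window. *)
Lemma trilinear_eigen N u w : eigenfunction N u -> CR_trilinear u u u w ->
  L2 (cubic u) /\ forall q, eigenfunction N q -> inner w q = (pi ^+ 2)%:C * inner (cubic u) q.
Proof.
move=> eu [Lw [G [aeG LG _ GP]]]; have Lu := eigenfunction_L2 eu.
have mc := cmeasurable_cubic (L2_cmeasurable Lu).
have step tau : (exists v1 v2 v3, [/\ propagator (- tau) u v1, propagator (- tau) u v2,
      propagator (- tau) u v3 & propagator tau (fun x => v1 x * v2 x * (v3 x)^*) (G tau)]) ->
    L2 (cubic u) /\ forall q, eigenfunction N q -> inner (G tau) q = inner (cubic u) q.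
  move=> [v1 [v2 [v3 [P1 P2 P3 P4]]]].
  pose c := cis (tau * eigenvalue_H N).
  have E : {ae mu, forall x, v1 x * v2 x * (v3 x)^* = c^* * cubic u x}.
    have := propagator_eigen eu P1; have := propagator_eigen eu P2.
    have := propagator_eigen eu P3; rewrite mulNr cisN -/c.
    apply: filterS3 => x -> -> ->; rewrite /cubic rmorphM /= Num.Theory.conjCK.
    rewrite (_ : _ * _ = c * c^* * (c^* * (u x * u x * (u x)^*))); last by ring.
    by rewrite cisMJ mul1r.
  have [LF _ _] := P4.
  have Lc : L2 (cubic u).
    apply: (L2_ae (L2Z c LF)) => //; apply: filterS E => x ->.
    by rewrite mulrA cisMJ mul1r.
  split=> // q eq; rewrite (propagator_inner eq P4).
  have -> : inner (fun x => v1 x * v2 x * (v3 x)^*) q = c^* * inner (cubic u) q.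
    rewrite -innerZl//; last exact: eigenfunction_L2 eq.
    apply: inner_ae => //; [exact: L2Z|exact: eigenfunction_L2 eq|exact: eigenfunction_L2 eq|].
    by apply: aeW.
  by rewrite mulrA cisMJ mul1r.
(* The window has positive measure, so some tau in it satisfies the almost everywhere condition; the
   square integrability of the cubic term is read off there. *)
have [tau wt Htau] : exists2 tau, window tau & exists v1 v2 v3,
    [/\ propagator (- tau) u v1, propagator (- tau) u v2,
      propagator (- tau) u v3 & propagator tau (fun x => v1 x * v2 x * (v3 x)^*) (G tau)].
  apply: contrapT => /forall2NP H; case: aeG => A [mA A0 sA].
  have : (lebesgue_measure (@window R) <= 0)%E.
    rewrite -A0; apply: le_measure; rewrite ?inE//; first exact: measurable_window.
    by move=> t wt; apply: sA => /= h; case: (H t) => [|]; [exact|apply; exact: h].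
  by rewrite measure_window lee_fin leNgt divr_gt0 ?pi_gt0.
have [Lc _] := step tau Htau; split => // q eq.
have [m1 m2 ->] := GP q (eigenfunction_L2 eq).
rewrite (@ae_cintegral _ _ _ lebesgue_measure window measurable_window _ (fun=> inner (cubic u) q)) //.
  have /= mw := congr1 fine measure_window.
  move: (inner (cubic u) q) => [a b]; rewrite /cintegral !Rintegral_cst; [|exact: measurable_window..].
  by apply: complex_ext; rewrite /= mw; field.
case: aeG => A [mA A0 sA]; exists A; split=> //; apply: subset_trans sA => t /= h1 h2.
by apply: h1 => wt'; have [_ ->] := step t (h2 wt').
Qed.

End propagator_on_eigenspace.

(** * The resonant field *)

Section complex_functions.
Context {R : realType} {I : finType}.
Implicit Types (f g : (I -> R) -> R[i]) (x : I -> R) (i : I).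

Lemma ReM (a b : R[i]) : Re (a * b) = Re a * Re b - Im a * Im b.
Proof. by case: a b => [? ?] [? ?]. Qed.

Lemma ImM (a b : R[i]) : Im (a * b) = Re a * Im b + Im a * Re b.
Proof. by case: a b => [? ?] [? ?]. Qed.

Lemma ReA (a b : R[i]) : Re (a + b) = Re a + Re b.
Proof. by case: a b => [? ?] [? ?]. Qed.

Lemma ImA (a b : R[i]) : Im (a + b) = Im a + Im b.
Proof. by case: a b => [? ?] [? ?]. Qed.

Definition cLip f := locLip (fun x => Re (f x)) /\ locLip (fun x => Im (f x)).

Lemma cLip_cst c : cLip (fun=> c).
Proof. by split; exact: locLip_cst. Qed.

Lemma cLipM f g : cLip f -> cLip g -> cLip (fun x => f x * g x).
Proof.
move=> [f1 f2] [g1 g2]; split.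
  apply: (locLip_ext (f := fun x => Re (f x) * Re (g x) + - (Im (f x) * Im (g x)))).
    by move=> x; rewrite ReM.
  by apply: locLipD; [|apply: locLipN]; exact: locLipM.
apply: (locLip_ext (f := fun x => Re (f x) * Im (g x) + Im (f x) * Re (g x))).
  by move=> x; rewrite ImM.
by apply: locLipD; exact: locLipM.
Qed.

Lemma cLipD f g : cLip f -> cLip g -> cLip (fun x => f x + g x).
Proof.
move=> [f1 f2] [g1 g2]; split.
  by apply: (locLip_ext _ (locLipD f1 g1)) => x; rewrite raddfD.
by apply: (locLip_ext _ (locLipD f2 g2)) => x; rewrite raddfD.
Qed.

Lemma cLipJ f : cLip f -> cLip (fun x => ((f x)^*)%R).
Proof.
move=> [f1 f2]; split; first by apply: (locLip_ext _ f1) => x; case: (f x).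
by apply: (locLip_ext _ (locLipN f2)) => x; case: (f x).
Qed.

Lemma cLip_sum J (s : seq J) (F : J -> (I -> R) -> R[i]) : (forall j, cLip (F j)) ->
  cLip (fun x => \sum_(j <- s) F j x).
Proof.
move=> lF; elim: s => [|j s IH].
  by under eq_fun do rewrite big_nil; exact: cLip_cst.
by under eq_fun do rewrite big_cons; exact: cLipD.
Qed.

Definition cpartial i f g := forall x s,
  is_derive s (1 : R) (fun t => Re (f (upd x i t))) (Re (g (upd x i s))) /\
  is_derive s (1 : R) (fun t => Im (f (upd x i t))) (Im (g (upd x i s))).

Lemma cpartial_ext i f g g' : (forall x, g x = g' x) -> cpartial i f g -> cpartial i f g'.
Proof. by move=> gg'; have -> : g' = g by apply/funext. Qed.

Lemma cpartial_cst i c : cpartial i (fun=> c) (fun=> 0).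
Proof. by move=> x s; split; exact: is_derive_cst. Qed.

Lemma cpartialD i f g f' g' : cpartial i f f' -> cpartial i g g' ->
  cpartial i (fun x => f x + g x) (fun x => f' x + g' x).
Proof.
move=> df dg x s; have [f1 f2] := df x s; have [g1 g2] := dg x s; split.
  rewrite raddfD (_ : (fun _ => _) = (fun t => Re (f (upd x i t))) + (fun t => Re (g (upd x i t)))).
    exact: is_deriveD.
  by apply/funext => t; rewrite raddfD.
rewrite raddfD (_ : (fun _ => _) = (fun t => Im (f (upd x i t))) + (fun t => Im (g (upd x i t)))).
  exact: is_deriveD.
by apply/funext => t; rewrite raddfD.
Qed.

Lemma cpartialM i f g f' g' : cpartial i f f' -> cpartial i g g' ->
  cpartial i (fun x => f x * g x) (fun x => f' x * g x + f x * g' x).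
Proof.
move=> df dg x s; have [f1 f2] := df x s; have [g1 g2] := dg x s; split.
  rewrite (_ : (fun _ => _) = (fun t => Re (f (upd x i t))) * (fun t => Re (g (upd x i t)))
     - (fun t => Im (f (upd x i t))) * (fun t => Im (g (upd x i t)))).
    apply: (is_derive_eq (is_deriveB (is_deriveM f1 g1) (is_deriveM f2 g2))).
    by rewrite ReA !ReM /GRing.scale/=; ring.
  by apply/funext => t; rewrite ReM.
rewrite (_ : (fun _ => _) = (fun t => Re (f (upd x i t))) * (fun t => Im (g (upd x i t)))
     + (fun t => Im (f (upd x i t))) * (fun t => Re (g (upd x i t)))).
  apply: (is_derive_eq (is_deriveD (is_deriveM f1 g2) (is_deriveM f2 g1))).
  by rewrite ImA !ImM /GRing.scale/=; ring.
by apply/funext => t; rewrite ImM.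
Qed.

Lemma cpartialJ i f f' : cpartial i f f' -> cpartial i (fun x => ((f x)^*)%R) (fun x => ((f' x)^*)%R).
Proof.
have E (z : R[i]) : Re (z^*)%R = Re z /\ Im (z^*)%R = - Im z by case: z.
move=> df x s; have [f1 f2] := df x s; split.
  rewrite (E _).1 (_ : (fun _ => _) = (fun t => Re (f (upd x i t))))//.
  by apply/funext => t; rewrite (E _).1.
rewrite (E _).2 (_ : (fun _ => _) = - (fun t => Im (f (upd x i t)))); first exact: is_deriveN.
by apply/funext => t; rewrite (E _).2.
Qed.

Lemma cpartial_sum i J (s : seq J) (F F' : J -> (I -> R) -> R[i]) :
  (forall j, cpartial i (F j) (F' j)) ->
  cpartial i (fun x => \sum_(j <- s) F j x) (fun x => \sum_(j <- s) F' j x).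
Proof.
move=> dF; elim: s => [|j s IH].
  rewrite (_ : (fun x => _) = fun=> 0); last by apply/funext => x; rewrite big_nil.
  rewrite (_ : (fun x => _) = fun=> 0); last by apply/funext => x; rewrite big_nil.
  exact: cpartial_cst.
rewrite (_ : (fun x => _) = (fun x => F j x + \sum_(j <- s) F j x)); last first.
  by apply/funext => x; rewrite big_cons.
rewrite (_ : (fun x => \sum_(j <- _ :: _) F' j x) = (fun x => F' j x + \sum_(j <- s) F' j x)).
  exact: cpartialD.
by apply/funext => x; rewrite big_cons.
Qed.

End complex_functions.

(** * The cubic field of a quartic Hamiltonian *)

Section quartic_hamiltonian.
Context {R : realType} {n : nat}.
Local Notation I := ('I_n * bool)%type.
Local Notation P := ('I_n * 'I_n)%type.
Implicit Types (x : I -> R) (k : 'I_n) (p q : P).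
(** [Q (a, b) (d, k)] stands for the integral of phi_a phi_b conj(phi_d phi_k); both hypotheses
    below are symmetries of that integral. *)
Variables (Q : P -> P -> R[i]) (c : R).
Hypothesis Qherm : forall p q, Q q p = ((Q p q)^*)%R.
Hypothesis Qsym : forall a b q, Q (a, b) q = Q (b, a) q.

Definition zc x k : R[i] := x (k, false) +i* x (k, true).

Definition cubic_form x k : R[i] :=
  \sum_(p : P) \sum_(d : 'I_n) Q p (d, k) * (zc x p.1 * zc x p.2 * ((zc x d)^*)%R).

(** The real and imaginary parts of -i c F_k, where F_k is [cubic_form x k]; this is the system i
    z_k' = c F_k. *)
Definition quartic_field (i : I) x : R :=
  if i.2 then - c * Re (cubic_form x i.1) else c * Im (cubic_form x i.1).

Definition unit_of (b : bool) : R[i] := if b then 'i else 1.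

Definition dzc (i : I) k : R[i] := (k == i.1)%:R * unit_of i.2.

Definition dcubic_form (i : I) x k : R[i] :=
  \sum_(p : P) \sum_(d : 'I_n) Q p (d, k) *
    ((dzc i p.1 * zc x p.2 + zc x p.1 * dzc i p.2) * ((zc x d)^*)%R
     + zc x p.1 * zc x p.2 * ((dzc i d)^*)%R).

Definition dquartic_field (i : I) x : R :=
  if i.2 then - c * Re (dcubic_form i x i.1) else c * Im (dcubic_form i x i.1).

Lemma cLip_zc k : cLip (fun x => zc x k).
Proof. by split; exact: locLip_coord. Qed.

Lemma cpartial_zc i k : cpartial i (fun x => zc x k) (fun=> dzc i k).
Proof.
move=> x s; rewrite /zc /dzc /=; case: i => j b /=.
have E b' : is_derive s (1 : R) (fun t => upd x (j, b) t (k, b')) ((k == j) && (b' == b))%:R.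
  rewrite /upd -pair_eqE /pair_eq /=; case: (_ && _); last exact: is_derive_cst.
  exact: is_derive_id.
have [E0 E1] := (E false, E true); split.
  apply: (is_derive_eq E0).
  by case: (k == j); case: b {E E0 E1}; rewrite /= ?mul1r ?mul0r ?subr0.
apply: (is_derive_eq E1).
by case: (k == j); case: b {E E0 E1}; rewrite /= ?mul1r ?mul0r ?addr0.
Qed.

Lemma cLip_cubic k : cLip (fun x => cubic_form x k).
Proof.
apply: cLip_sum => p; apply: cLip_sum => d; apply: cLipM; first exact: cLip_cst.
by apply: cLipM; [apply: cLipM|apply: cLipJ]; exact: cLip_zc.
Qed.

Lemma cLip_dcubic i k : cLip (fun x => dcubic_form i x k).
Proof.
apply: cLip_sum => p; apply: cLip_sum => d; apply: cLipM; first exact: cLip_cst.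
apply: cLipD; apply: cLipM.
- by apply: cLipD; apply: cLipM; by [exact: cLip_cst|exact: cLip_zc].
- by apply: cLipJ; exact: cLip_zc.
- by apply: cLipM; exact: cLip_zc.
- exact: cLip_cst.
Qed.

Lemma cpartial_cubic i k : cpartial i (fun x => cubic_form x k) (fun x => dcubic_form i x k).
Proof.
apply: cpartial_sum => p; apply: cpartial_sum => d.
have dz a := cpartial_zc i a.
apply: (cpartial_ext _ (cpartialM (cpartial_cst i (Q p (d, k)))
  (cpartialM (cpartialM (dz p.1) (dz p.2)) (cpartialJ (dz d))))) => x.
by rewrite mul0r add0r.
Qed.

(** The sum is the value of the Hermitian form Q on the vector of products z_a z_b, hence real. It
    expresses the conservation of |z|^2. *)
Lemma tangent_form x : Im (\sum_k (zc x k)^*%R * cubic_form x k) = 0.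
Proof.
set S := \sum_k _.
have SE : S = \sum_(p : P) \sum_(q : P) Q p q * ((zc x p.1 * zc x p.2) * ((zc x q.1 * zc x q.2)^*)%R).
  rewrite /S; under eq_bigr do rewrite mulr_sumr.
  rewrite exchange_big /=; apply: eq_bigr => p _.
  under eq_bigr do rewrite mulr_sumr.
  rewrite exchange_big /= pair_big /=; apply: eq_bigr => -[d k] _ /=.
  by rewrite rmorphM /=; ring.
have SJ : (S^*)%R = S.
  rewrite [in LHS]SE rmorph_sum /=; under eq_bigr do rewrite rmorph_sum /=.
  rewrite exchange_big /= SE; apply: eq_bigr => p _; apply: eq_bigr => q _.
  by rewrite !rmorphM /= -Qherm !conjCK; ring.
by move: SJ; case: S {SE} => a b /= [] h; lra.
Qed.

Lemma Qsymr a b p : Q p (a, b) = Q p (b, a).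
Proof. by rewrite (Qherm (a, b)) Qsym -Qherm. Qed.

(* Along the two real directions of z_k, the derivatives of cubic_form are
   e A + e^* B with e = 1, i, where A is real. *)
Lemma dcubic_formE x k : exists A B : R[i], Im A = 0 /\
  forall b, dcubic_form (k, b) x k = unit_of b * A + ((unit_of b)^*)%R * B.
Proof.
(* z_k occurs in either of the two unconjugated factors, and by [Qsym] each gives [A1]; the
   conjugated factor gives [B]. *)
pose A1 := \sum_(b : 'I_n) \sum_(d : 'I_n) Q (k, b) (d, k) * (zc x b * ((zc x d)^*)%R).
pose B := \sum_(p : P) Q p (k, k) * (zc x p.1 * zc x p.2).
exists (A1 + A1), B; split.
  (* Conjugation exchanges the two summation indices. *)
  have AJ : (A1^*)%R = A1.
    rewrite /A1 rmorph_sum /=; under eq_bigr do rewrite rmorph_sum /=.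
    rewrite exchange_big /=; apply: eq_bigr => a _; apply: eq_bigr => d _.
    rewrite !rmorphM /= -Qherm conjCK (Qsym a k) (Qsymr k d).
    by rewrite [X in _ * X]mulrC.
  by rewrite raddfD /=; move: AJ; case: A1 => a d /= [] h; lra.
move=> e; set u := unit_of e.
transitivity (\sum_(p : P) \sum_(d : 'I_n) (
   Q (p.1, p.2) (d, k) * ((p.1 == k)%:R * u * zc x p.2 * ((zc x d)^*)%R)
   + Q (p.1, p.2) (d, k) * ((p.2 == k)%:R * u * zc x p.1 * ((zc x d)^*)%R)
   + Q p (d, k) * (zc x p.1 * zc x p.2 * ((d == k)%:R * (u^*)%R)))).
  apply: eq_bigr => -[a' b'] _; apply: eq_bigr => d _.
  by rewrite /dzc /= -/u rmorphM /= rmorph_nat; ring.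
under eq_bigr do rewrite !big_split /=.
rewrite !big_split /=; congr (_ + _).
  rewrite mulrDr; congr (_ + _).
    rewrite /A1 -(pair_bigA _ (fun a b => \sum_(d : 'I_n) Q (a, b) (d, k) *
      ((a == k)%:R * u * zc x b * ((zc x d)^*)%R))) /= (bigD1 k)//= [X in _ + X]big1 ?addr0.
      rewrite mulr_sumr; apply: eq_bigr => b' _; rewrite mulr_sumr; apply: eq_bigr => d _.
      by rewrite eqxx /=; ring.
    move=> a /negbTE ak; rewrite big1// => b' _; rewrite big1// => d _.
    by rewrite ak !mul0r mulr0.
  rewrite /A1 -(pair_bigA _ (fun a b => \sum_(d : 'I_n) Q (a, b) (d, k) *
    ((b == k)%:R * u * zc x a * ((zc x d)^*)%R))) /= exchange_big /= (bigD1 k)//= [X in _ + X]big1 ?addr0.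
    rewrite mulr_sumr; apply: eq_bigr => b' _; rewrite mulr_sumr; apply: eq_bigr => d _.
    by rewrite eqxx /= Qsym; ring.
  move=> a /negbTE ak; rewrite big1// => b' _; rewrite big1// => d _.
  by rewrite ak !mul0r mulr0.
rewrite mulr_sumr; apply: eq_bigr => p _.
rewrite (bigD1 k)//= big1 ?addr0.
  by rewrite eqxx /=; ring.
by move=> d /negbTE dk; rewrite dk mul0r !mulr0.
Qed.

(** In the divergence the coordinates (k, false) and (k, true) contribute c Im (A + B) and -c Re (i
    A - i B): the B terms cancel, and 2 c Im A = 0 remains. Tangency is [tangent_form]. *)
Lemma quartic_spherical : spherical_field quartic_field dquartic_field.
Proof.
split.
- move=> [k [|]]; have [l1 l2] := cLip_cubic k; apply: locLipM => //; exact: locLip_cst.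
- move=> [k [|]]; have [l1 l2] := cLip_dcubic (k, true) k;
    have [l3 l4] := cLip_dcubic (k, false) k; apply: locLipM => //; exact: locLip_cst.
- move=> [k b] x s; have [d1 d2] := cpartial_cubic (k, b) k x s.
  rewrite /quartic_field /dquartic_field /=; case: b d1 d2 => d1 d2.
    have := @is_deriveZ _ _ _ (fun t => Re (cubic_form (upd x (k, true) t) k)) (- c) s 1 _ d1.
    by [].
  have := @is_deriveZ _ _ _ (fun t => Im (cubic_form (upd x (k, false) t) k)) c s 1 _ d2.
  by [].
- move=> x; rewrite -(pair_bigA _ (fun k b => dquartic_field (k, b) x)) big1// => k _.
  rewrite big_bool /dquartic_field /=; have [A [B [A0 E]]] := dcubic_formE x k.
  rewrite !E /unit_of; move: A0; case: A {E} => a1 a2 /= ->; case: B => b1 b2 /=; ring.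
- move=> x; transitivity (\sum_(i : I) x (i.1, i.2) * quartic_field (i.1, i.2) x).
    by apply: eq_bigr => -[].
  rewrite -(pair_bigA _ (fun k b => x (k, b) * quartic_field (k, b) x)) /=.
  transitivity (c * Im (\sum_k (zc x k)^*%R * cubic_form x k)); last by rewrite tangent_form mulr0.
  rewrite raddf_sum /= mulr_sumr; apply: eq_bigr => k _.
  rewrite big_bool /quartic_field /= /zc; case: (cubic_form x k) => a d /=; ring.
Qed.

End quartic_hamiltonian.

(** * Coordinates on the eigenspace *)

Section eigenspace_coordinates.
Context {R : realType} (N : nat) (phi : 'I_N.+1 -> Heigenspace R N).
Hypothesis ophi : orthonormal_basis phi.
Local Notation mu := (leb2 R).
Local Notation I := ('I_N.+1 * bool)%type.
Implicit Types (x : I -> R) (k : 'I_N.+1) (u v : Heigenspace R N).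

(** The normalisation of [gammaN], so that the coordinates of [gammaN] are the Gaussians
    themselves. *)
Definition alpha : R := (Num.sqrt N.+1%:R)^-1.

Lemma alpha_gt0 : 0 < alpha.
Proof. by rewrite invr_gt0 sqrtr_gt0 ltr0n. Qed.

Lemma eigenE u : eigenfunction N u. Proof. exact: svalP u. Qed.

Lemma eigenL2 u : L2 u. Proof. exact: eigenfunction_L2 (eigenE u). Qed.

Definition elt_fun x : plane R -> R[i] := fun y => alpha%:C * \sum_k zc x k * phi k y.

Lemma elt_funE x : elt_fun x = fun y => \sum_k (alpha%:C * zc x k) * phi k y.
Proof. by apply/funext => y; rewrite /elt_fun mulr_sumr; apply: eq_bigr => k _; rewrite mulrA. Qed.

Lemma elt_eigenfunction x : eigenfunction N (elt_fun x).
Proof.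
rewrite elt_funE.
exact: (eigenfunction_comb (fun k => alpha%:C * zc x k) (index_enum 'I_N.+1) (fun k => eigenE (phi k))).1.
Qed.

Definition elt x : Heigenspace R N := exist _ _ (elt_eigenfunction x).

(** Defined on all functions, so that it applies to the difference of two elements of the
    eigenspace. *)
Definition coord_of (w : plane R -> R[i]) : I -> R := fun i =>
  let c := (alpha^-1)%:C * inner w (phi i.1) in if i.2 then Im c else Re c.

Definition xi u : I -> R := coord_of u.

Lemma complex_eta (z : R[i]) : Re z +i* Im z = z. Proof. by case: z. Qed.

Lemma zc_coord w k : zc (coord_of w) k = (alpha^-1)%:C * inner w (phi k).
Proof. exact: complex_eta. Qed.

Lemma zc_inj x y : (forall k, zc x k = zc y k) -> x = y.
Proof. by move=> h; apply/funext => -[k [|]]; have := h k; rewrite /zc => -[]. Qed.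

Lemma alphaK (z : R[i]) : (alpha^-1)%:C * (alpha%:C * z) = z.
Proof. by rewrite mulrA -rmorphM /= mulVf ?mul1r// gt_eqF// alpha_gt0. Qed.

Lemma alphaVK (z : R[i]) : alpha%:C * ((alpha^-1)%:C * z) = z.
Proof. by rewrite mulrA -rmorphM /= mulfV ?mul1r// gt_eqF// alpha_gt0. Qed.

Lemma inner_comb (c : 'I_N.+1 -> R[i]) k :
  inner (fun y => \sum_j c j * phi j y) (phi k) = c k.
Proof.
rewrite inner_sum//; [|by move=> j; exact: eigenL2|exact: eigenL2].
by rewrite (bigD1 k)//= ophi.1 eqxx mulr1 big1 ?addr0// => j jk; rewrite ophi.1 (negbTE jk) mulr0.
Qed.

Lemma xi_elt x : xi (elt x) = x.
Proof.
apply: zc_inj => k; rewrite zc_coord.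
have -> : inner (elt x) (phi k) = alpha%:C * zc x k.
  by rewrite -[RHS](inner_comb (fun k => alpha%:C * zc x k)) -elt_funE.
exact: alphaK.
Qed.

(** Elements are functions, so [xi (elt x) = x] holds exactly, whereas [elt (xi u)] recovers u only
    up to a null set. *)
Lemma eigen_expand u : {ae mu, forall y, u y = elt_fun (xi u) y}.
Proof.
have [c uc] := ophi.2 u.
have Lc : L2 (fun y => \sum_k c k * phi k y) by apply: L2_sum => k; exact: eigenL2.
have cE k : c k = inner u (phi k).
  rewrite -[LHS](inner_comb c); apply: inner_ae => //; try exact: eigenL2.
  - by apply: filterS uc => y ->.
  - exact: aeW.
apply: filterS uc => y ->; rewrite elt_funE; apply: eq_bigr => k _.
by rewrite zc_coord alphaVK cE.
Qed.

Lemma coord_ae w w' : L2 w -> L2 w' -> {ae mu, forall y, w y = w' y} -> coord_of w = coord_of w'.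
Proof.
move=> Lw Lw' ww'; apply: zc_inj => k; rewrite !zc_coord; congr (_ * _).
by apply: inner_ae => //; [exact: eigenL2|exact: eigenL2|exact: aeW].
Qed.

Lemma zcB x y k : zc (fun i => x i - y i) k = zc x k - zc y k.
Proof. by rewrite /zc; apply/eqP; rewrite eq_complex /= !eqxx. Qed.

Lemma coordB u v : coord_of (fun y => u y - v y) = fun i => xi u i - xi v i.
Proof.
apply: zc_inj => k; rewrite zcB !zc_coord innerB; [by rewrite mulrBr|exact: eigenL2..].
Qed.

Lemma sq_zc x : (\sum_k zc x k * ((zc x k)^*)%R) = (sq x)%:C.
Proof.
rewrite /sq (eq_bigr (fun i : I => x (i.1, i.2) ^+ 2)); last by case.
rewrite -(pair_bigA _ (fun k b => x (k, b) ^+ 2)) /= rmorph_sum /=.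
apply: eq_bigr => k _; rewrite big_bool /zc; apply: complex_ext => /=; ring.
Qed.

Lemma nm_eigen u : nm u ^+ 2 = alpha ^+ 2 * sq (xi u).
Proof.
have Lu := eigenL2 u.
have Le : L2 (elt_fun (xi u)) := eigenL2 (elt (xi u)).
have : inner u u = (alpha ^+ 2 * sq (xi u))%:C.
  rewrite (@inner_ae _ u (elt_fun (xi u)) u u)//; [|exact: eigen_expand|exact: aeW].
  rewrite elt_funE inner_sum//; last by move=> j; exact: eigenL2.
  rewrite rmorphM /= -sq_zc mulr_sumr; apply: eq_bigr => k _.
  rewrite (inner_conj Lu (eigenL2 (phi k))).
  have -> : inner u (phi k) = alpha%:C * zc (xi u) k by rewrite zc_coord alphaVK.
  case: (zc (xi u) k) => a b; apply: complex_ext => /=; ring.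
by rewrite inner_self// => -[].
Qed.

Lemma L2norm_eigenB u v :
  L2norm (fun y => u y - v y) = (alpha * Num.sqrt (sq (fun i => xi u i - xi v i)))%:E.
Proof.
have eB := eigenfunctionB (eigenE u) (eigenE v).
rewrite (L2normE (eigenfunction_L2 eB)); congr EFin.
have := nm_eigen (exist _ _ eB); rewrite /xi /= coordB => h.
rewrite -[LHS]ger0_norm ?nm_ge0// -sqrtr_sqr h sqrtrM ?sqr_ge0// sqrtr_sqr ger0_norm//.
exact/ltW/alpha_gt0.
Qed.

Section interaction.
(** Supplied later by [cubic_L2], from the existence of the trilinear term along the flow. *)
Hypothesis cL2 : forall u, L2 (cubic u).

Local Notation P := ('I_N.+1 * 'I_N.+1)%type.

Definition Qfun (p q : P) : plane R -> R[i] :=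
  fun y => phi p.1 y * phi p.2 y * ((phi q.1 y * phi q.2 y)^*)%R.

Definition Qint (p q : P) : R[i] := cintegral mu setT (Qfun p q).

(** |u|^4 is the product of the moduli of |u|^2 u and u, both square integrable. *)
Lemma quartic_integrable u : mu.-integrable setT (fun y => (normc (u y) ^+ 4)%:E).
Proof.
have := L2_norm_mul (cL2 u) (eigenL2 u).
by congr (_.-integrable); apply/funext => y; rewrite /cubic !Normc.normcM normcJ; congr EFin; ring.
Qed.

(** A product of four moduli is at most the sum of their fourth powers. *)
Lemma Qintegrable p q : cintegrable mu setT (Qfun p q).
Proof.
have i k := quartic_integrable (phi k).
have i4 : mu.-integrable setT (fun y => (normc (phi p.1 y) ^+ 4 + normc (phi p.2 y) ^+ 4
    + (normc (phi q.1 y) ^+ 4 + normc (phi q.2 y) ^+ 4))%:E).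
  have A (a b : plane R -> R) : mu.-integrable setT (fun y => (a y)%:E) ->
      mu.-integrable setT (fun y => (b y)%:E) -> mu.-integrable setT (fun y => (a y + b y)%:E).
    by move=> ia ib; exact: (integrableD measurableT ia ib).
  exact: A _ _ (A _ _ (i p.1) (i p.2)) (A _ _ (i q.1) (i q.2)).
apply: (le_cintegrable measurableT _ i4).
  have c k := L2_cmeasurable (eigenL2 (phi k)).
  by apply: cmeasurable_mulJ; exact: cmeasurableM.
move=> y; rewrite /Qfun Normc.normcM normcJ !Normc.normcM.
have := normc_ge0 (phi p.1 y); have := normc_ge0 (phi p.2 y).
have := normc_ge0 (phi q.1 y); have := normc_ge0 (phi q.2 y).
move: (normc (phi p.1 y)) (normc (phi p.2 y)) (normc (phi q.1 y)) (normc (phi q.2 y)).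
move=> a b c d d0 c0 b0 a0.
have ab : a * b <= (a ^+ 2 + b ^+ 2) / 2 by have := sqr_ge0 (a - b); nra.
have cd : c * d <= (c ^+ 2 + d ^+ 2) / 2 by have := sqr_ge0 (c - d); nra.
apply: (le_trans (ler_pM (mulr_ge0 a0 b0) (mulr_ge0 c0 d0) ab cd)).
rewrite (exprM a 2 2) (exprM b 2 2) (exprM c 2 2) (exprM d 2 2).
have := sqr_ge0 a; have := sqr_ge0 b; have := sqr_ge0 c; have := sqr_ge0 d.
move: (a ^+ 2) (b ^+ 2) (c ^+ 2) (d ^+ 2) => A B C D ? ? ? ?.
have := sqr_ge0 (A - C); have := sqr_ge0 (A - D); have := sqr_ge0 (B - C); have := sqr_ge0 (B - D).
nra.
Qed.

Lemma Qint_herm p q : Qint q p = ((Qint p q)^*)%R.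
Proof.
rewrite /Qint -[RHS]cintegral_conj//; last exact: Qintegrable.
congr cintegral; apply/funext => y.
rewrite /Qfun; move: (phi p.1 y * phi p.2 y) (phi q.1 y * phi q.2 y) => [a b] [c d].
by apply: complex_ext => /=; ring.
Qed.

Lemma Qint_sym a b q : Qint (a, b) q = Qint (b, a) q.
Proof. by rewrite /Qint /Qfun /=; under eq_fun do rewrite [phi a _ * _]mulrC. Qed.

Lemma inner_cubic_elt x k :
  inner (cubic (elt x)) (phi k) = (alpha ^+ 3)%:C * cubic_form Qint x k.
Proof.
pose c (j : P * 'I_N.+1) := (alpha ^+ 3)%:C * (zc x j.1.1 * zc x j.1.2 * ((zc x j.2)^*)%R).
transitivity (\sum_(j : P * 'I_N.+1) c j * Qint j.1 (j.2, k)); last first.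
  rewrite /cubic_form mulr_sumr -(pair_bigA _ (fun p d => c (p, d) * Qint p (d, k))) /=.
  apply: eq_bigr => p _; rewrite mulr_sumr; apply: eq_bigr => d _.
  by rewrite /c /=; ring.
rewrite -cintegral_sum//; last by move=> j; exact: Qintegrable.
rewrite /inner; congr cintegral; apply/funext => y.
have aJ : ((alpha%:C)^*)%R = alpha%:C by exact: conjc_real.
rewrite /cubic /= /elt_fun !rmorphM /= aJ rmorph_sum /=.
set S := \sum_k0 _; set SJ := \sum_(i < N.+1) _.
transitivity ((alpha ^+ 3)%:C * (S * S * SJ) * ((phi k y)^*)%R).
  by rewrite rmorphXn /=; ring.
rewrite -(pair_bigA _ (fun p d => c (p, d) * Qfun p (d, k) y)) /=.
rewrite -(pair_bigA _ (fun a b => \sum_d c ((a, b), d) * Qfun (a, b) (d, k) y)) /=.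
have E : S * S * SJ = \sum_a \sum_b \sum_d
    (zc x a * phi a y) * (zc x b * phi b y) * ((zc x d * phi d y)^*)%R.
  rewrite /S big_distrlr /= mulr_suml; apply: eq_bigr => a _.
  by rewrite mulr_suml; apply: eq_bigr => b _; rewrite mulr_sumr.
rewrite E mulr_sumr mulr_suml; apply: eq_bigr => a _.
rewrite mulr_sumr mulr_suml; apply: eq_bigr => b _.
rewrite mulr_sumr mulr_suml; apply: eq_bigr => d _.
by rewrite /c /Qfun /= !rmorphM /=; ring.
Qed.

(** pi^2 comes from [trilinear_eigen]; alpha^3 from the cubic term and alpha^-1 from the coordinates
    leave alpha^2. *)
Definition field : I -> (I -> R) -> R := quartic_field Qint (pi ^+ 2 * alpha ^+ 2).
Definition dfield : I -> (I -> R) -> R := dquartic_field Qint (pi ^+ 2 * alpha ^+ 2).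

Lemma field_spherical : spherical_field field dfield.
Proof. by apply: quartic_spherical; [exact: Qint_herm|exact: Qint_sym]. Qed.

Lemma inner_cubic u k : inner (cubic u) (phi k) = (alpha ^+ 3)%:C * cubic_form Qint (xi u) k.
Proof.
rewrite -inner_cubic_elt; apply: inner_ae => //; try exact: eigenL2.
- by apply: filterS (eigen_expand u) => y uy; rewrite /cubic uy.
- exact: aeW.
Qed.

End interaction.
End eigenspace_coordinates.

Lemma is_derive_quotient (R : realType) (f : R -> R) (t d : R) :
  (fun h => h^-1 * (f (t + h) - f t)) @ 0^' --> d -> is_derive t (1 : R) f d.
Proof.
move=> H.
have L : (fun h : R => h^-1 *: ((f \o shift t) (h *: (1 : R)) - f t)) @ 0^' --> d.
  rewrite (_ : (fun h => _) = (fun h => h^-1 * (f (t + h) - f t)))//.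
  by apply/funext => h; rewrite /= /GRing.scale/= mulr1 (addrC t).
by split; [apply/cvg_ex; exists d|exact/cvg_lim].
Qed.

(** * The equation in coordinates *)

Section resonant_flow.
Context {R : realType} (N : nat) (phi : 'I_N.+1 -> Heigenspace R N).
Hypothesis ophi : orthonormal_basis phi.
Variable Phi : R -> Heigenspace R N -> Heigenspace R N.
Hypothesis hPhi : CR_flow Phi.
Local Notation mu := (leb2 R).
Local Notation I := ('I_N.+1 * bool)%type.
Local Notation xi := (@xi R N phi).
Local Notation elt := (@elt R N phi).

(** The solution at time 0 makes the trilinear term of [Phi 0 u] defined, hence its cubic term
    square integrable; this passes to u, which equals [Phi 0 u] almost everywhere. *)
Lemma cubic_L2 (u : Heigenspace R N) : L2 (cubic u).
Proof.
have [e0 /(_ 0) [_ [w [tri _]]]] := hPhi u.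
have [Lc _] := trilinear_eigen (eigenE (Phi 0 u)) tri.
apply: (L2_ae Lc).
  exact: cmeasurable_cubic (L2_cmeasurable (eigenL2 u)).
by apply: filterS e0 => y E; rewrite /cubic E.
Qed.

Local Notation X := (@field R N phi).

Lemma xi_Re u k : xi u (k, false) = (alpha N)^-1 * Re (inner u (phi k)).
Proof. by rewrite /xi /coord_of; move: (inner _ _) => [a b] /=; ring. Qed.

Lemma xi_Im u k : xi u (k, true) = (alpha N)^-1 * Im (inner u (phi k)).
Proof. by rewrite /xi /coord_of; move: (inner _ _) => [a b] /=; ring. Qed.

(** Pairing with phi_k turns the L^2 limit of the difference quotients into limits of real
    quotients. [D] carries the factor i, so the real part of its pairing gives the derivative of the
    imaginary coordinate with the opposite sign, and its imaginary part that of the real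
    coordinate. *)
Lemma resonant_curve u : curve (fun t => xi (Phi t u)) (fun t i => X i (xi (Phi t u))).
Proof.
move=> t [k b]; have [_ sol] := hPhi u.
have [_ [w [tri lim_w]]] := sol t.
have [_ /(_ _ (eigenE (phi k))) W] := trilinear_eigen (eigenE (Phi t u)) tri.
rewrite (inner_cubic ophi cubic_L2) in W.
have [Lw _] := tri.
pose D (h : R) (y : plane R) := 'i * ((h^-1)%:C * (Phi (t + h) u y - Phi t u y)).
have LB h : L2 (fun y => Phi (t + h) u y - Phi t u y) by apply: L2B; exact: eigenL2.
have LD h : L2 (D h) by do 2 apply: L2Z.
have ID h : inner (D h) (phi k) =
    'i * ((h^-1)%:C * (inner (Phi (t + h) u) (phi k) - inner (Phi t u) (phi k))).
  rewrite innerZl; [|by apply: L2Z|exact: eigenL2]; congr (_ * _).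
  rewrite innerZl//; last exact: eigenL2.
  by rewrite innerB//; exact: eigenL2.
have [cR cI] := inner_cvg _ LD Lw (eigenL2 (phi k)) lim_w.
have a0 : (alpha N : R) != 0 by rewrite gt_eqF//; exact: alpha_gt0.
apply: is_derive_quotient; rewrite /X /quartic_field /=; case: b.
- rewrite (_ : - _ * _ = - (alpha N)^-1 * Re (inner w (phi k))); last first.
    rewrite W; case: (cubic_form _ _ _) => p q /=.
    by rewrite !mul0r !subr0; field.
  rewrite (_ : (fun h : R => _) = (fun h => - (alpha N)^-1 * Re (inner (D h) (phi k)))).
    by apply: cvgM; [exact: cvg_cst|exact: cR].
  apply/funext => h; rewrite ID.
  by rewrite !xi_Im; move: (inner _ _) (inner _ _) => [p q] [r s] /=; ring.
- rewrite (_ : _ * _ = (alpha N)^-1 * Im (inner w (phi k))); last first.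
    rewrite W; case: (cubic_form _ _ _) => p q /=.
    by rewrite !mul0r !addr0; field.
  rewrite (_ : (fun h : R => _) = (fun h => (alpha N)^-1 * Im (inner (D h) (phi k)))).
    by apply: cvgM; [exact: cvg_cst|exact: cI].
  apply/funext => h; rewrite ID.
  by rewrite !xi_Re; move: (inner _ _) (inner _ _) => [p q] [r s] /=; ring.
Qed.

Definition coord_flow (t : R) (x : I -> R) : I -> R := xi (Phi t (elt x)).

Lemma xi_Phi0 u : xi (Phi 0 u) = xi u.
Proof. by apply: coord_ae; [exact: eigenL2|exact: eigenL2|exact: (hPhi u).1]. Qed.

Lemma coord_flow_of : flow_of X coord_flow.
Proof.
split=> x; first by rewrite /coord_flow xi_Phi0 xi_elt.
exact: resonant_curve (elt x).
Qed.

(** [u] and [elt (xi u)] may be different functions; uniqueness of curves in coordinates shows that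
    [Phi t] gives them the same coordinates. *)
Lemma xi_Phi t u : xi (Phi t u) = coord_flow t (xi u).
Proof.
have := flow_unique (@field_spherical R N phi cubic_L2) coord_flow_of (resonant_curve u) t.
by rewrite xi_Phi0.
Qed.

End resonant_flow.

(** * Invariance and recurrence on the eigenspace *)

Local Close Scope complex_scope.

Section open_approximation.
Context {R : realType} {I : finType}.
Implicit Types (x y : I -> R) (O : set (I -> R)).

(* The point 1 keeps the infimum meaningful when [O] is everything. *)
Definition open_penalty O n x : R :=
  inf ([set 1] `|` [set n%:R * l1dist x y | y in ~` O]).

Lemma open_penalty_lb O (n : nat) x :
  lbound ([set 1] `|` [set n%:R * l1dist x y | y in ~` O]) 0.
Proof.
move=> s [->|[y _ <-]]; first exact: ler01.
by rewrite mulr_ge0// l1dist_ge0.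
Qed.

Lemma open_penalty_ne O (n : nat) x :
  ([set 1] `|` [set n%:R * l1dist x y | y in ~` O]) !=set0.
Proof. by exists 1; left. Qed.

Lemma open_penalty_ge0 O n x : 0 <= open_penalty O n x.
Proof. by apply: lb_le_inf; [exact: open_penalty_ne|exact: open_penalty_lb]. Qed.

Lemma open_penalty_le O n x s : ([set 1] `|` [set n%:R * l1dist x y | y in ~` O]) s ->
  open_penalty O n x <= s.
Proof. by apply: ge_inf; exists 0; exact: open_penalty_lb. Qed.

Lemma open_penalty_le1 O n x : `|open_penalty O n x| <= 1.
Proof. by rewrite ger0_norm ?open_penalty_ge0//; apply: open_penalty_le; left. Qed.

Lemma open_penalty_lipschitz O n : lipschitz_with n%:R (open_penalty O n).
Proof.
have D x y : open_penalty O n x - n%:R * l1dist x y <= open_penalty O n y.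
  apply: lb_le_inf; first exact: open_penalty_ne.
  move=> s [->|[z Oz <-]].
    rewrite lerBlDr (@le_trans _ _ 1)//; first by apply: open_penalty_le; left.
    by rewrite lerDl mulr_ge0// l1dist_ge0.
  rewrite lerBlDl -mulrDr; apply: (@le_trans _ _ (n%:R * l1dist x z)).
    by apply: open_penalty_le; right; exists z.
  by rewrite ler_wpM2l// l1dist_triangle.
move=> x y; rewrite ler_norml; have := D x y; have := D y x; rewrite (l1distC y x).
by move=> *; apply/andP; split; lra.
Qed.

(** The penalty is min(1, n d), where d is the distance from x to the complement of O: it is 1 once
    n >= 1 / e, if the ball of radius e about x lies in O, and it is always 0 outside O. Bounded
    Lipschitz functions thus reach the indicator of any open set. *)
Lemma open_penalty_cvg O x : l1open O -> (fun n => open_penalty O n x) @ \oo --> (\1_O x : R).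
Proof.
move=> oO; rewrite indicE; case: (boolP (x \in O)) => [/set_mem Ox|/negP xO].
  have [e e0 eO] := oO _ Ox.
  apply: (@cvg_near_cst _ R^o); near=> n.
  apply/eqP; rewrite eq_le; apply/andP; split; first by apply: open_penalty_le; left.
  apply: lb_le_inf; first exact: open_penalty_ne.
  move=> s [->//|[y Oy <-]].
  have ey : e <= l1dist x y by rewrite leNgt; apply/negP => /eO.
  have ne : e^-1 <= n%:R.
    apply: (le_trans (ltW (archi_boundP (ltW (_ : 0 < e^-1))))); first by rewrite invr_gt0.
    by rewrite ler_nat; near: n; exact: nbhs_infty_ge.
  rewrite -[leLHS](mulVf (lt0r_neq0 e0)).
  by apply: ler_pM => //; rewrite ltW// invr_gt0.
apply: (@cvg_near_cst _ R^o 0); near=> n.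
apply/eqP; rewrite eq_le open_penalty_ge0 andbT; apply: open_penalty_le; right.
exists x; first by move=> Ox; apply: xO; exact/mem_set.
by rewrite /l1dist big1 ?mulr0// => i _; rewrite subrr normr0.
Unshelve. all: by end_near. Qed.

End open_approximation.

Lemma Rintegral_cvg_indic d (T : measurableType d) (R : realType) (P : probability T R)
    (h : nat -> T -> R) (A : set T) : measurable A ->
  (forall n, measurable_fun setT (h n)) -> (forall n w, `|h n w| <= 1) ->
  (forall w, (fun n => h n w) @ \oo --> (\1_A w : R)) ->
  (fun n => \int[P]_w h n w) @ \oo --> fine (P A).
Proof.
move=> mA mh h1 hA.
have -> : P A = (\int[P]_w (\1_A w)%:E)%E by rewrite integral_indic// setIT.
apply: fine_cvg.
have iA : (\int[P]_w (\1_A w)%:E)%E \is a fin_num.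
  by rewrite integral_indic// fin_num_measure// setIT.
rewrite fineK//.
apply: (@dominated_cvg _ _ _ P setT measurableT _ _ (EFin \o cst 1)) => //.
- by move=> n; exact/measurable_EFinP.
- by move=> w _; apply: cvg_EFin; [exact: nearW|exact: hA].
- by apply: (@bounded_integrable _ _ _ _ (cst 1) 1) => // w; rewrite normr1.
- by move=> n w _ /=; rewrite lee_fin.
Qed.

(** * Poincare recurrence and uniqueness of measures *)

Lemma poincare_recurrence d (T : measurableType d) (R : realType) (mu : probability T R)
    (f : T -> T) (A : set T) : measurable_fun setT f ->
  (forall B, measurable B -> mu (f @^-1` B) = mu B) -> measurable A ->
  {ae mu, forall x, A x -> forall m, exists2 n, (m <= n)%N & A (iter n f x)}.
Proof.
move=> mf muf mA.
have mI n B : measurable B -> measurable (iter n f @^-1` B) /\ mu (iter n f @^-1` B) = mu B.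
  elim: n => // n IH mB; have [m1 e1] := IH mB.
  rewrite (_ : iter n.+1 f @^-1` B = f @^-1` (iter n f @^-1` B)).
    by rewrite muf//; split=> //; rewrite -[X in measurable X]setTI; exact: mf.
  by apply/funext => x; rewrite /preimage /mkset iterSr.
(* The preimage of U under an iterate of f is a subset of U of the same measure. *)
pose U := \bigcup_n (iter n f @^-1` A).
have mU : measurable U by apply: bigcupT_measurable => n; exact: (mI n A mA).1.
(* The time m is moved in front of the condition A x, so that each m can be treated separately and
   the countably many null sets united. *)
suff H : {ae mu, forall x m, A x -> exists2 n, (m <= n)%N & A (iter n f x)}.
  by case: H => N [mN N0 sN]; exists N; split=> // x nx; apply: sN => h; apply: nx => Ax m; exact: h.
apply: ae_foralln => m; have [mV muV] := mI m _ mU.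
exists (U `\` (iter m f @^-1` U)); split; first exact: measurableD.
- rewrite measureD//; last by rewrite ltey_eq fin_num_measure.
  rewrite setIidr; last by move=> x [n _ /= An]; exists (n + m)%N => //=; rewrite iterD.
  by rewrite [X in (_ - X)%E]muV subee// fin_num_measure.
(* An exceptional point lies in A, hence in U with n = 0, and never visits A from time m on. *)
- move=> x /= nx; have Ax : A x by apply: contrapT => nA; apply: nx => /nA.
  split; first by exists 0%N.
  move=> [n _ /= An]; apply: nx => _; exists (n + m)%N; first exact: leq_addl.
  by rewrite iterD.
Qed.

Lemma preimage_measure_unique d (T : measurableType d) (R : realType) (mu : probability T R)
    (f : T -> T) (G : set (set T)) : measurable_fun setT f ->
  measurable = <<s G >> -> setI_closed G -> G setT ->
  (forall A, G A -> mu (f @^-1` A) = mu A) ->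
  forall A, measurable A -> mu (f @^-1` A) = mu A.
Proof.
move=> mf mG GI GT muf A mA.
pose nu := measure_function_pushforward__canonical__measure_function_Measure mu mf.
apply: (@measure_unique _ R _ G (fun=> setT) _ _ _ _ nu mu) => //.
- by rewrite bigcup_const//; exists 0%N.
- by move=> _; rewrite /nu /= /pushforward preimage_setT probability_setT ltry.
Qed.

Section flow_open.
Context {R : realType} {I : finType} (X DX : I -> (I -> R) -> R)
  (f : R -> (I -> R) -> I -> R).
Hypothesis (sX : spherical_field X DX) (fX : flow_of X f).

Lemma flow_l1open t (O : set (I -> R)) : l1open O -> l1open (f t @^-1` O).
Proof.
move=> oO x Ox; have [e e0 eO] := oO _ Ox.
have [r rP] := in_box_near x; have [C C0 HC] := flow_locally_lipschitz sX fX r t.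
have C1 : 0 < C + 1 by rewrite ltr_wpDl.
have xr : in_box r x by apply: rP; rewrite /l1dist big1// => i _; rewrite subrr normr0.
exists (Num.min 1 (e / (C + 1))); first by rewrite lt_min ltr01 divr_gt0.
move=> y; rewrite lt_min => /andP[y1 ye]; apply: eO.
apply: (le_lt_trans (HC _ _ xr (rP _ y1))).
rewrite ltr_pdivlMr// in ye; apply: le_lt_trans ye.
by rewrite mulrC ler_wpM2l ?l1dist_ge0// lerDl.
Qed.

End flow_open.

Section flow_invariance.
Context d (Omega : measurableType d) (R : realType) (P : probability Omega R)
  (n : nat) (g : 'I_n -> {RV P >-> plane R}).
Hypotheses (indep : independent_family g) (gauss : forall k, std_complex_gaussian (g k)).
Local Notation I := ('I_n * bool)%type.
Context (X DX : I -> (I -> R) -> R) (f : R -> (I -> R) -> I -> R).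
Hypothesis (sX : spherical_field X DX) (fX : flow_of X f).

(** For each penalty of O, [flow_expectation] equates the expectations at times t and 0; the limits
    of both sides are the two probabilities. *)
Lemma flow_probability t (O : set (I -> R)) : l1open O ->
  P [set w | O (f t (coords g w))] = P [set w | O (coords g w)].
Proof.
move=> oO.
have mO := l1open_measurable (measurable_coords g) oO.
have mfO := l1open_measurable (measurable_coords g) (flow_l1open sX fX (t := t) oO).
have lF m := lipschitz_locLip (ler0n R m) (open_penalty_le1 O m) (@open_penalty_lipschitz _ _ O m).
have lFf m := locLip_flow sX fX t (ler0n R m) (open_penalty_le1 O m)
  (@open_penalty_lipschitz _ _ O m).
have c1 := Rintegral_cvg_indic (P := P) mO
  (fun m => locLip_measurable (measurable_coords g) (lF m))
  (fun m w => open_penalty_le1 O m _) (fun w => open_penalty_cvg (x := coords g w) oO).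
have c2 := Rintegral_cvg_indic (P := P) mfO
  (fun m => locLip_measurable (measurable_coords g) (lFf m))
  (fun m w => open_penalty_le1 O m _) (fun w => open_penalty_cvg (x := f t (coords g w)) oO).
have E : (fun m => \int[P]_w open_penalty O m (coords g w)) =
    (fun m => \int[P]_w (open_penalty O m \o f t) (coords g w)).
  apply/funext => m; symmetry.
  exact: (flow_expectation indep gauss sX fX t ler01 (ler0n R m) (open_penalty_le1 O m)
    (@open_penalty_lipschitz _ _ O m)).
have c2' : (fun m => \int[P]_w open_penalty O m (coords g w)) @ \oo -->
    fine (P [set w | O (f t (coords g w))]) by rewrite E; exact: c2.
have E' := cvg_unique (@norm_hausdorff R R^o) c2' c1.
by rewrite -[LHS]fineK ?E' ?fineK ?fin_num_measure.
Qed.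

End flow_invariance.

(** * Transfer to the law on the eigenspace *)

Section invariance.
Context (R : realType) d (Omega : measurableType d) (P : probability Omega R) (N : nat)
  (phi : 'I_N.+1 -> Heigenspace R N) (g : 'I_N.+1 -> {RV P >-> plane R})
  (Phi : R -> Heigenspace R N -> Heigenspace R N).
Hypotheses (ophi : orthonormal_basis phi) (gauss : forall k, std_complex_gaussian (g k))
  (indep : independent_family g) (hPhi : CR_flow Phi).
Local Notation I := ('I_N.+1 * bool)%type.
Local Notation H := (Heigenspace R N).
Local Notation xi := (@xi R N phi).
Local Notation elt := (@elt R N phi).
Local Notation f := (@coord_flow R N phi Phi).
Let sX := @field_spherical R N phi (cubic_L2 hPhi).
Let fX := coord_flow_of ophi hPhi.

Lemma L2norm_le_l1dist (u v : H) :
  (L2norm (fun y => (u y - v y)%R) <= (l1dist (xi u) (xi v))%:E)%E.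
Proof.
rewrite (L2norm_eigenB ophi) lee_fin -[leRHS]mul1r ler_pM ?sqrtr_ge0//.
- exact/ltW/alpha_gt0.
- by rewrite /alpha invf_le1 ?sqrtr_gt0// -[leLHS]sqrtr1 ler_wsqrtr// ler1n.
- by rewrite -[leRHS]ger0_norm ?l1dist_ge0// -sqrtr_sqr ler_wsqrtr// sq_le_l1dist.
Qed.

(** The L^2 distance on the eigenspace is alpha times the Euclidean distance of the coordinates, so
    L^2 open sets are saturated for [xi]: they cannot separate functions that agree almost
    everywhere. *)
Lemma Heigenspace_openP (A : set H) : Heigenspace_open A <->
  exists2 O : set (I -> R), l1open O & A = xi @^-1` O.
Proof.
split=> [oA| [V oV ->] u Vu].
  have sat u v : A u -> xi v = xi u -> A v.
    move=> Au vu; have [e e0 eA] := oA _ Au; apply: eA.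
    apply: (le_lt_trans (L2norm_le_l1dist v u)).
    by rewrite vu /l1dist big1// => i _; rewrite subrr normr0.
  exists (elt @^-1` A).
    move=> x Ax; have [e e0 eA] := oA _ Ax; exists e => // y xy; apply: eA.
    apply: (le_lt_trans (L2norm_le_l1dist _ _)).
    by rewrite !xi_elt// l1distC lte_fin.
  by apply/seteqP; split => u /= Au; apply: (sat _ _ Au); rewrite xi_elt.
have [e e0 eO] := oV _ Vu.
pose a : R := alpha N; have a0 : 0 < a by exact: alpha_gt0.
(* sqrt m is the cost of passing from the Euclidean distance to [l1dist], by [l1dist_sq]. *)
pose m : R := #|{: I}|%:R; have m0 : 0 < m by rewrite ltr0n card_prod card_ord card_bool.
exists (a * (e / Num.sqrt m)).
  by rewrite mulr_gt0// divr_gt0// sqrtr_gt0.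
move=> v; rewrite (L2norm_eigenB ophi) lte_fin ltr_pM2l// ltr_pdivlMr ?sqrtr_gt0// => h.
apply: eO; rewrite l1distC; apply: le_lt_trans h; rewrite -sqrtrM ?sq_ge0//.
rewrite -[leLHS]ger0_norm ?l1dist_ge0// -sqrtr_sqr ler_wsqrtr// mulrC.
exact: l1dist_sq.
Qed.

Lemma xi_measurable (O : set (I -> R)) : l1open O -> measurable (xi @^-1` O).
Proof.
by move=> oO; apply: sub_sigma_algebra; apply/Heigenspace_openP; exists O.
Qed.

Lemma preimage_Phi t (O : set (I -> R)) : Phi t @^-1` (xi @^-1` O) = xi @^-1` (f t @^-1` O).
Proof. by apply/funext => u; rewrite /preimage /mkset (xi_Phi ophi hPhi). Qed.

Lemma Phi_measurable t : measurable_fun setT (Phi t).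
Proof.
apply: (measurability (@Heigenspace_open R N)) => // _ [_ /Heigenspace_openP[V oV ->] <-].
rewrite setTI preimage_Phi; apply: xi_measurable; exact: (flow_l1open sX fX (t := t) oV).
Qed.

(** [gammaN phi g w] and [elt (coords g w)] are the same function by computation. *)
Lemma xi_gammaN w : xi (gammaN phi g w) = coords g w.
Proof. by rewrite -[RHS](xi_elt ophi). Qed.

Lemma muN_xi (O : set (I -> R)) : muN phi g (xi @^-1` O) = P [set w | O (coords g w)].
Proof.
rewrite /muN /distribution /= /pushforward; congr (P _).
by apply/funext => w; rewrite /preimage /mkset /= xi_gammaN.
Qed.

Lemma Heigenspace_setI_closed : setI_closed (@Heigenspace_open R N).
Proof.
move=> A1 A2 /Heigenspace_openP[V1 oO1 ->] /Heigenspace_openP[V2 oO2 ->].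
apply/Heigenspace_openP; exists (V1 `&` V2) => // x [x1 x2].
have [e1 e10 h1] := oO1 _ x1; have [e2 e20 h2] := oO2 _ x2.
exists (Num.min e1 e2); first by rewrite lt_min e10.
by move=> y; rewrite lt_min => /andP[? ?]; split; [exact: h1|exact: h2].
Qed.

Lemma muN_open t (A : set H) : Heigenspace_open A ->
  muN phi g (Phi t @^-1` A) = muN phi g A.
Proof.
move=> /Heigenspace_openP[V oV ->]; rewrite preimage_Phi !muN_xi.
exact: (flow_probability indep gauss sX fX t oV).
Qed.

Lemma muN_invariant : invariant_measure (muN phi g) Phi.
Proof.
move=> t; split; first exact: Phi_measurable.
apply: (preimage_measure_unique (Phi_measurable t) _ Heigenspace_setI_closed).
- by [].
- by move=> u _; exists 1.
- by move=> A oA; exact: muN_open.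
Qed.

(** The group law is available in coordinates: as functions, an iterate of [Phi 1] and the map [Phi]
    at an integer time are only known to agree almost everywhere. *)
Lemma xi_iter n u : xi (iter n (Phi 1) u) = xi (Phi n%:R u).
Proof.
elim: n => [|n IH] /=; first by rewrite (xi_Phi0 _ hPhi).
rewrite (xi_Phi ophi hPhi) IH !(xi_Phi ophi hPhi).
by rewrite -(flow_add sX fX) -natr1 addrC.
Qed.

Lemma muN_recurrent : {ae muN phi g, forall u0, recurrent Phi u0}.
Proof.
pose A (c : {ffun I -> rat} * nat) : set H :=
  [set u | l1dist (xi u) (rat_point c.1) < c.2.+1%:R^-1].
have mA c : measurable (A c).
  apply: (@xi_measurable [set x | l1dist x (rat_point c.1) < c.2.+1%:R^-1]) => x /= xc.
  exists (c.2.+1%:R^-1 - l1dist x (rat_point c.1)); first by rewrite subr_gt0.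
  move=> y xy; apply: (le_lt_trans (l1dist_triangle y x _)).
  by rewrite l1distC -ltrBrDr.
have [mPhi invPhi] := muN_invariant 1.
(* The balls are enumerated by [unpickle], so that one null set serves them all. *)
have : {ae muN phi g, forall u (k : nat) c, unpickle k = Some c -> A c u ->
    forall m, exists2 n, (m <= n)%N & A c (iter n (Phi 1) u)}.
  apply: ae_foralln => k; case: (unpickle k) => [c|]; last by apply: aeW.
  have [B [mB B0 sB]] := poincare_recurrence mPhi invPhi (mA c).
  by exists B; split=> // u nu; apply: sB => h; apply: nu => _ [<-].
case=> B [mB B0 sB]; exists B; split=> // u nu; apply: sB => h; apply: nu.
(* u and its return lie in a common ball of radius 1 / (k + 1), and the return is sought at a time
   at least k: this yields both limits. *)
have ret k : exists2 n, (k <= n)%N & l1dist (xi (Phi n%:R u)) (xi u) < 2 / k.+1%:R.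
  have k0 : 0 < k.+1%:R^-1 :> R by rewrite invr_gt0.
  have [q qu] := rat_point_dense (xi u) k0.
  have [n kn An] := h (pickle (q, k)) (q, k) (pickleK _) qu k.
  exists n => //; rewrite -xi_iter.
  apply: (le_lt_trans (l1dist_triangle _ (rat_point q) _)).
  by rewrite mulr_natl mulr2n ltrD// l1distC.
have [t tP] := choice (fun k => let: ex_intro2 n a b := ret k in
  ex_intro (fun n => (k <= n)%N /\ l1dist (xi (Phi n%:R u)) (xi u) < 2 / k.+1%:R) n (conj a b)).
exists (fun k => (t k)%:R); split.
  apply/cvgryPge => M; near=> k.
  apply: (@le_trans _ _ k%:R); last by rewrite ler_nat (tP k).1.
  apply: (le_trans (ler_norm M)); apply: (le_trans (ltW (archi_boundP (normr_ge0 M)))).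
  by rewrite ler_nat; near: k; exact: nbhs_infty_ge.
apply: (@squeeze_cvge _ _ _ _ (fun=> 0%E) _ (fun k => (2 * k.+1%:R^-1)%:E)).
- apply: nearW => k; rewrite L2norm_ge0/=.
  by apply: (le_trans (L2norm_le_l1dist _ _)); rewrite lee_fin ltW// (tP k).2.
- exact: cvg_cst.
- apply: cvg_EFin; first exact: nearW.
  rewrite -[X in _ --> X](mulr0 2).
  by apply: cvgM; [exact: cvg_cst|exact: cvg_harmonic].
Unshelve. all: by end_near. Qed.

End invariance.

Theorem theorem2p2 (R : realType) (d : measure_display)
  (Omega : measurableType d) (P : probability Omega R) (N : nat)
  (phi : 'I_N.+1 -> Heigenspace R N) (g : 'I_N.+1 -> {RV P >-> plane R})
  (Phi : R -> Heigenspace R N -> Heigenspace R N) :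
  (1 <= N)%N ->
  orthonormal_basis phi ->
  (forall k, std_complex_gaussian (g k)) -> independent_family g ->
  CR_flow Phi ->
  invariant_measure (muN phi g) Phi /\
  {ae muN phi g, forall u0, recurrent Phi u0}.
Proof.
move=> _ ophi gauss indep hPhi.
by split; [exact: muN_invariant|exact: muN_recurrent].
Qed.
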